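(* For each $n$ let $h=h_n$ be a symmetric kernel (which can potentially change with $n$) and let $\mathcal{P}_{n,h}$ be a set of distributions associated with $h$. Suppose that any sequence of distributions $P_n\in\mathcal{P}_{n,h}$ satisfies (i) $\mathbb{E}_{P_n}[h(X,y)]=0$ (for $P_n$-almost every $y$) for each $n$, and (ii) as $n\to\infty$, $$\frac{\mathbb{E}_{P_n}[h^4(X_1,X_2)]\,n^{-1}+\mathbb{E}_{P_n}[h^2(X_1,X_3)h^2(X_2,X_3)]}{n\{\mathbb{E}_{P_n}[h^2(X_1,X_2)]\}^2}\to0 .$$ Then $$\sup_{P\in\mathcal{P}_{n,h}}\ \sup_{-\infty<z<\infty}\bigl|P(T_h\le z)-\Phi(z)\bigr|\to0\quad\text{as }n\to\infty .$$ In particular, $p_n=1-\Phi(T_h)$ is a dimension-agnostic $p$-value, i.e. $\limsup_{n\to\infty}\sup_{P\in\mathcal{P}_{n,h}}P(p_n\le\alpha)\le\alpha$ for any $\alpha\in[0,1]$, regardless of the behaviour of the intrinsic dimension $D_n$.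
   Context: $\Phi$ is the cumulative distribution function of $N(0,1)$. $X_1,\dots,X_n$ are i.i.d. from $P$, and $X,X_1,X_2,X_3$ inside expectations are i.i.d. from the indicated distribution. The kernel is assumed to have finite, positive second moment $\mathbb{E}_P[h^2(X_1,X_2)]$, so that it has the spectral decomposition $h(x,y)=\sum_{k\ge1}\lambda_k\phi_k(x)\phi_k(y)$, with $\lambda_k=\lambda_{k,n}$ and $\phi_k$ the eigenvalues and (orthonormal) eigenfunctions of $\mathbb{E}_P[h(X,y)f(X)]=\lambda f(y)$. The intrinsic dimension is $D_n=\sum_{k=1}^\infty\lambda_{k,n}^2=\mathbb{E}_P[h^2(X_1,X_2)]$. Let $m=\lfloor n/2\rfloor$, $f_h(x)=\frac1{n-m}\sum_{j=m+1}^{n}h(x,X_j)$, $\overline f_h=\frac1m\sum_{i=1}^{m}f_h(X_i)$, and $$T_h=\frac{\sqrt m\,\overline f_h}{\sqrt{m^{-1}\sum_{i=1}^{m}\{f_h(X_i)-\overline f_h\}^2}} .$$ (Any fixed convention may be used on the event where the denominator vanishes.) *)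

(* Defs.v *)
From HB Require Import structures.
From mathcomp Require Import all_boot all_order all_algebra.
From mathcomp Require Import all_classical all_reals all_analysis.

Set Implicit Arguments.
Unset Strict Implicit.
Unset Printing Implicit Defensive.

Import Order.TTheory GRing.Theory Num.Theory.
Import numFieldNormedType.Exports.

Local Open Scope classical_set_scope.
Local Open Scope ring_scope.

Section iid_sample.
Context d (T : measurableType d) (R : realType).

Definition tcons n (x : T * n.-tuple T) : n.+1.-tuple T :=
  [tuple of x.1 :: x.2].

Lemma measurable_tcons n : measurable_fun [set: T * n.-tuple T] (@tcons n).
Proof. exact: measurable_cons. Qed.

HB.instance Definition _ n :=
  isMeasurableFun.Build _ _ _ _ (@tcons n) (@measurable_tcons n).

(* The n-fold product measure, i.e. the joint law of X_1, ..., X_n i.i.d. from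
   P; [iid_law_rect] below checks that it is the product measure. *)
Fixpoint iid_law (P : probability T R) (n : nat) :
    probability (n.-tuple T) R :=
  match n with
  | 0 => \d_ [tuple]
  | n'.+1 => distribution (P \x iid_law P n')%E (@tcons n')
  end.

Lemma iid_law_rect (P : probability T R) n (A : 'I_n -> set T) :
  (forall i, measurable (A i)) ->
  iid_law P n [set x | forall i, A i (tnth x i)] = (\prod_(i < n) P (A i))%E.
Proof.
elim: n => [|n IH] in A * => mA.
  rewrite big_ord0 /= diracE mem_set//= => -[]//.
rewrite big_ord_recl -IH; last by move=> i; exact: mA.
rewrite /= /distribution /pushforward.
rewrite (_ : _ @^-1` _ =
  A ord0 `*` [set x : n.-tuple T | forall i, A (lift ord0 i) (tnth x i)]).
  rewrite product_measure1E//.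
  rewrite (_ : [set _ | _] =
    \bigcap_(i in [set: 'I_n]) ((@tnth _ T ^~ i) @^-1` A (lift ord0 i))).
    apply: fin_bigcap_measurable => // i _.
    by rewrite -[X in measurable X]setTI; exact: measurable_tnth.
  by apply/seteqP; split => x /= Hx i; [move=> _|]; exact: Hx.
apply/seteqP; split => [[x t] /= H|[x t] /= [Hx Ht] i].
  split; first exact: (H ord0).
  by move=> i; have := H (lift ord0 i); rewrite tnthS.
case: (unliftP ord0 i) => [j ->|->]; last by [].
by rewrite tnthS.
Qed.

End iid_sample.

Section statistic.
Context (T : Type) (R : realType) (h : T -> T -> R).
Context (n : nat) (X : n.-tuple T).

(* With 0-based indices, X_1, ..., X_m are the tnth X i with i < m and
   X_{m+1}, ..., X_n are the tnth X j with m <= j. *)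
Let m : nat := n./2.

Definition f_stat (x : T) : R :=
  (n - m)%:R^-1 * \sum_(j < n | (m <= j)%N) h x (tnth X j).

Definition fbar_stat : R :=
  m%:R^-1 * \sum_(i < n | (i < m)%N) f_stat (tnth X i).

(* When the denominator vanishes, T_stat is 0 (division by zero). *)
Definition T_stat : R :=
  Num.sqrt m%:R * fbar_stat /
  Num.sqrt (m%:R^-1 *
    \sum_(i < n | (i < m)%N) (f_stat (tnth X i) - fbar_stat) ^+ 2).

End statistic.

Definition Phi (R : realType) (z : R) : R := fine (normal_prob 0 1 `]-oo, z]).

Section moments.
Context d (T : measurableType d) (R : realType) (P : probability T R).
Context (h : T -> T -> R).
Local Open Scope ereal_scope.

(* E_P[h^2(X_1, X_2)], which is also the intrinsic dimension: the sum of the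
   squared eigenvalues of h under P *)
Definition moment2 : \bar R := \int[P \x P]_w (h w.1 w.2 ^+ 2)%:E.

(* E_P[h^4(X_1, X_2)] *)
Definition moment4 : \bar R := \int[P \x P]_w (h w.1 w.2 ^+ 4)%:E.

(* E_P[h^2(X_1, X_3) h^2(X_2, X_3)], with w = ((X_1, X_2), X_3) *)
Definition moment22 : \bar R :=
  \int[(P \x P) \x P]_w (h w.1.1 w.2 ^+ 2 * h w.1.2 w.2 ^+ 2)%:E.

End moments.

Definition moment_ratio d (T : measurableType d) (R : realType)
    (P : probability T R) (h : T -> T -> R) (n : nat) : \bar R :=
  ((moment4 P h * n%:R%:E^-1 + moment22 P h)
   / (n%:R%:E * moment2 P h ^+ 2))%E.

(* Main.v *)
Require Import Defs.
From HB Require Import structures.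
From mathcomp Require Import all_boot all_order all_algebra.
From mathcomp Require Import all_classical all_reals all_analysis.
From mathcomp Require Import measurable_realfun.
From mathcomp Require Import ring lra zify.

Import Order.TTheory GRing.Theory Num.Theory.
Import numFieldNormedType.Exports.

Local Open Scope classical_set_scope.
Local Open Scope ring_scope.

Set Implicit Arguments.
Unset Strict Implicit.
Unset Printing Implicit Defensive.

(** Write [n = m + k] for the two halves of the sample.  Once the second half [t]
    is fixed, the statistic is the studentized mean of [f X_1, ..., f X_m], where
    [f x] is the average of [h x t_j] over [j] ([T_stat_cat]).  These variables are
    independent and identically distributed, and centred because the kernel is
    degenerate, so a central limit theorem for studentized sums applies whenever
    their fourth moment is small compared to [m] times their squared variance
    ([studentized_clt]).  The error in that theorem depends on nothing else, so it
    may be integrated over [t]; what is left is to show that the ratio is small for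
    most [t].

    Its numerator is controlled in mean.  The fourth moment of a sum of independent
    centred variables is explicit ([tsum_cov_sqr]), and its expectation over [t] is
    bounded by the two moments in the numerator of [moment_ratio]
    ([cmean_pow4_mean]).

    Its denominator is the conditional variance [cvar].  It is a degenerate
    quadratic form in [t] whose limit law may be any weighted sum of chi-squares, so
    it does not concentrate in general; but it only has to be rarely small compared
    to its mean ([cvar_anticoncentration]).  Let [gram x y] be the inner product of
    the sections [h x] and [h y].  Up to a vanishing term, the variance of [cvar]
    relative to its squared mean is of the order of [gamma / m2 ^+ 2], where [gamma]
    is the second moment of [gram] and [m2] that of [h].  If this ratio is small,
    Chebyshev's inequality suffices.  Otherwise averaging over [x] produces a section
    [h x] such that the normalised sum of [gram x t_j], whose square bounds [cvar]
    from below by the Cauchy-Schwarz inequality, has a variance of the same order as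
    the mean of [cvar].  By the central limit theorem this sum is nearly Gaussian,
    hence rarely small.  Both bounds are free of the eigenvalues of the kernel, so
    the intrinsic dimension may behave arbitrarily.

    The central limit theorem itself ([clt]) is proved by Lindeberg's replacement of
    the summands by Gaussian variables, one at a time, inside a smooth step function
    with bounded third derivative; this needs the first two moments of the normal
    law ([gauss_moments]) and its stability under convolution
    ([gauss_convolution]).  Studentization is harmless because the sample variance
    concentrates ([sample_variance_concentration]) and the normal distribution
    function changes little when its argument is rescaled ([Phi_rescale]).

    The hypotheses hold for almost every section of the kernel only.  Erasing a null
    set of sections makes them hold everywhere without changing the law of the
    statistic ([regularise], [pr_T_stat_erase]).  Since the resulting bound for one
    distribution depends on the moment ratio alone ([T_stat_clt]), it is uniform:
    a ratio that vanishes along every sequence of distributions vanishes uniformly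
    ([uniform_of_sequences]).  The statement on p-values then follows through the
    quantiles of the normal law ([p_value_le]). *)

Local Notation integrableR P f := (P.-integrable [set: _] (EFin \o f)).

(** * Integrals of real functions against a probability *)

Section expectation.
Context d (T : measurableType d) (R : realType) (P : probability T R).
Implicit Types f g : T -> R.

Lemma integrableR_meas f : integrableR P f -> measurable_fun [set: T] f.
Proof. by move=> /measurable_int /measurable_EFinP. Qed.

Lemma integrableR_dom f g : measurable_fun [set: T] f ->
  (forall x, `|f x| <= g x) -> integrableR P g -> integrableR P f.
Proof.
move=> mf fg; apply: le_integrable => //; first exact/measurable_EFinP.
by move=> x _ /=; rewrite lee_fin (le_trans (fg x))// ler_norm.
Qed.

Lemma integrableR_cst c : integrableR P (fun=> c).
Proof. exact: finite_measure_integrable_cst. Qed.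

Lemma integrableR_add f g : integrableR P f -> integrableR P g ->
  integrableR P (fun x => f x + g x).
Proof. by move=> fi gi; apply: (@integrableD _ _ _ P _ _ (EFin \o f) (EFin \o g)). Qed.

Lemma integrableR_sub f g : integrableR P f -> integrableR P g ->
  integrableR P (fun x => f x - g x).
Proof. by move=> fi gi; apply: (@integrableB _ _ _ P _ _ (EFin \o f) (EFin \o g)). Qed.

Lemma integrableR_scale c f : integrableR P f -> integrableR P (fun x => c * f x).
Proof. by move=> fi; apply: (@integrableZl _ _ _ P _ _ c (EFin \o f)). Qed.

(** Finite linear combinations are given as lists of pairs of a coefficient and a
    function, so that expanded polynomials integrate in one step. *)
Lemma integrableR_lin (s : seq (R * (T -> R))) :
  (forall u, u \in [seq i.2 | i <- s] -> integrableR P u) ->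
  integrableR P (fun x => \sum_(i <- s) i.1 * i.2 x) /\
  \int[P]_x (\sum_(i <- s) i.1 * i.2 x) = \sum_(i <- s) i.1 * \int[P]_x i.2 x.
Proof.
elim: s => [_|[c f] s IH H].
  split; first by under eq_fun do rewrite big_nil; exact: integrableR_cst.
  rewrite big_nil; under eq_Rintegral do rewrite big_nil.
  by rewrite Rintegral_cst// mul0r.
have [|Is Es] := IH; first by move=> u us; apply: H; rewrite /= inE us orbT.
have If : integrableR P f by apply: H; rewrite /= inE eqxx.
split.
  under eq_fun do rewrite big_cons /=.
  by apply: integrableR_add => //; exact: integrableR_scale.
rewrite big_cons/= -Es -RintegralZl// -RintegralD//; last exact: integrableR_scale.
by apply: eq_Rintegral => x _; rewrite big_cons.
Qed.

Lemma Rintegral_prob_cst c : \int[P]_x c = c.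
Proof.
rewrite Rintegral_cst// -[RHS]mulr1; congr (_ * _).
by rewrite [X in fine X](_ : _ = 1%E)//; exact: probability_setT.
Qed.

Lemma EFin_Rintegral f : integrableR P f ->
  (\int[P]_x (f x)%:E)%E = (\int[P]_x f x)%:E.
Proof. by move=> If; rewrite /Rintegral fineK//; exact: integrable_fin_num. Qed.

Lemma ge0_integrableR f : measurable_fun [set: T] f -> (forall x, 0 <= f x) ->
  (\int[P]_x (f x)%:E < +oo)%E -> integrableR P f.
Proof.
move=> mf f0 foo; apply/integrableP; split; first exact/measurable_EFinP.
by under eq_integral do rewrite /= ger0_norm//.
Qed.

Lemma integrableR_bounded f c : measurable_fun [set: T] f ->
  (forall x, `|f x| <= c) -> integrableR P f.
Proof. by move=> mf fc; apply: (integrableR_dom mf fc); exact: integrableR_cst. Qed.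

Lemma integrableR_mul f g : measurable_fun [set: T] f -> measurable_fun [set: T] g ->
  integrableR P (fun x => f x ^+ 2) -> integrableR P (fun x => g x ^+ 2) ->
  integrableR P (fun x => f x * g x).
Proof.
move=> mf mg If Ig; apply: (@integrableR_dom _ (fun x => f x ^+ 2 + g x ^+ 2)).
- exact: measurable_funM.
- move=> x; rewrite normrM -(real_normK (num_real (f x))).
  rewrite -(real_normK (num_real (g x))).
  have := normr_ge0 (f x); have := normr_ge0 (g x); nra.
- exact: integrableR_add.
Qed.

Lemma le_Rintegral_prob f g : integrableR P f -> integrableR P g ->
  (forall x, f x <= g x) -> \int[P]_x f x <= \int[P]_x g x.
Proof. by move=> If Ig fg; apply: le_Rintegral. Qed.

(** The quadratic form [t |-> E (f - t g)^2] is nonnegative; its value at the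
    vertex, cleared of denominators, is the inequality. *)
Lemma Cauchy_Schwarz f g : measurable_fun [set: T] f -> measurable_fun [set: T] g ->
  integrableR P (fun x => f x ^+ 2) -> integrableR P (fun x => g x ^+ 2) ->
  (\int[P]_x (f x * g x)) ^+ 2 <= (\int[P]_x (f x ^+ 2)) * (\int[P]_x (g x ^+ 2)).
Proof.
move=> mf mg If Ig; have Ifg := integrableR_mul mf mg If Ig.
set A := \int[P]_x (f x ^+ 2); set B := \int[P]_x (g x ^+ 2).
set C := \int[P]_x (f x * g x).
have Q t : 0 <= A - 2 * t * C + t ^+ 2 * B.
  have [|_] := @integrableR_lin [:: (1, fun x => f x ^+ 2);
    (- (2 * t), fun x => f x * g x); (t ^+ 2, fun x => g x ^+ 2)].
    by move=> u; rewrite /= !inE => /or3P[]/eqP->.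
  rewrite !big_cons !big_nil/= -/A -/B -/C => E.
  have -> : A - 2 * t * C + t ^+ 2 * B =
            1 * A + (- (2 * t) * C + (t ^+ 2 * B + 0)) by ring.
  rewrite -E; apply: Rintegral_ge0 => x _; rewrite !big_cons big_nil/=.
  rewrite [leRHS](_ : _ = (f x - t * g x) ^+ 2) ?sqr_ge0//; ring.
have B0 : 0 <= B by apply: Rintegral_ge0 => x _; exact: sqr_ge0.
have [B_eq0|B_neq0] := eqVneq B 0; last first.
  have Bgt : 0 < B by rewrite lt_def B_neq0.
  have := Q (C / B); rewrite [X in 0 <= X](_ : _ = (A * B - C ^+ 2) / B); last first.
    by field.
  by rewrite pmulr_lge0 ?invr_gt0// subr_ge0.
have [->|C0] := eqVneq C 0; first by rewrite B_eq0 mulr0 expr0n.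
have := Q ((A + 1) / (2 * C)); rewrite B_eq0 mulr0 addr0.
rewrite [X in 0 <= X](_ : _ = -1) ?oppr_ge0 ?ler10//.
by field.
Qed.

End expectation.

(** * A smooth step with bounded third derivative *)

Section third_order_remainder.
Context {R : realType}.
Implicit Types (r x K : R).

Lemma mvt_power_bound (r r1 : R -> R) x K k : 0 <= K ->
  (forall y : R, is_derive y 1 r (r1 y)) -> r 0 = 0 ->
  (forall y, `|y| <= `|x| -> `|r1 y| <= K * `|y| ^+ k) ->
  forall y, `|y| <= `|x| -> `|r y| <= K * `|y| ^+ k.+1.
Proof.
move=> K0 dr r0 r1K y yx.
have rc : continuous r.
  by move=> z; apply/differentiable_continuous/derivable1_diffP; case: (dr z).
suff [c cy ->] : exists2 c, `|c| <= `|y| & r y = r1 c * y.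
  rewrite normrM exprSr mulrA ler_wpM2r//.
  apply: (le_trans (r1K _ (le_trans cy yx))).
  by apply: ler_wpM2l => //; rewrite lerXn2r ?nnegrE.
have [y0|y0] := leP 0 y.
  have [c] := @MVT_segment _ r r1 0 y y0 (fun z _ => dr z)
    (continuous_subspaceT rc).
  rewrite in_itv/= r0 !subr0 => /andP[c0 cy] E; exists c => //.
  by rewrite !ger0_norm.
have [c] := @MVT_segment _ r r1 y 0 (ltW y0) (fun z _ => dr z)
    (continuous_subspaceT rc).
rewrite in_itv/= r0 => /andP[c0 cy] E; exists c; last by move: E; lra.
by rewrite !ler0_norm ?lerN2// ltW.
Qed.

(** The mean value theorem is applied three times; the intermediate points are only
    bounded by [`|x|], so the constant is [K] and not [K / 6]. *)
Lemma cubic_remainder (r r1 r2 r3 : R -> R) x K :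
  (forall y : R, is_derive y 1 r (r1 y)) -> (forall y : R, is_derive y 1 r1 (r2 y)) ->
  (forall y : R, is_derive y 1 r2 (r3 y)) -> r 0 = 0 -> r1 0 = 0 -> r2 0 = 0 ->
  (forall y, `|y| <= `|x| -> `|r3 y| <= K) -> `|r x| <= K * `|x| ^+ 3.
Proof.
move=> d1 d2 d3 z0 z1 z2 r3K.
have K0 : 0 <= K by apply: le_trans (r3K 0 _); rewrite ?normr0.
apply: (mvt_power_bound K0 d1 z0 _ (lexx _)).
apply: (mvt_power_bound K0 d2 z1).
apply: (mvt_power_bound K0 d3 z2).
by move=> y yx; rewrite expr0 mulr1; exact: r3K.
Qed.

End third_order_remainder.

Section logistic.
Context {R : realType}.
Implicit Types (x y : R).

(** The logistic function is used as a smooth step because its derivatives are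
    polynomials in the function itself, hence bounded. *)
Definition logistic x : R := (1 + expR x)^-1.

Definition logistic1 x : R := - (logistic x * (1 - logistic x)).
Definition logistic2 x : R := logistic x * (1 - logistic x) * (1 - 2 * logistic x).
Definition logistic3 x : R := - (logistic x * (1 - logistic x)) *
  (1 - 6 * logistic x + 6 * logistic x ^+ 2).

Lemma logistic_gt0 x : 0 < logistic x.
Proof. by rewrite invr_gt0 addr_gt0// expR_gt0. Qed.

Lemma logistic_lt1 x : logistic x < 1.
Proof. by rewrite invf_lt1 ?ltrDl ?expR_gt0// addr_gt0// expR_gt0. Qed.

Lemma logisticN x : logistic (- x) = 1 - logistic x.
Proof.
rewrite /logistic expRN; have := expR_gt0 x => ?.
by field; rewrite !gt_eqF ?addr_gt0.
Qed.

Lemma logistic_le x : 0 < x -> logistic x <= x^-1.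
Proof.
move=> x0; rewrite /logistic lef_pV2 ?posrE// ?addr_gt0 ?expR_gt0//.
by have := expR_ge1Dx x; lra.
Qed.

Lemma is_derive_logistic x : is_derive x 1 logistic (logistic1 x).
Proof.
have e0 : 1 + expR x != 0 by rewrite gt_eqF ?addr_gt0 ?expR_gt0.
have D : is_derive x 1 (cst 1 + expR) (0 + expR x) by apply: is_deriveD.
have -> : logistic = (fun x => ((cst 1 + expR) x)^-1) by [].
apply: (is_derive_eq (is_deriveV _ D)); first by [].
by rewrite /logistic1 /logistic add0r /GRing.scale/= !fctE; field.
Qed.

Lemma is_derive_logistic1 x : is_derive x 1 logistic1 (logistic2 x).
Proof.
have := is_derive_logistic x => D.
have -> : logistic1 = - (logistic * (cst 1 - logistic)) by [].
apply: is_derive_eq.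
rewrite /logistic2 /logistic1 /GRing.scale/= !fctE.
have E (u : R) : - (u * (0 - - (u * (1 - u))) + (1 - u) * - (u * (1 - u))) =
  u * (1 - u) * (1 - 2 * u) by ring.
exact: E.
Qed.

Lemma is_derive_logistic2 x : is_derive x 1 logistic2 (logistic3 x).
Proof.
have := is_derive_logistic x => D.
have := is_derive_logistic1 x => D1.
have -> : logistic2 = - (logistic1 * (cst 1 - (2 : R) \*: logistic)).
  by apply/funext => y; rewrite /logistic2 /logistic1 !fctE/= /GRing.scale/=; ring.
apply: is_derive_eq.
rewrite /logistic3 /logistic2 /logistic1 /GRing.scale/= !fctE.
have E (u : R) : - (- (u * (1 - u)) * (0 - 2 * - (u * (1 - u))) +
  (1 - 2 * u) * (u * (1 - u) * (1 - 2 * u))) =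
  - (u * (1 - u)) * (1 - 6 * u + 6 * u ^+ 2) by ring.
exact: E.
Qed.

Lemma logistic1_le1 x : `|logistic1 x| <= 1.
Proof.
rewrite /logistic1; have := logistic_gt0 x; have := logistic_lt1 x.
by move: (logistic x) => u u1 u0; rewrite ler_norml; apply/andP; split; nra.
Qed.

Lemma logistic2_le1 x : `|logistic2 x| <= 1.
Proof.
rewrite /logistic2; have := logistic_gt0 x; have := logistic_lt1 x.
move: (logistic x) => u u1 u0; rewrite normrM.
have : `|u * (1 - u)| <= 1 by rewrite ler_norml; apply/andP; split; nra.
have : `|1 - 2 * u| <= 1 by rewrite ler_norml; apply/andP; split; nra.
by move=> A B; rewrite -[leRHS]mulr1 ler_pM.
Qed.

Lemma logistic3_le1 x : `|logistic3 x| <= 1.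
Proof.
rewrite /logistic3; have := logistic_gt0 x; have := logistic_lt1 x.
move: (logistic x) => u u1 u0; rewrite normrM normrN.
have : `|u * (1 - u)| <= 1 by rewrite ler_norml; apply/andP; split; nra.
have : `|1 - 6 * u + 6 * u ^+ 2| <= 1 by rewrite ler_norml; apply/andP; split; nra.
by move=> A B; rewrite -[leRHS]mulr1 ler_pM.
Qed.

Lemma logistic_taylor x y :
  `|logistic (x + y) - logistic x - logistic1 x * y - logistic2 x / 2 * y ^+ 2| <= `|y| ^+ 3.
Proof.
rewrite -[leRHS]mul1r.
have shiftD (f : R -> R) (df z : R) : is_derive (x + z) 1 f df ->
    is_derive z 1 (fun t => f (x + t)) df.
  move=> D; have D' : is_derive z 1 (cst x + id) (0 + 1) by apply: is_deriveD.
  by apply: (is_derive_eq (is_derive1_comp D D')); rewrite add0r mulr1.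
apply: (@cubic_remainder _
  (fun t => logistic (x + t) - logistic x - logistic1 x * t - logistic2 x / 2 * t ^+ 2)
  (fun t => logistic1 (x + t) - logistic1 x - logistic2 x * t)
  (fun t => logistic2 (x + t) - logistic2 x)
  (fun t => logistic3 (x + t)) y 1).
- move=> z; have D := shiftD _ _ _ (is_derive_logistic (x + z)).
  rewrite [X in is_derive _ _ X](_ : _ = (fun t => logistic (x + t)) -
    cst (logistic x) - logistic1 x \*: id - (logistic2 x / 2) \*: (id ^+ 2))//.
  apply: is_derive_eq; rewrite /GRing.scale/=.
  have E (a b c w : R) : a - 0 - b * 1 - c / 2 * (2 * w ^+ 1 * 1) = a - b - c * w.
    by field.
  exact: E.
- move=> z; have D := shiftD _ _ _ (is_derive_logistic1 (x + z)).
  rewrite [X in is_derive _ _ X](_ : _ = (fun t => logistic1 (x + t)) -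
    cst (logistic1 x) - logistic2 x \*: id)//.
  by apply: is_derive_eq; rewrite /GRing.scale/= subr0 mulr1.
- move=> z; have D := shiftD _ _ _ (is_derive_logistic2 (x + z)).
  rewrite [X in is_derive _ _ X](_ : _ = (fun t => logistic2 (x + t)) -
    cst (logistic2 x))//.
  by apply: is_derive_eq; rewrite subr0.
- by rewrite addr0 subrr mulr0 expr0n/= mulr0 !subr0.
- by rewrite addr0 subrr mulr0 subr0.
- by rewrite addr0 subrr.
- by move=> z _; exact: logistic3_le1.
Qed.

Let is_derive_continuous (f f' : R -> R) :
  (forall x : R, is_derive x 1 f (f' x)) -> continuous f.
Proof.
by move=> D x; apply/differentiable_continuous/derivable1_diffP; case: (D x).
Qed.

Lemma continuous_logistic : continuous logistic.
Proof. exact: is_derive_continuous is_derive_logistic. Qed.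

Lemma measurable_logistic1 : measurable_fun [set: R] logistic1.
Proof. by apply: continuous_measurable_fun; exact: is_derive_continuous is_derive_logistic1. Qed.

Lemma measurable_logistic2 : measurable_fun [set: R] logistic2.
Proof. by apply: continuous_measurable_fun; exact: is_derive_continuous is_derive_logistic2. Qed.

End logistic.

(** * The standard Gaussian law and its moments *)

Section gauss.
Context {R : realType}.
Local Notation mu := (@lebesgue_measure R).

Definition gauss : probability (measurableTypeR R) R := normal_prob 0 1.

(** The density of the normal law is its Radon-Nikodym derivative, by uniqueness. *)
Lemma ge0_integral_gauss (f : R -> R) : measurable_fun [set: R] f ->
  (forall x, 0 <= f x) ->
  (\int[gauss]_x (f x)%:E = \int[mu]_x (f x * normal_pdf 0 1 x)%:E)%E.
Proof.
move=> mf f0.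
have dom := @normal_prob_dominates R 0 1.
have mEf : measurable_fun [set: measurableTypeR R] (EFin \o f).
  exact/measurable_EFinP.
rewrite -(Radon_Nikodym_SigmaFinite.change_of_variables dom _ measurableT mEf);
  last by move=> x; rewrite lee_fin.
have If := @Radon_Nikodym_SigmaFinite.f_integrable _ _ R gauss mu dom.
have mp : measurable_fun [set: measurableTypeR R] (EFin \o normal_pdf (0:R) 1).
  by apply/measurable_EFinP; exact: measurable_normal_pdf.
under [RHS]eq_integral do rewrite EFinM.
apply: ae_eq_integral => //.
- by apply: emeasurable_funM; [exact: mEf|exact: measurable_int If].
- by apply: emeasurable_funM; [exact: mEf|exact: mp].
- apply: ae_eqe_mul2l; apply: integral_ae_eq => //.
  by move=> E ET mE; rewrite -Radon_Nikodym_SigmaFinite.f_integral.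
Qed.


(** Multiplying the density by [expR (t * x)] shifts its mean to [t]. *)
Lemma gauss_mgf (t : R) : (\int[gauss]_x (expR (t * x))%:E = (expR (t ^+ 2 / 2))%:E)%E.
Proof.
rewrite ge0_integral_gauss//; last first.
  by apply: measurableT_comp => //; exact: measurable_funM.
transitivity (\int[mu]_x ((expR (t ^+ 2 / 2))%:E * (normal_pdf t 1 x)%:E))%E.
  apply: eq_integral => x _; rewrite -EFinM; congr EFin.
  rewrite !normal_pdfE ?oner_neq0// /normal_fun mulrCA [RHS]mulrCA; congr (_ * _).
  by rewrite -!expRD; congr expR; field.
rewrite ge0_integralZl//; last 2 first.
- by apply/measurable_EFinP; exact: measurable_normal_pdf.
- by move=> x _; rewrite lee_fin normal_pdf_ge0.
by rewrite integral_normal_pdf mule1.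
Qed.

Lemma integrable_gauss_exp (t : R) : integrableR gauss (fun x => expR (t * x)).
Proof.
apply: ge0_integrableR.
- by apply: measurableT_comp => //; exact: measurable_funM.
- by move=> x; exact: expR_ge0.
- by rewrite gauss_mgf ltry.
Qed.

Lemma Rintegral_gauss_exp (t : R) : \int[gauss]_x expR (t * x) = expR (t ^+ 2 / 2).
Proof. by rewrite /Rintegral gauss_mgf. Qed.

Lemma expR_norm_le (x : R) : expR `|x| <= expR x + expR (- x).
Proof.
have := expR_ge0 x; have := expR_ge0 (- x).
by have [x0|x0] := ger0P x; lra.
Qed.

Lemma exprn_le_expR (x : R) k : 0 <= x -> x ^+ k <= k%:R ^+ k * expR x.
Proof.
case: k => [|k] x0; first by rewrite !expr0 mul1r (le_trans _ (expR_ge1Dx x))// lerDl.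
have k0 : (0 : R) < k.+1%:R by rewrite ltr0n.
have -> : expR x = expR (x / k.+1%:R) ^+ k.+1.
  by rewrite -expRM_natl mulrC divfK// gt_eqF.
rewrite -exprMn lerXn2r ?nnegrE ?mulr_ge0 ?expR_ge0 ?ler0n//.
rewrite -ler_pdivrMl// mulrC; apply: le_trans (expR_ge1Dx _).
by rewrite lerDr.
Qed.

Lemma integrable_gauss_pow k : integrableR gauss (fun x => x ^+ k).
Proof.
apply: (@integrableR_dom _ _ _ gauss _
  (fun x => k%:R ^+ k * (expR (1 * x) + expR (- 1 * x)))).
- exact: exprn_measurable.
- move=> x; rewrite normrX (le_trans (exprn_le_expR _ _))//.
  rewrite mul1r mulN1r ler_wpM2l ?exprn_ge0//; exact: expR_norm_le.
- apply: integrableR_scale; apply: integrableR_add; exact: integrable_gauss_exp.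
Qed.

(** The third derivative of [expR y] is at most [expR `|x|] for [`|y| <= `|x|]. *)
Lemma expR_cubic (x : R) :
  `|expR x - 1 - x - x ^+ 2 / 2| <= expR `|x| * `|x| ^+ 3.
Proof.
apply: (@cubic_remainder _ (fun x => expR x - 1 - x - x ^+ 2 / 2)
  (fun x => expR x - 1 - x) (fun x => expR x - 1) expR).
- move=> y.
  rewrite [X in is_derive _ _ X](_ : _ = expR - cst 1 - id - (2^-1 : R) \*: (id ^+ 2)).
    apply: is_derive_eq; rewrite /GRing.scale/=.
    have E (a w : R) : a - 0 - 1 - 2^-1 * (2 * w ^+ 1 * 1) = a - 1 - w by field.
    exact: E.
  by apply/funext => z /=; rewrite !fctE /GRing.scale/= mulrC.
- move=> y; rewrite [X in is_derive _ _ X](_ : _ = expR - cst 1 - id)//.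
  by apply: is_derive_eq; rewrite subr0.
- move=> y; rewrite [X in is_derive _ _ X](_ : _ = expR - cst 1)//.
  by apply: is_derive_eq; rewrite subr0.
- by rewrite expR0 expr0n/= mul0r !subr0 subrr.
- by rewrite expR0 subr0 subrr.
- by rewrite expR0 subrr.
- by move=> y yx; rewrite ger0_norm ?expR_ge0// ler_expR (le_trans _ yx)// ler_norm.
Qed.

Lemma norm_le_small_eq0 (B K : R) : (forall t, 0 < t <= 1 -> `|B| <= K * t) -> B = 0.
Proof.
move=> H; apply/eqP; apply: contraT => B0.
have nB : 0 < `|B| by rewrite normr_gt0.
have K0 : 0 < K by have := H 1; rewrite ltr01 lexx mulr1 => /(_ isT); lra.
have := H (Num.min 1 (`|B| / (2 * K))).
rewrite lt_min ltr01 ge_min lexx divr_gt0 ?mulr_gt0//= => /(_ isT).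
move=> /le_trans /(_ (ler_wpM2l (ltW K0) (_ : _ <= `|B| / (2 * K)))).
rewrite ge_min lexx orbT => /(_ isT).
have -> : K * (`|B| / (2 * K)) = `|B| / 2 by field; rewrite gt_eqF.
by lra.
Qed.

(** The expansion of the moment generating function to second order at [0]
    reads off the first two moments. *)
Lemma gauss_moments : \int[gauss]_x x = 0 /\ \int[gauss]_x (x ^+ 2) = 1.
Proof.
set A := \int[gauss]_x x; set B := \int[gauss]_x (x ^+ 2).
pose C : R := 27 * (2 * expR 2) + (1 + expR 1).
have I1 : integrableR gauss (fun x => x).
  by have := integrable_gauss_pow 1; under eq_fun do rewrite expr1.
have I2 := integrable_gauss_pow 2.
have H t : -1 <= t <= 1 -> `|t * A + t ^+ 2 * ((B - 1) / 2)| <= C * `|t| ^+ 3.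
  move=> t1; have nt : `|t| <= 1 by rewrite ler_norml.
  pose D x := expR (t * x) - 1 - t * x - (t * x) ^+ 2 / 2.
  have [|ID ED] := @integrableR_lin _ _ _ gauss [:: (1, fun x => expR (t * x)); (- 1, fun=> 1);
    (- t, fun x => x); (- (t ^+ 2 / 2), fun x => x ^+ 2)].
    move=> u; rewrite /= !inE => /or4P[]/eqP->//.
      exact: integrable_gauss_exp.
    exact: integrableR_cst.
  have DE : D = (fun x => \sum_(i <- [:: (1, fun x => expR (t * x)); (- 1, fun=> 1);
    (- t, fun x => x); (- (t ^+ 2 / 2), fun x => x ^+ 2)]) i.1 * i.2 x).
    by apply/funext => x; rewrite !big_cons big_nil /D /=; field.
  rewrite -DE in ID ED; move: ED.
  rewrite !big_cons big_nil/= Rintegral_gauss_exp Rintegral_prob_cst -/A -/B => ED.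
  have bD : `|\int[gauss]_x D x| <= 27 * (2 * expR 2) * `|t| ^+ 3.
    apply: le_trans (le_normr_Rintegral measurableT ID) _.
    pose G x : R := (27 * `|t| ^+ 3) * (expR (2 * x) + expR (- 2 * x)).
    have IG : integrableR gauss G.
      by apply: integrableR_scale; apply: integrableR_add; exact: integrable_gauss_exp.
    have -> : 27 * (2 * expR 2) * `|t| ^+ 3 = \int[gauss]_x G x.
      rewrite RintegralZl//; last first.
        by apply: integrableR_add; exact: integrable_gauss_exp.
      rewrite RintegralD//; try exact: integrable_gauss_exp.
      rewrite !Rintegral_gauss_exp sqrrN (_ : 2 ^+ 2 / 2 = 2); last by field.
      by ring.
    apply: le_Rintegral_prob => //; first exact: integrable_norm.
    move=> x; apply: le_trans (expR_cubic _) _; rewrite normrM exprMn /G.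
    have e1 : expR (`|t| * `|x|) <= expR `|x| by rewrite ler_expR ler_piMl.
    have e2 : `|x| ^+ 3 <= 27 * expR `|x|.
      have := @exprn_le_expR `|x| 3 (normr_ge0 _).
      by rewrite (_ : 3 ^+ 3 = 27)//; ring.
    have e3 : expR `|x| * expR `|x| <= expR (2 * x) + expR (- 2 * x).
      rewrite -expRD; have := expR_norm_le (2 * x).
      by rewrite normrM ger0_norm// mulNr mulr2n mulrDl mul1r.
    rewrite mulrCA [leRHS]mulrAC mulrC; apply: ler_wpM2r; first by rewrite exprn_ge0.
    apply: (@le_trans _ _ (expR `|x| * (27 * expR `|x|))).
      by rewrite ler_pM ?expR_ge0 ?exprn_ge0.
    by rewrite mulrCA ler_wpM2l.
  have t3 k : `|t| ^+ (3 + k) <= `|t| ^+ 3.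
    by rewrite exprD ler_piMr ?exprn_ge0// exprn_ile1.
  have eD : `|expR (t ^+ 2 / 2) - 1 - t ^+ 2 / 2| <= (1 + expR 1) * `|t| ^+ 3.
    have := expR_cubic (t ^+ 2 / 2); set u := t ^+ 2 / 2.
    have u0 : 0 <= u by rewrite divr_ge0 ?sqr_ge0.
    have uE : u = `|t| ^+ 2 / 2 by rewrite real_normK ?num_real.
    have u1 : u <= 1.
      rewrite uE; have : `|t| ^+ 2 <= 1 by rewrite exprn_ile1.
      by lra.
    have e1 : expR `|u| * `|u| ^+ 3 <= expR 1 * `|t| ^+ 3.
      rewrite ger0_norm// ler_pM ?expR_ge0 ?exprn_ge0 ?ler_expR//.
      apply: le_trans (t3 3); rewrite uE expr_div_n -exprM.
      by rewrite ler_pdivrMr// ler_peMr ?exprn_ge0// -natrX ler1n.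
    have e2 : u ^+ 2 / 2 <= `|t| ^+ 3.
      apply: le_trans (t3 1); rewrite uE expr_div_n -exprM -mulrA ler_piMr ?exprn_ge0//.
      by lra.
    have e3 : 0 <= u ^+ 2 by rewrite sqr_ge0.
    by move=> /le_trans/(_ e1); rewrite !ler_norml => /andP[? ?]; apply/andP; split; lra.
  have -> : t * A + t ^+ 2 * ((B - 1) / 2) =
    (expR (t ^+ 2 / 2) - 1 - t ^+ 2 / 2) - \int[gauss]_x D x by rewrite ED; field.
  rewrite (le_trans (ler_normB _ _))// addrC /C mulrDl; exact: lerD.
have B0 : (B - 1) / 2 = 0.
  apply: (@norm_le_small_eq0 _ C) => t /andP[t0 t1].
  have := H t; have := H (- t); rewrite !normrN sqrrN (gtr0_norm t0).
  have -> : -1 <= t <= 1 by rewrite t1 andbT; lra.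
  have -> : -1 <= - t <= 1 by apply/andP; split; lra.
  move=> /(_ isT) + /(_ isT).
  rewrite 2!ler_norml => /andP[a1 a2] /andP[a3 a4].
  have t2 : 0 < t ^+ 2 by rewrite exprn_gt0.
  rewrite -(ler_pM2l t2) -{1}(gtr0_norm t2) -normrM ler_norml.
  have -> : t ^+ 2 * (C * t) = C * t ^+ 3 by ring.
  by apply/andP; split; lra.
split; last by lra.
apply: (@norm_le_small_eq0 _ C) => t /andP[t0 t1].
have := H t; rewrite B0 mulr0 addr0 normrM (gtr0_norm t0) t1 andbT.
have -> : -1 <= t by lra.
move=> /(_ isT); rewrite exprS mulrCA ler_pM2l// => /le_trans; apply.
apply: ler_wpM2l; last by rewrite expr2 ler_piMl// ltW.
by rewrite /C addr_ge0// ?mulr_ge0 ?addr_ge0 ?expR_ge0.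
Qed.

End gauss.

(** * Probabilities as real numbers *)

Section real_probability.
Context d (T : measurableType d) (R : realType) (P : probability T R).
Implicit Types (A B : set T) (f : T -> R).

Definition pr A : R := fine (P A).

Lemma EFin_pr A : measurable A -> (pr A)%:E = P A.
Proof. by move=> mA; rewrite /pr fineK//; exact: fin_num_measure. Qed.

Lemma pr_ge0 A : 0 <= pr A.
Proof. by rewrite fine_ge0. Qed.

Lemma pr_le1 A : measurable A -> pr A <= 1.
Proof. by move=> mA; rewrite -lee_fin EFin_pr//; exact: probability_le1. Qed.

Lemma le_pr A B : measurable A -> measurable B -> A `<=` B -> pr A <= pr B.
Proof.
move=> mA mB AB; rewrite -lee_fin !EFin_pr//.
by apply: le_measure => //; rewrite inE.
Qed.

Lemma pr_setC A : measurable A -> pr (~` A) = 1 - pr A.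
Proof.
move=> mA; apply: EFin_inj; rewrite EFinB !EFin_pr//; first exact: probability_setC.
exact: measurableC.
Qed.

Lemma pr_setU A B : measurable A -> measurable B -> pr (A `|` B) <= pr A + pr B.
Proof.
move=> mA mB; rewrite -lee_fin EFinD !EFin_pr//; first exact: measureU2.
exact: measurableU.
Qed.

Lemma integrableR_indic A : measurable A -> integrableR P (\1_A : T -> R).
Proof. by move=> mA; apply: integrable_indic. Qed.

Lemma Rintegral_indic A : measurable A -> \int[P]_x \1_A x = pr A.
Proof. by move=> mA; rewrite /Rintegral integral_indic// setIT. Qed.

Lemma markov_pr A f c : measurable A -> 0 < c -> integrableR P f ->
  (forall x, 0 <= f x) -> (forall x, A x -> c <= f x) ->
  pr A <= (\int[P]_x f x) / c.
Proof.
move=> mA c0 If f0 fA; rewrite ler_pdivlMr// -Rintegral_indic// -RintegralZr//;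
  last exact: integrableR_indic.
apply: le_Rintegral_prob => //.
  under eq_fun do rewrite mulrC; apply: integrableR_scale; exact: integrableR_indic.
move=> x; rewrite indicE; have [xA|_] := boolP (x \in A).
  by rewrite mul1r fA//; move: xA; rewrite inE.
by rewrite mul0r.
Qed.

End real_probability.
Arguments pr {d T R} P A.

(** * Convolution of Gaussian laws *)

Section normal_pdf_facts.
Context {R : realType}.
Local Notation mu := (@lebesgue_measure R).

Lemma normal_peakE (s : R) : 0 < s -> normal_peak s = s^-1 * normal_peak 1.
Proof.
move=> s0; rewrite /normal_peak -invfM; congr (_^-1).
rewrite expr1n mul1r -mulrnAr sqrtrM ?sqr_ge0//.
by rewrite sqrtr_sqr gtr0_norm.
Qed.

Lemma normal_pdf_affine (w s z : R) : 0 < s ->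
  normal_pdf w s (w + s * z) * s = normal_pdf 0 1 z.
Proof.
move=> s0; rewrite !normal_pdfE ?gt_eqF// (normal_peakE s0).
rewrite mulrAC mulrAC mulrC mulrA mulrA divff ?gt_eqF// mul1r; congr (_ * expR _).
by field; rewrite gt_eqF.
Qed.

(** The substitution [y = w + s * z] in the density; the change of variables on the
    whole line asks for a continuous integrand. *)
Lemma gauss_affine (f : R -> R) (w s : R) : 0 < s -> continuous f ->
  (forall x, 0 <= f x) ->
  (\int[gauss]_z (f (w + s * z))%:E = \int[mu]_y (f y * normal_pdf w s y)%:E)%E.
Proof.
move=> s0 cf f0.
have cF : continuous (fun z : R => w + s * z).
  move=> z; apply: cvgD; first exact: cvg_cst.
  by apply: cvgM; [exact: cvg_cst|exact: cvg_id].
have mF : measurable_fun [set: R] (fun z : R => w + s * z).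
  exact: continuous_measurable_fun.
have mf : measurable_fun [set: R] f by exact: continuous_measurable_fun.
rewrite (@ge0_integral_gauss _ (fun z => f (w + s * z)) (measurableT_comp mf mF)
  (fun z => f0 _)).
have F'E : ((fun z : R => w + s * z)^`())%classic = cst s.
  apply/funext => x; rewrite derive1E.
  have D : is_derive x 1 (cst w + s \*: id : R -> R) (0 + s *: 1) by apply: is_deriveD.
  by apply: etrans (@derive_val _ _ _ _ _ _ _ D) _; rewrite add0r /GRing.scale/= mulr1.
rewrite [RHS](@increasing_ge0_integration_by_substitutionT _ (fun z => w + s * z)
  (fun y => f y * normal_pdf w s y)).
- apply: eq_integral => z _; rewrite F'E/= !fctE/=.
  by rewrite -mulrA normal_pdf_affine.
- by move=> x y xy; rewrite ltrD2l ltr_pM2l.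
- by rewrite F'E => ?; exact: cvg_cst.
- by rewrite F'E; exact: is_cvg_cst.
- by rewrite F'E; exact: is_cvg_cst.
- move=> x.
  have D : is_derive x 1 (cst w + s \*: id : R -> R) (0 + s *: 1) by apply: is_deriveD.
  by case: D.
- apply: cvg_comp; last exact: cvg_addrl_Ny.
  exact/gt0_cvgMrNy.
- apply: cvg_comp; last exact: cvg_addrl.
  exact/gt0_cvgMry.
- move=> x; apply: cvgM; first exact: cf.
  by apply: continuous_normal_pdf; rewrite gt_eqF.
- by move=> x; rewrite mulr_ge0// normal_pdf_ge0.
Qed.

(** Completing the square in [z] separates the density of the sum of two Gaussians
    from the conditional density of one of them, which integrates to one. *)
Lemma normal_pdf_complete_square (w s s' y z : R) : 0 < s -> 0 < s' ->
  let r := Num.sqrt (s ^+ 2 + s' ^+ 2) in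
  normal_pdf (w + s * z) s' y * normal_pdf 0 1 z =
  normal_pdf w r y * normal_pdf (s * (y - w) / r ^+ 2) (s' / r) z.
Proof.
move=> s0 s'0 r.
have r2 : r ^+ 2 = s ^+ 2 + s' ^+ 2 by rewrite sqr_sqrtr// addr_ge0 ?sqr_ge0.
have r0 : 0 < r by rewrite sqrtr_gt0 addr_gt0 ?exprn_gt0.
have t0 : 0 < s' / r by rewrite divr_gt0.
rewrite !normal_pdfE ?gt_eqF// (normal_peakE s'0) (normal_peakE r0) (normal_peakE t0).
set p := normal_peak 1.
transitivity (s'^-1 * p * p *
  (normal_fun (w + s * z) s' y * normal_fun 0 1 z)); first by ring.
transitivity (s'^-1 * p * p *
  (normal_fun w r y * normal_fun (s * (y - w) / r ^+ 2) (s' / r) z)); last first.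
  rewrite (_ : s'^-1 = r^-1 * (s' / r)^-1); first by ring.
  by field; rewrite !gt_eqF.
congr (_ * _); rewrite /normal_fun -!expRD; congr expR.
rewrite expr_div_n r2; field.
by rewrite !gt_eqF// ?addr_gt0 ?exprn_gt0.
Qed.

Lemma measurable_pdf2 (w s s' : R) : 0 < s' ->
  measurable_fun [set: R * R] (fun yz : R * R => normal_pdf (w + s * yz.2) s' yz.1).
Proof.
move=> s0; under eq_fun do rewrite normal_pdfE ?gt_eqF//.
apply: measurable_funM => //; apply: measurableT_comp => //.
apply: measurable_funM => //; apply: measurableT_comp => //.
apply: measurable_funX; apply: measurable_funB => //.
by apply: measurable_funD => //; exact: measurable_funM.
Qed.

(** After the square has been completed, the inner variable integrates out and the
    density of the sum is left. *)
Lemma gauss_convolution (f : R -> R) (w s s' : R) : 0 < s -> 0 < s' ->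
  continuous f -> (forall x, 0 <= f x) ->
  (\int[gauss]_z \int[gauss]_z' (f (w + s * z + s' * z'))%:E =
   \int[gauss]_z (f (w + Num.sqrt (s ^+ 2 + s' ^+ 2) * z))%:E)%E.
Proof.
move=> s0 s'0 cf f0; set r := Num.sqrt _.
have r0 : 0 < r by rewrite sqrtr_gt0 addr_gt0 ?exprn_gt0.
have mf : measurable_fun [set: R] f by exact: continuous_measurable_fun.
pose k (yz : R * R) := f yz.1 * normal_pdf (w + s * yz.2) s' yz.1.
have mk : measurable_fun [set: R * R] k.
  by apply: measurable_funM; [exact: measurableT_comp|exact: measurable_pdf2].
have k0 yz : 0 <= k yz by rewrite mulr_ge0// normal_pdf_ge0.
transitivity (\int[gauss]_z \int[mu]_y (k (y, z))%:E)%E.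
  by apply: eq_integral => z _; rewrite gauss_affine.
transitivity (\int[mu]_y \int[gauss]_z (k (y, z))%:E)%E.
  apply/esym; apply: (@fubini_tonelli _ _ _ _ R mu gauss (EFin \o k)).
    exact/measurable_EFinP.
  by move=> x; rewrite lee_fin.
rewrite gauss_affine//; apply: eq_integral => y _.
rewrite ge0_integral_gauss//; last exact: (measurableT_comp mk).
transitivity (\int[mu]_z ((f y * normal_pdf w r y)%:E *
   (normal_pdf (s * (y - w) / r ^+ 2) (s' / r) z)%:E))%E.
  apply: eq_integral => z _.
  rewrite -EFinM /k/= -[in LHS]mulrA -[in RHS](mulrA (f y)).
  by rewrite normal_pdf_complete_square.
rewrite ge0_integralZl//; first by rewrite integral_normal_pdf mule1.
- by apply/measurable_EFinP; exact: measurable_normal_pdf.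
- by move=> x _; rewrite lee_fin normal_pdf_ge0.
- by rewrite lee_fin mulr_ge0// normal_pdf_ge0.
Qed.

End normal_pdf_facts.

(** * The normal distribution function *)

Section Phi.
Context {R : realType}.
Local Notation mu := (@lebesgue_measure R).
Implicit Types (a b c z : R).

Lemma PhiE z : Phi z = pr gauss [set x : R | x <= z].
Proof. by rewrite /Phi /pr set_itvNyc. Qed.

Lemma measurable_le z : measurable [set x : R | x <= z].
Proof. by rewrite -set_itvNyc. Qed.

Lemma Phi_ge0 z : 0 <= Phi z.
Proof. by rewrite PhiE pr_ge0. Qed.

Lemma Phi_le1 z : Phi z <= 1.
Proof. by rewrite PhiE pr_le1//; exact: measurable_le. Qed.

Lemma Phi_nondecreasing : {homo @Phi R : a b / a <= b}.
Proof.
move=> a b ab; rewrite !PhiE; apply: le_pr; try exact: measurable_le.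
by move=> x /= /le_trans; apply.
Qed.

Lemma Phi_increment a b c : a <= b -> 0 <= c ->
  (forall x, a <= x <= b -> normal_pdf 0 1 x <= c) -> Phi b - Phi a <= c * (b - a).
Proof.
move=> ab c0 H.
have -> : Phi b - Phi a = pr gauss (`]a, b] : set R).
  have E : [set x : R | x <= b] = [set x : R | x <= a] `|` `]a, b].
    apply/seteqP; split => x /=; rewrite in_itv/=.
      by case: (leP x a) => [|_ xb]; [left|right].
    by case=> [/le_trans|/andP[]//]; exact.
  apply/eqP; rewrite subr_eq addrC; apply/eqP/EFin_inj.
  rewrite EFinD !PhiE !EFin_pr//; last 2 first.
  - exact: measurable_le.
  - exact: measurable_le.
  rewrite E measureU//; first exact: measurable_le.
  apply/seteqP; split => // x [/= xa]; rewrite in_itv/= => /andP[ax _].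
  by move: ax; rewrite ltNge xa.
rewrite -lee_fin EFin_pr//.
apply: (@le_trans _ _ (\int[mu]_(x in `]a, b]) c%:E)%E).
  apply: ge0_le_integral => //.
  - by move=> x _; rewrite lee_fin normal_pdf_ge0.
  - by apply/measurable_EFinP; apply: measurable_funTS; exact: measurable_normal_pdf.
  - move=> x; rewrite /= in_itv/= => /andP[ax xb].
    by rewrite lee_fin H// xb ltW.
rewrite integral_cst//= lebesgue_measure_itv/= lte_fin.
have [_|] := ltP a b; first by rewrite -EFinD.
by move=> ba; rewrite mule0 lee_fin mulr_ge0// subr_ge0.
Qed.

Lemma normal_pdf01_le (x : R) : normal_pdf 0 1 x <= (1 + x ^+ 2 / 2)^-1.
Proof.
rewrite normal_pdfE ?oner_neq0//.
have p1 : normal_peak 1 <= 1 :> R.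
  have p2 : 1 <= 1 ^+ 2 * pi *+ 2 :> R by have := @pi_ge2 R; lra.
  rewrite /normal_peak invf_le1 ?sqrtr_gt0 ?(lt_le_trans ltr01 p2)//.
  by rewrite -[leLHS]sqrtr1 ler_sqrt// (le_trans ler01 p2).
apply: (@le_trans _ _ (normal_fun 0 1 x)).
  by apply: (ler_piMl _ p1); exact: normal_fun_ge0.
rewrite /normal_fun subr0 expr1n mulNr expRN lef_pV2 ?posrE ?expR_gt0//; last first.
  by rewrite ltr_pwDl// divr_ge0 ?sqr_ge0.
exact: expR_ge1Dx.
Qed.

Lemma Phi_lipschitz a b : a <= b -> Phi b - Phi a <= b - a.
Proof.
move=> ab; rewrite -[leRHS]mul1r; apply: Phi_increment => // x _.
apply: le_trans (normal_pdf01_le x) _.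
by rewrite invf_le1 ?lerDl ?ltr_pwDl// divr_ge0 ?sqr_ge0.
Qed.

(** The density decays fast enough that a relative perturbation of the argument
    moves [Phi] by a multiple of the perturbation, uniformly in [z]. *)
Lemma Phi_rescale z a b (e : R) : 0 <= e -> a <= b -> b - a <= 2 * e * `|z| ->
  (forall x, a <= x <= b -> `|z| / 2 <= `|x|) -> Phi b - Phi a <= 3 * e.
Proof.
move=> e0 ab bae H; set u := `|z|.
have u0 : 0 <= u by exact: normr_ge0.
have D0 : 0 < 1 + u ^+ 2 / 8 by rewrite ltr_pwDl// divr_ge0 ?sqr_ge0.
apply: (@le_trans _ _ ((1 + u ^+ 2 / 8)^-1 * (b - a))).
  apply: Phi_increment => //; first by rewrite invr_ge0 ltW.
  move=> x /H xu; apply: le_trans (normal_pdf01_le x) _.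
  rewrite lef_pV2 ?posrE ?ltr_pwDl ?divr_ge0 ?sqr_ge0//.
  rewrite -(real_normK (num_real x)); move: xu; rewrite -/u.
  have := normr_ge0 x; nra.
rewrite ler_pdivrMl//; apply: le_trans bae _; rewrite -/u.
have : 0 <= e * (3 + 3 * u ^+ 2 / 8 - 2 * u) 
  by rewrite mulr_ge0//; have := sqr_ge0 (u - 8 / 3); lra.
by lra.
Qed.

End Phi.

(** * Products of laws and independent samples *)

Section product_expectation.
Context d1 d2 (T1 : measurableType d1) (T2 : measurableType d2) (R : realType).
Context (P : probability T1 R) (Q : probability T2 R).

Lemma integrableR_tensor (u : T1 -> R) (v : T2 -> R) :
  integrableR P u -> integrableR Q v ->
  integrableR (P \x Q)%E (fun z => u z.1 * v z.2).
Proof.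
move=> Iu Iv; have mu := integrableR_meas Iu; have mv := integrableR_meas Iv.
have muv : measurable_fun [set: T1 * T2] (fun z => u z.1 * v z.2).
  by apply: measurable_funM; exact: measurableT_comp.
apply/integrableP; split; first exact/measurable_EFinP.
rewrite fubini_tonelli2//=; last first.
  by apply/measurable_EFinP; exact: measurableT_comp.
rewrite /fubini_G/=.
have Inu := integrable_norm Iu; have Inv := integrable_norm Iv.
pose U := \int[P]_x `|u x|.
under eq_integral => y _.
  under eq_integral do rewrite normrM mulrC.
  rewrite (EFin_Rintegral (f := fun x => `|v y| * `|u x|));
    last exact: integrableR_scale.
  rewrite RintegralZl// -/U mulrC.
  over.
by apply: integrable_lty => //; apply: (integrableR_scale U Inv).
Qed.

Lemma Rintegral_tensor (u : T1 -> R) (v : T2 -> R) :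
  integrableR P u -> integrableR Q v ->
  \int[(P \x Q)%E]_z (u z.1 * v z.2) = (\int[P]_x u x) * (\int[Q]_y v y).
Proof.
move=> Iu Iv; have Iuv := integrableR_tensor Iu Iv.
apply: EFin_inj; rewrite -EFin_Rintegral// -integral21_prod_meas1//= /fubini_G/=.
rewrite EFinM -!EFin_Rintegral//.
under eq_integral do under eq_integral do rewrite mulrC EFinM.
under eq_integral do rewrite integralZl//.
by rewrite muleC (EFin_Rintegral Iu) integralZr.
Qed.

End product_expectation.

Section iid.
Context d (T : measurableType d) (R : realType) (P : probability T R).
Local Notation iid := (iid_law P).

Lemma tconsE n (x : T) (t : n.-tuple T) : tcons (x, t) = [tuple of x :: t].
Proof. by []. Qed.

Lemma measurable_cat_tuple m k : measurable_fun [set: (m.-tuple T * k.-tuple T)%type]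
  (fun st => cat_tuple st.1 st.2).
Proof.
apply/measurable_fun_tnthP => i.
case: (splitP i) => j ij.
  rewrite [X in measurable_fun _ X](_ : _ = (@tnth _ T ^~ j) \o fst).
    by apply: measurableT_comp => //; exact: measurable_tnth.
  apply/funext => -[s t] /=; rewrite /comp/=.
  have -> : i = lshift k j by apply: val_inj.
  by rewrite tnth_lshift.
rewrite [X in measurable_fun _ X](_ : _ = (@tnth _ T ^~ j) \o snd).
  by apply: measurableT_comp => //; exact: measurable_tnth.
apply/funext => -[s t] /=; rewrite /comp/=.
have -> : i = rshift m j by apply: val_inj.
by rewrite tnth_rshift.
Qed.

Section Tonelli.
Local Open Scope ereal_scope.
Context n (F : n.+1.-tuple T -> \bar R).
Hypotheses (mF : measurable_fun [set: n.+1.-tuple T] F) (F0 : forall t, 0 <= F t).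

Let mFt : measurable_fun [set: T * n.-tuple T] (F \o @tcons _ T n).
Proof. exact: measurableT_comp. Qed.

Lemma ge0_integral_iidS :
  \int[iid n.+1]_t F t = \int[iid n]_t \int[P]_x F [tuple of x :: t].
Proof.
rewrite /= (@ge0_integral_distribution _ _ _ _ _ _ (@tcons _ T n))//.
by rewrite fubini_tonelli2//= => x; exact: F0.
Qed.

Lemma ge0_integral_iidS1 :
  \int[iid n.+1]_t F t = \int[P]_x \int[iid n]_t F [tuple of x :: t].
Proof.
rewrite ge0_integral_iidS.
apply/esym.
by apply: (@fubini_tonelli _ _ _ _ R P (iid n) (F \o @tcons _ T n)) => // x; exact: F0.
Qed.

Lemma measurable_integral_iidS :
  measurable_fun [set: n.-tuple T] (fun t => \int[P]_x F [tuple of x :: t]).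
Proof.
apply: (@measurable_fun_fubini_tonelli_G _ _ _ _ R P (F \o @tcons _ T n)) => // x.
exact: F0.
Qed.

End Tonelli.

Lemma ge0_integral_iid0 (F : 0.-tuple T -> \bar R) :
  measurable_fun [set: 0.-tuple T] F -> (\int[iid 0]_t F t = F [tuple])%E.
Proof. by move=> mF; rewrite /= integral_dirac// diracT mul1e. Qed.

Lemma ge0_integral_iidD m k (F : (m + k).-tuple T -> \bar R) :
  measurable_fun [set: (m + k).-tuple T] F -> (forall t, 0 <= F t)%E ->
  (\int[iid (m + k)]_t F t = \int[iid k]_t \int[iid m]_s F (cat_tuple s t))%E.
Proof.
have mcat n (t : k.-tuple T) :
    measurable_fun [set: n.-tuple T] (fun s => cat_tuple s t).
  rewrite [X in measurable_fun _ X](_ : _ =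
    (fun st => cat_tuple st.1 st.2) \o (pair^~ t))//.
  by apply: measurableT_comp; [exact: measurable_cat_tuple|exact: measurable_pair2].
elim: m F => [|m IH] F mF F0.
  apply: eq_integral => t _; rewrite ge0_integral_iid0.
    by congr F; apply: val_inj.
  exact: (measurableT_comp mF (mcat 0%N t)).
rewrite (ge0_integral_iidS mF F0) IH.
- apply: eq_integral => t _.
  rewrite (@ge0_integral_iidS m (fun s => F (cat_tuple s t))
    (measurableT_comp mF (mcat m.+1 t)) (fun s => F0 _)).
  apply: eq_integral => s _; apply: eq_integral => x _.
  by congr F; apply: val_inj.
- exact: measurable_integral_iidS.
- by move=> t; exact: integral_ge0.
Qed.

Lemma measurable_tnth_preimage n (i : 'I_n) (A : set T) : measurable A ->
  measurable [set t : n.-tuple T | A (tnth t i)].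
Proof. by move=> mA; rewrite -[X in measurable X]setTI; exact: measurable_tnth. Qed.

Lemma measurable_exists_tnth n (A : set T) : measurable A ->
  measurable [set t : n.-tuple T | exists i, A (tnth t i)].
Proof.
move=> mA; rewrite [X in measurable X](_ : _ =
  \bigcup_(i in [set: 'I_n]) [set t | A (tnth t i)]).
  by apply: fin_bigcup_measurable => // i _; exact: measurable_tnth_preimage.
by apply/seteqP; split => t /= [i]; [move=> Ai; exists i|move=> _ Ai; exists i].
Qed.

(** The complement is a rectangle of full measure. *)
Lemma iid_null n (A : set T) : measurable A -> P A = 0%E ->
  iid n [set t | exists i, A (tnth t i)] = 0%E.
Proof.
move=> mA PA.
have E1 : iid n [set t | forall i, (~` A) (tnth t i)] = 1%E.
  rewrite (@iid_law_rect _ T R P n (fun=> ~` A)); last by move=> _; exact: measurableC.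
  by rewrite big1// => i _; rewrite probability_setC// PA sube0.
rewrite (_ : [set _ | _] = ~` [set t | forall i, (~` A) (tnth t i)]).
  rewrite probability_setC ?E1 ?subee//.
  rewrite [X in measurable X](_ : _ =
    ~` [set t : n.-tuple T | exists i, A (tnth t i)]).
    by apply: measurableC; exact: measurable_exists_tnth.
  by apply/seteqP; split => t /= H; [move=> [i /H]|move=> i Ai; apply: H; exists i].
apply/seteqP; split => t /=; first by move=> [i Ai] /(_ i).
by move=> /existsNP[i /contrapT Ai]; exists i.
Qed.

Definition tsum (f : T -> R) n (t : n.-tuple T) : R := \sum_(i < n) f (tnth t i).

Lemma tsum_cons f n x (t : n.-tuple T) : tsum f [tuple of x :: t] = f x + tsum f t.
Proof.
rewrite /tsum big_ord_recl tnth0; congr (_ + _).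
by apply: eq_bigr => i _; rewrite tnthS.
Qed.

Lemma tsum0 f (t : 0.-tuple T) : tsum f t = 0.
Proof. by rewrite /tsum big_ord0. Qed.

Lemma measurable_tsum f n : measurable_fun [set: T] f ->
  measurable_fun [set: n.-tuple T] (tsum f (n := n)).
Proof.
move=> mf; apply: measurable_sum => i.
by apply: measurableT_comp => //; exact: measurable_tnth.
Qed.

(** Every moment of a sum over [n + 1] coordinates expands into products of a
    function of the first coordinate and a function of the others, and independence
    factors the expectation of each product. *)
Lemma iidS_expectation n (s : seq ((T -> R) * (n.-tuple T -> R)))
    (F : n.+1.-tuple T -> R) :
  measurable_fun [set: n.+1.-tuple T] F ->
  (forall (x : T) (t : n.-tuple T), F [tuple of x :: t] = \sum_(i <- s) i.1 x * i.2 t) ->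
  (forall i, i \in s -> integrableR P i.1 /\ integrableR (iid n) i.2) ->
  integrableR (iid n.+1) F /\
  \int[iid n.+1]_t F t = \sum_(i <- s) (\int[P]_x i.1 x) * (\int[iid n]_t i.2 t).
Proof.
move=> mF FE Is.
pose G (z : T * n.-tuple T) := F (tcons z).
have GE : G = fun z => \sum_(i <- s) i.1 z.1 * i.2 z.2.
  by apply/funext => -[x t]; rewrite /G tconsE FE.
have [|IG EG] := @integrableR_lin _ _ _ (P \x iid n)%E
  [seq (1, fun z : T * n.-tuple T => i.1 z.1 * i.2 z.2) | i <- s].
  move=> u /mapP[[c v]] /mapP[i si [_ ->]] -> /=.
  by have [? ?] := Is _ si; exact: integrableR_tensor.
have GE' : G = fun z => \sum_(j <- [seq (1,
    fun z : T * n.-tuple T => i.1 z.1 * i.2 z.2) | i <- s]) j.1 * j.2 z.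
  by rewrite GE; apply/funext => z; rewrite big_map/=; under [RHS]eq_bigr do rewrite mul1r.
rewrite -GE' in IG EG.
have mEF : measurable_fun [set: n.+1.-tuple T] (EFin \o F) by exact/measurable_EFinP.
have IF : integrableR (iid n.+1) F.
  by apply: integrable_pushforward => //.
split => //.
apply: EFin_inj; rewrite -EFin_Rintegral// integral_distribution//.
rewrite (EFin_Rintegral (f := G))// EG big_map/=; congr EFin.
rewrite big_seq [RHS]big_seq; apply: eq_bigr => i si; rewrite mul1r.
by have [? ?] := Is _ si; rewrite Rintegral_tensor.
Qed.

End iid.

(** * Moments of sums of independent variables *)

Section moments_of_sums.
Context d (T : measurableType d) (R : realType) (P : probability T R).
Local Notation iid := (iid_law P).
Implicit Types a b : T -> R.

Lemma integrableR_of_sqr d' (T' : measurableType d') (Q : probability T' R)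
    (f : T' -> R) : measurable_fun [set: T'] f ->
  integrableR Q (fun x => f x ^+ 2) -> integrableR Q f.
Proof.
move=> mf If.
suff : integrableR Q (fun x => f x * 1) by under eq_fun do rewrite mulr1.
by apply: integrableR_mul => //; exact: integrableR_cst.
Qed.

Lemma tsum_mean a n : integrableR P a -> \int[P]_x a x = 0 ->
  integrableR (iid n) (@tsum _ T R a n) /\ \int[iid n]_t tsum a t = 0.
Proof.
move=> Ia a0; have ma := integrableR_meas Ia.
elim: n => [|n [IA A0]].
  have E : @tsum _ T R a 0 = fun=> 0 by apply/funext => t; rewrite tsum0.
  by rewrite E Rintegral_prob_cst; split => //; exact: integrableR_cst.
have [||| I ->] := @iidS_expectation _ T R P n [:: (a, fun=> 1); (fun=> 1, @tsum _ T R a n)]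
  (@tsum _ T R a n.+1).
- exact: measurable_tsum.
- by move=> x t; rewrite tsum_cons !big_cons big_nil/= mulr1 mul1r addr0.
- by move=> i; rewrite !inE => /orP[]/eqP->/=; split => //; exact: integrableR_cst.
- by split => //; rewrite !big_cons big_nil/= a0 A0 mul0r mulr0 !addr0.
Qed.

Lemma tsum_cov a b n : measurable_fun [set: T] a -> measurable_fun [set: T] b ->
  integrableR P (fun x => a x ^+ 2) -> integrableR P (fun x => b x ^+ 2) ->
  \int[P]_x a x = 0 -> \int[P]_x b x = 0 ->
  integrableR (iid n) (fun t => tsum a t * tsum b t) /\
  \int[iid n]_t (tsum a t * tsum b t) = n%:R * \int[P]_x (a x * b x).
Proof.
move=> ma mb Ia2 Ib2 a0 b0.
have Ia := integrableR_of_sqr ma Ia2; have Ib := integrableR_of_sqr mb Ib2.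
elim: n => [|n [IAB AB]].
  have E : (fun t : 0.-tuple T => tsum a t * tsum b t) = fun=> 0.
    by apply/funext => t; rewrite !tsum0 mul0r.
  by rewrite E Rintegral_prob_cst mul0r; split => //; exact: integrableR_cst.
have [IA A0] := tsum_mean n Ia a0; have [IB B0] := tsum_mean n Ib b0.
have [||| I ->] := @iidS_expectation _ T R P n [:: (fun x => a x * b x, fun=> 1);
  (a, @tsum _ T R b n); (b, @tsum _ T R a n); (fun=> 1, fun t => tsum a t * tsum b t)]
  (fun t => tsum a t * tsum b t).
- by apply: measurable_funM; exact: measurable_tsum.
- by move=> x t; rewrite !tsum_cons !big_cons big_nil/=; ring.
- by move=> i; rewrite !inE => /or4P[]/eqP->/=; split => //;
    (exact: integrableR_cst || exact: integrableR_mul).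
- split => //; rewrite !big_cons big_nil/= A0 B0 AB !Rintegral_prob_cst.
  by rewrite -natr1; ring.
Qed.

(** In the expansion of [(A + a x)^2 (B + b x)^2] over the last coordinate, every
    term with an isolated factor [a x] or [b x] or an isolated sum [A] or [B]
    averages out. *)
Lemma tsum_cov_sqr a b n : measurable_fun [set: T] a -> measurable_fun [set: T] b ->
  integrableR P (fun x => a x ^+ 4) -> integrableR P (fun x => b x ^+ 4) ->
  \int[P]_x a x = 0 -> \int[P]_x b x = 0 ->
  integrableR (iid n) (fun t => (tsum a t * tsum b t) ^+ 2) /\
  \int[iid n]_t ((tsum a t * tsum b t) ^+ 2) =
    n%:R * \int[P]_x ((a x * b x) ^+ 2) + (n%:R * (n%:R - 1)) *
    ((\int[P]_x (a x ^+ 2)) * (\int[P]_x (b x ^+ 2)) +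
     2 * (\int[P]_x (a x * b x)) ^+ 2).
Proof.
move=> ma mb Ia4 Ib4 a0 b0.
have sqr4 (f : T -> R) : integrableR P (fun x => f x ^+ 4) ->
    integrableR P (fun x => (f x ^+ 2) ^+ 2).
  by under [in X in _ -> X]eq_fun do rewrite -exprM.
have ma2 : measurable_fun [set: T] (fun x => a x ^+ 2) by exact: measurable_funX.
have mb2 : measurable_fun [set: T] (fun x => b x ^+ 2) by exact: measurable_funX.
have Ia2 := integrableR_of_sqr ma2 (sqr4 _ Ia4).
have Ib2 := integrableR_of_sqr mb2 (sqr4 _ Ib4).
have Ia := integrableR_of_sqr ma Ia2; have Ib := integrableR_of_sqr mb Ib2.
have Iab := integrableR_mul ma mb Ia2 Ib2.
have Ia2b2 := integrableR_mul ma2 mb2 (sqr4 _ Ia4) (sqr4 _ Ib4).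
have Ia2b := integrableR_mul ma2 mb (sqr4 _ Ia4) Ib2.
have Iab2 := integrableR_mul ma mb2 Ia2 (sqr4 _ Ib4).
elim: n => [|n [IAB2 AB2]].
  have E : (fun t : 0.-tuple T => (tsum a t * tsum b t) ^+ 2) = fun=> 0.
    by apply/funext => t; rewrite !tsum0 mul0r expr0n.
  rewrite E Rintegral_prob_cst !mul0r addr0; split => //; exact: integrableR_cst.
have [IA A0] := tsum_mean n Ia a0; have [IB B0] := tsum_mean n Ib b0.
have [IA2 A2] := tsum_cov n ma ma Ia2 Ia2 a0 a0.
have [IB2 B2] := tsum_cov n mb mb Ib2 Ib2 b0 b0.
have [IAB AB] := tsum_cov n ma mb Ia2 Ib2 a0 b0.
set A := @tsum _ T R a n in IAB2 AB2 IA A0 IA2 A2 IAB AB *.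
set B := @tsum _ T R b n in IAB2 AB2 IB B0 IB2 B2 IAB AB *.
have mA : measurable_fun [set: n.-tuple T] A by exact: measurable_tsum.
have mB : measurable_fun [set: n.-tuple T] B by exact: measurable_tsum.
have mAB : measurable_fun [set: n.-tuple T] (fun t => A t * B t) by exact: measurable_funM.
have IA2' : integrableR (iid n) (fun t => A t ^+ 2).
  by under eq_fun do rewrite expr2.
have IB2' : integrableR (iid n) (fun t => B t ^+ 2).
  by under eq_fun do rewrite expr2.
have IA2B := integrableR_mul mA mAB IA2' IAB2.
have IAB2'' := integrableR_mul mB mAB IB2' IAB2.
have [||| I ->] := @iidS_expectation _ T R P n [::
  (fun=> 1, fun t => (A t * B t) ^+ 2);
  (fun x => 2 * b x, fun t => A t * (A t * B t));
  (fun x => 2 * a x, fun t => B t * (A t * B t));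
  (fun x => a x ^+ 2, fun t => B t * B t);
  (fun x => b x ^+ 2, fun t => A t * A t);
  (fun x => 4 * (a x * b x), fun t => A t * B t);
  (fun x => 2 * (a x ^+ 2 * b x), B);
  (fun x => 2 * (a x * b x ^+ 2), A);
  (fun x => a x ^+ 2 * b x ^+ 2, fun=> 1)]
  (fun t => (tsum a t * tsum b t) ^+ 2).
- by apply: measurable_funX; apply: measurable_funM; exact: measurable_tsum.
- move=> x t; rewrite !tsum_cons !big_cons big_nil/= -/A -/B.
  by rewrite -/(A t) -/(B t); ring.
- move=> i; rewrite !inE.
  by repeat (case/orP => [/eqP->/=|]; first by split => //;
    try exact: integrableR_scale; exact: integrableR_cst);
    move=> /eqP->/=; split => //; exact: integrableR_cst.
- split => //; rewrite !big_cons big_nil/= A0 B0 AB A2 B2 AB2 !Rintegral_prob_cst.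
  rewrite !RintegralZl// a0 b0.
  under [X in _ = _ * X + _]eq_Rintegral do rewrite exprMn.
  under [\int[P]_x (a x * a x)]eq_Rintegral do rewrite -expr2.
  under [\int[P]_x (b x * b x)]eq_Rintegral do rewrite -expr2.
  under [X in n%:R * X]eq_Rintegral do rewrite exprMn.
  by rewrite -natr1; ring.
Qed.

End moments_of_sums.

(** * Smoothing of distribution functions *)

Section smoothing.
Context {R : realType}.
Implicit Types (w v s c e : R).

(** A smooth surrogate of the indicator of the negative half-line, at scale [e]. *)
Definition step e (x : R) : R := logistic (x / e).

Lemma step_ge0 e x : 0 <= step e x.
Proof. by rewrite ltW// logistic_gt0. Qed.

Lemma step_le1 e x : step e x <= 1.
Proof. by rewrite ltW// logistic_lt1. Qed.

Lemma step_norm_le1 e x : `|step e x| <= 1.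
Proof. by rewrite ger0_norm ?step_le1 ?step_ge0. Qed.

Lemma continuous_step e : continuous (step e).
Proof.
have -> : step e = logistic \o (fun x => x / e) by [].
move=> x; apply: continuous_comp; last exact: continuous_logistic.
by apply: cvgM; [exact: cvg_id|exact: cvg_cst].
Qed.

Lemma measurable_step e : measurable_fun [set: R] (step e).
Proof. by apply: continuous_measurable_fun; exact: continuous_step. Qed.

Lemma step_taylor e w v : 0 < e ->
  `|step e (w + v) - step e w - logistic1 (w / e) / e * v
    - logistic2 (w / e) / 2 / e ^+ 2 * v ^+ 2| <= (e ^- 3) * `|v| ^+ 3.
Proof.
move=> e0; have := logistic_taylor (w / e) (v / e).
rewrite /step mulrDl normrM exprMn normfV (gtr0_norm e0).
by congr (`|_| <= _); field; rewrite gt_eqF.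
Qed.

Context d (T : measurableType d) (Q : probability T R) (X : T -> R).
Hypothesis mX : measurable_fun [set: T] X.

Lemma measurable_RV_le z : measurable [set x | X x <= z].
Proof.
rewrite (_ : [set _ | _] = X @^-1` `]-oo, z]); last by rewrite set_itvNyc.
by rewrite -[X in measurable X]setTI; exact: mX.
Qed.

Lemma integrable_step e c : integrableR Q (fun x => step e (X x - c)).
Proof.
apply: (@integrableR_bounded _ _ _ _ _ 1); last by move=> x; exact: step_norm_le1.
by apply: measurableT_comp (measurable_step e) _; exact: measurable_funB.
Qed.

Lemma step_expectation_le e a c : 0 < e -> 0 < a ->
  \int[Q]_x step e (X x - c) <= pr Q [set x | X x <= c + a] + e / a.
Proof.
move=> e0 a0; have mA := measurable_RV_le (c + a).
rewrite -Rintegral_indic// -(Rintegral_prob_cst Q (e / a)) -RintegralD//; first last.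
- exact: integrableR_cst.
- exact: integrableR_indic.
apply: le_Rintegral_prob.
- exact: integrable_step.
- by apply: integrableR_add; [exact: integrableR_indic|exact: integrableR_cst].
- move=> x; rewrite indicE; have [_|xA] := boolP (_ \in _).
    by rewrite (le_trans (step_le1 _ _))// lerDl divr_ge0 ?ltW.
  rewrite add0r; have ax : a < X x - c.
    by move: xA; rewrite notin_setE/= => /negP; rewrite -ltNge; lra.
  have x0 : 0 < X x - c by exact: lt_trans ax.
  apply: le_trans (logistic_le _) _; first by rewrite divr_gt0.
  by rewrite invf_div ler_pM2l// lef_pV2 ?posrE// ltW.
Qed.

Lemma le_step_expectation e a c : 0 < e -> 0 < a ->
  pr Q [set x | X x <= c - a] <= \int[Q]_x step e (X x - c) + e / a.
Proof.
move=> e0 a0; have mA := measurable_RV_le (c - a).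
rewrite -Rintegral_indic// -(Rintegral_prob_cst Q (e / a)) -RintegralD//; first last.
- exact: integrableR_cst.
- exact: integrable_step.
apply: le_Rintegral_prob.
- exact: integrableR_indic.
- by apply: integrableR_add; [exact: integrable_step|exact: integrableR_cst].
- move=> x; rewrite indicE; have [xA|_] := boolP (_ \in _); last first.
    by rewrite addr_ge0 ?step_ge0 ?divr_ge0// ltW.
  have ax : a <= c - X x by move: xA; rewrite inE/=; lra.
  have x0 : 0 < c - X x by exact: lt_le_trans ax.
  rewrite -lerBlDl/= /step -logisticN -mulNr opprB.
  apply: le_trans (logistic_le _) _; first by rewrite divr_gt0.
  by rewrite invf_div ler_pM2l// lef_pV2 ?posrE.
Qed.

End smoothing.

(** The terms [e / a] are the tails of the logistic function at distance [a]; the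
    shift [2 * a] is the price of sandwiching an indicator between translates. *)
Lemma cdf_le_of_step {R : realType} d1 d2 (T1 : measurableType d1)
    (T2 : measurableType d2) (Q1 : probability T1 R) (Q2 : probability T2 R)
    (X : T1 -> R) (Y : T2 -> R) (e a z b : R) :
  measurable_fun [set: T1] X -> measurable_fun [set: T2] Y -> 0 < e -> 0 < a ->
  \int[Q1]_x step e (X x - (z + a)) <= \int[Q2]_x step e (Y x - (z + a)) + b ->
  pr Q1 [set x | X x <= z] <= pr Q2 [set x | Y x <= z + 2 * a] + 2 * (e / a) + b.
Proof.
move=> mX mY e0 a0 H.
have := @le_step_expectation R _ _ Q1 X mX e a (z + a) e0 a0.
have := @step_expectation_le R _ _ Q2 Y mY e a (z + a) e0 a0.
rewrite addrK -addrA (_ : a + a = 2 * a); last by ring.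
by lra.
Qed.

Section taylor_step.
Context {R : realType}.

(** Only the first two moments of [Y] enter the expansion of [E g(w + Y)] up to
    order three.  The absolute third moment is bounded through
    [2 |y|^3 <= l y^2 + y^4 / l]. *)
Lemma taylor_expectation d (T : measurableType d) (Q : probability T R) (Y : T -> R)
    (g : R -> R) (w g1 g2 K l : R) :
  measurable_fun [set: R] g -> (forall x, `|g x| <= 1) ->
  measurable_fun [set: T] Y -> integrableR Q (fun x => Y x ^+ 4) ->
  \int[Q]_x Y x = 0 -> 0 < l -> 0 <= K ->
  (forall v, `|g (w + v) - g w - g1 * v - g2 * v ^+ 2| <= K * `|v| ^+ 3) ->
  `|\int[Q]_x g (w + Y x) - (g w + g2 * \int[Q]_x (Y x ^+ 2))| <=
    K / 2 * (l * \int[Q]_x (Y x ^+ 2) + l^-1 * \int[Q]_x (Y x ^+ 4)).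
Proof.
move=> mg g_le1 mY IY4 Y0 l0 K0 H.
have IY2 : integrableR Q (fun x => Y x ^+ 2).
  apply: integrableR_of_sqr; first exact: measurable_funX.
  by under eq_fun do rewrite -exprM.
have IY := integrableR_of_sqr mY IY2.
have Ig : integrableR Q (fun x => g (w + Y x)).
  apply: (@integrableR_bounded _ _ _ _ _ 1) => //.
  by apply: (measurableT_comp mg); exact: measurable_funD.
pose D x := g (w + Y x) - g w - g1 * Y x - g2 * Y x ^+ 2.
have [|ID ED] := @integrableR_lin _ _ _ Q [:: (1, fun x => g (w + Y x)); (- g w, fun=> 1);
  (- g1, Y); (- g2, fun x => Y x ^+ 2)].
  by move=> u; rewrite /= !inE => /or4P[]/eqP->//; exact: integrableR_cst.
have DE : D = fun x => \sum_(i <- [:: (1, fun x => g (w + Y x)); (- g w, fun=> 1);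
  (- g1, Y); (- g2, fun x => Y x ^+ 2)]) i.1 * i.2 x.
  by apply/funext => x; rewrite !big_cons big_nil /D/=; ring.
rewrite -DE in ID ED; move: ED; rewrite !big_cons big_nil/= Y0 Rintegral_prob_cst => ED.
rewrite (_ : _ - _ = \int[Q]_x D x); last by rewrite ED; ring.
apply: le_trans (le_normr_Rintegral measurableT ID) _.
rewrite -!RintegralZl// -RintegralD//; try exact: integrableR_scale.
rewrite -RintegralZl//; last by apply: integrableR_add; exact: integrableR_scale.
apply: le_Rintegral_prob; first exact: integrable_norm.
  by apply: integrableR_scale; apply: integrableR_add; exact: integrableR_scale.
move=> x; apply: le_trans (H _) _; rewrite -[leRHS]mulrA ler_wpM2l//.
have -> : Y x ^+ 4 = (`|Y x| ^+ 2) ^+ 2 by rewrite -exprM -normrX ger0_norm// exprn_even_ge0.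
rewrite -[X in l * X](real_normK (num_real _)).
set y := `|Y x|; have y0 : 0 <= y by exact: normr_ge0.
rewrite ler_pdivlMl// -subr_ge0.
have -> : l * y ^+ 2 + l^-1 * (y ^+ 2) ^+ 2 - 2 * y ^+ 3 =
  (y ^+ 2 * (l - y) ^+ 2) / l by field; rewrite gt_eqF.
by apply: divr_ge0; [apply: mulr_ge0; exact: sqr_ge0|exact: ltW].
Qed.

End taylor_step.

Section gaussian_smoothing.
Context {R : realType}.
Variable e : R.
Hypothesis e0 : 0 < e.

(** The test function after part of the sum has been replaced by a Gaussian of
    variance [s ^+ 2]. *)
Definition gstep (s w : R) : R := \int[gauss]_z step e (w + s * z).

Let maff (f : R -> R) (w s : R) : measurable_fun [set: R] f ->
  measurable_fun [set: R] (fun z => f (w + s * z)).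
Proof.
move=> mf; apply: (measurableT_comp mf); apply: measurable_funD => //; exact: measurable_funM.
Qed.

Let Iaff (f : R -> R) (w s c : R) : measurable_fun [set: R] f ->
  (forall x, `|f x| <= c) -> integrableR gauss (fun z => f (w + s * z)).
Proof.
by move=> mf fc; apply: (@integrableR_bounded _ _ _ gauss _ c) => //; exact: maff.
Qed.

Lemma gstep_integrable s w : integrableR gauss (fun z => step e (w + s * z)).
Proof. by apply: (@Iaff _ _ _ 1); [exact: measurable_step|exact: step_norm_le1]. Qed.

Lemma EFin_gstep s w : (gstep s w)%:E = (\int[gauss]_z (step e (w + s * z))%:E)%E.
Proof. by rewrite (EFin_Rintegral (gstep_integrable s w)). Qed.

Lemma gstep_ge0 s w : 0 <= gstep s w.
Proof. by apply: Rintegral_ge0 => z _; exact: step_ge0. Qed.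

Lemma gstep_norm_le1 s w : `|gstep s w| <= 1.
Proof.
rewrite ger0_norm ?gstep_ge0// -[leRHS](Rintegral_prob_cst (@gauss R)).
apply: le_Rintegral_prob; [exact: gstep_integrable|exact: integrableR_cst|].
by move=> x; exact: step_le1.
Qed.

Lemma measurable_gstep s : measurable_fun [set: R] (gstep s).
Proof.
apply/measurable_EFinP.
rewrite (_ : EFin \o gstep s = fun w => (\int[gauss]_z (step e (w + s * z))%:E)%E);
  last by apply/funext => w; rewrite /= EFin_gstep.
apply: (@measurable_fun_fubini_tonelli_F _ _ (measurableTypeR R) _ R gauss
  (fun wz => (step e (wz.1 + s * wz.2))%:E)).
  apply/measurable_EFinP; apply: (measurableT_comp (measurable_step e)).
  by apply: measurable_funD => //; exact: measurable_funM.
by move=> x; rewrite lee_fin step_ge0.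
Qed.

Lemma gstep0 : gstep 0 = step e.
Proof.
apply/funext => w; rewrite /gstep.
under eq_Rintegral do rewrite mul0r addr0.
exact: Rintegral_prob_cst.
Qed.

Lemma gstep_convolution s c w : 0 <= s -> 0 < c ->
  \int[gauss]_z gstep s (w + c * z) = gstep (Num.sqrt (s ^+ 2 + c ^+ 2)) w.
Proof.
rewrite le_eqVlt => /predU1P[<-|s0] c0.
  by rewrite gstep0 expr0n/= add0r sqrtr_sqr gtr0_norm.
apply: EFin_inj; rewrite -EFin_Rintegral; last first.
  by apply: (@Iaff _ _ _ 1); [exact: measurable_gstep|exact: gstep_norm_le1].
under eq_integral do rewrite EFin_gstep.
rewrite gauss_convolution//; last 2 first.
- exact: continuous_step.
- by move=> x; exact: step_ge0.
by rewrite EFin_gstep addrC.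
Qed.

Lemma gstep_taylor s w : exists g1 g2, forall v,
  `|gstep s (w + v) - gstep s w - g1 * v - g2 * v ^+ 2| <= e ^- 3 * `|v| ^+ 3.
Proof.
pose p1 x : R := logistic1 (x / e); pose p2 x : R := logistic2 (x / e).
have mdiv : measurable_fun [set: R] (fun x => x / e) by exact: measurable_funM.
have I1 : integrableR gauss (fun z => p1 (w + s * z)).
  apply: (@Iaff _ _ _ 1); last by move=> x; exact: logistic1_le1.
  exact: (measurableT_comp measurable_logistic1).
have I2 : integrableR gauss (fun z => p2 (w + s * z)).
  apply: (@Iaff _ _ _ 1); last by move=> x; exact: logistic2_le1.
  exact: (measurableT_comp measurable_logistic2).
exists ((\int[gauss]_z p1 (w + s * z)) / e).
exists ((\int[gauss]_z p2 (w + s * z)) / 2 / e ^+ 2) => v.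
pose D z := step e (w + s * z + v) - step e (w + s * z) - p1 (w + s * z) / e * v
  - p2 (w + s * z) / 2 / e ^+ 2 * v ^+ 2.
pose l := [:: (1, fun z => step e (w + v + s * z)); (- 1, fun z => step e (w + s * z));
  (- (v / e), fun z => p1 (w + s * z)); (- (v ^+ 2 / 2 / e ^+ 2), fun z => p2 (w + s * z))].
have [|ID ED] := @integrableR_lin _ _ _ gauss l.
  by move=> u; rewrite /= !inE => /or4P[]/eqP->//; exact: gstep_integrable.
have DE : D = fun z => \sum_(i <- l) i.1 * i.2 z.
  apply/funext => z; rewrite !big_cons big_nil /D/=.
  rewrite (_ : w + v + s * z = w + s * z + v); last by ring.
  by field; rewrite gt_eqF.
rewrite -DE in ID ED; move: ED; rewrite !big_cons big_nil/= => ED.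
rewrite (_ : _ - _ = \int[gauss]_x D x); last first.
  rewrite ED /gstep; set A := \int[gauss]_z _; set B := \int[gauss]_z step e (w + s * z).
  set C := \int[gauss]_z _; set D' := \int[gauss]_z _.
  by field; rewrite gt_eqF.
apply: le_trans (le_normr_Rintegral measurableT ID) _.
rewrite -[leRHS](Rintegral_prob_cst (@gauss R)).
apply: le_Rintegral_prob; [exact: integrable_norm|exact: integrableR_cst|].
by move=> z; exact: step_taylor.
Qed.

End gaussian_smoothing.

(** * The central limit theorem by Lindeberg's replacement *)

Definition gauss_moment4 (R : realType) : R := \int[gauss]_z (z ^+ 4).

Section lindeberg.
Context d (T : measurableType d) (R : realType) (P : probability T R).
Context (y : T -> R).
Hypotheses (my : measurable_fun [set: T] y)
  (Iy : integrableR P (fun x => y x ^+ 4))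
  (y0 : \int[P]_x y x = 0) (y2 : \int[P]_x (y x ^+ 2) = 1).
Variables (e c l : R).
Hypotheses (e0 : 0 < e) (c0 : 0 < c) (l0 : 0 < l).

Let K := \int[P]_x (y x ^+ 4) + gauss_moment4 R.
Let err : R := e ^- 3 / 2 * (2 * l * c ^+ 2 + l^-1 * (K * c ^+ 4)).

Let K0 : 0 <= e ^- 3.
Proof. by rewrite invr_ge0 exprn_ge0// ltW. Qed.

(** One summand is replaced by a Gaussian with the same mean and variance, so that
    the two expansions differ only from the third order on. *)
Lemma swap_one s w : 0 <= s ->
  `|\int[P]_x gstep e s (w + c * y x) - gstep e (Num.sqrt (s ^+ 2 + c ^+ 2)) w| <= err.
Proof.
move=> s0; have [g1 [g2 H]] := gstep_taylor e0 s w.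
have I2 : integrableR P (fun x => y x ^+ 2).
  apply: integrableR_of_sqr; first exact: measurable_funX.
  by under eq_fun do rewrite -exprM.
have I1 := integrableR_of_sqr my I2.
have G2 := @integrable_gauss_pow R 2; have G4 := @integrable_gauss_pow R 4.
have G1 : integrableR (@gauss R) (fun x => x).
  by have := @integrable_gauss_pow R 1; under eq_fun do rewrite expr1.
have [z1 z2] := @gauss_moments R.
have := @taylor_expectation R _ _ P (fun x => c * y x) (gstep e s) w g1 g2 (e ^- 3) l
  (measurable_gstep e s) (gstep_norm_le1 e s).
have := @taylor_expectation R _ _ gauss (fun z => c * z) (gstep e s) w g1 g2 (e ^- 3) l
  (measurable_gstep e s) (gstep_norm_le1 e s).
under [X in gauss.-integrable _ (EFin \o X)]eq_fun do rewrite exprMn.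
under [X in P.-integrable _ (EFin \o X)]eq_fun do rewrite exprMn.
under [\int[gauss]_x ((c * x) ^+ 2)]eq_Rintegral do rewrite exprMn.
under [\int[gauss]_x ((c * x) ^+ 4)]eq_Rintegral do rewrite exprMn.
under [\int[P]_x ((c * y x) ^+ 2)]eq_Rintegral do rewrite exprMn.
under [\int[P]_x ((c * y x) ^+ 4)]eq_Rintegral do rewrite exprMn.
rewrite !RintegralZl// y0 y2 z1 z2 !mulr0 gstep_convolution//.
move=> A B; have {}A := A _ (integrableR_scale _ G4) erefl l0 K0 H.
have {}B := B _ (integrableR_scale _ Iy) erefl l0 K0 H.
have {}A := A (measurable_funM (measurable_cst c) (@measurable_id _ R setT)).
have {}B := B (measurable_funM (measurable_cst c) my).
rewrite distrC in A.
apply: (le_trans (ler_distD (gstep e s w + g2 * (c ^+ 2 * 1)) _ _)).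
apply: le_trans (lerD B A) _; rewrite -/(gauss_moment4 R) /err /K mulr1.
by rewrite le_eqVlt; apply/orP; left; apply/eqP; ring.
Qed.

(** Induction peels off one observation: the other summands are already Gaussian up
    to [k%:R * err], and [swap_one] replaces the last one. *)
Lemma lindeberg k w :
  `|\int[iid_law P k]_t step e (w + c * tsum y t) - gstep e (c * Num.sqrt k%:R) w|
    <= k%:R * err.
Proof.
have mstep n v : measurable_fun [set: n.-tuple T] (fun t => step e (v + c * tsum y t)).
  apply: (measurableT_comp (measurable_step e)); apply: measurable_funD => //.
  by apply: measurable_funM => //; exact: measurable_tsum.
have Istep n v : integrableR (iid_law P n) (fun t => step e (v + c * tsum y t)).
  apply: (@integrableR_bounded _ _ _ _ _ 1); first exact: mstep.
  by move=> t; exact: step_norm_le1.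
elim: k w => [|k IH] w.
  rewrite sqrtr0 mulr0 gstep0 mul0r.
  under eq_Rintegral do rewrite tsum0 mulr0 addr0.
  by rewrite Rintegral_prob_cst subrr normr0.
pose g v := \int[iid_law P k]_t step e (v + c * tsum y t).
have g1 v : `|g v| <= 1.
  apply: le_trans (le_normr_Rintegral measurableT (Istep k v)) _.
  rewrite -[leRHS](Rintegral_prob_cst (iid_law P k)).
  apply: le_Rintegral_prob; [exact: integrable_norm|exact: integrableR_cst|].
  by move=> t; exact: step_norm_le1.
have EFing v : (g v)%:E = (\int[iid_law P k]_t (step e (v + c * tsum y t))%:E)%E.
  by rewrite (EFin_Rintegral (Istep k v)).
have mg : measurable_fun [set: T] (fun x => g (w + c * y x)).
  apply/measurable_EFinP; rewrite (_ : _ \o _ =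
    fun x => (\int[iid_law P k]_t (step e (w + c * y x + c * tsum y t))%:E)%E);
    last by apply/funext => x; rewrite /= EFing.
  apply: (@measurable_fun_fubini_tonelli_F _ _ T _ R (iid_law P k)
    (fun xt => (step e (w + c * y xt.1 + c * tsum y xt.2))%:E)).
    apply/measurable_EFinP; apply: (measurableT_comp (measurable_step e)).
    apply: measurable_funD; last first.
      apply: measurable_funM => //.
      rewrite [X in measurable_fun _ X](_ : _ = @tsum _ T R y k \o snd)//.
      by apply: measurableT_comp => //; exact: measurable_tsum.
    apply: measurable_funD => //; apply: measurable_funM => //.
    exact: (measurableT_comp my).
  by move=> z; rewrite lee_fin step_ge0.
have Ig : integrableR P (fun x => g (w + c * y x)).
  exact: (@integrableR_bounded _ _ _ _ _ 1).
have -> : \int[iid_law P k.+1]_t step e (w + c * tsum y t) = \int[P]_x g (w + c * y x).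
  apply: EFin_inj; rewrite -EFin_Rintegral// -(EFin_Rintegral Ig).
  rewrite (@ge0_integral_iidS1 _ T R P k (fun t => (step e (w + c * tsum y t))%:E)).
  - apply: eq_integral => x _; rewrite EFing; apply: eq_integral => t _.
    by rewrite tsum_cons mulrDr addrA.
  - by apply/measurable_EFinP; exact: mstep.
  - by move=> t; rewrite lee_fin step_ge0.
pose s := c * Num.sqrt k%:R.
have s0 : 0 <= s by rewrite mulr_ge0 ?sqrtr_ge0// ltW.
have -> : c * Num.sqrt k.+1%:R = Num.sqrt (s ^+ 2 + c ^+ 2).
  rewrite /s exprMn sqr_sqrtr ?ler0n// -[X in _ + X]mulr1 -mulrDr natr1.
  by rewrite sqrtrM ?sqr_ge0// sqrtr_sqr gtr0_norm.
have Is : integrableR P (fun x => gstep e s (w + c * y x)).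
  apply: (@integrableR_bounded _ _ _ _ _ 1); last by move=> x; exact: gstep_norm_le1.
  apply: (measurableT_comp (measurable_gstep e s)); apply: measurable_funD => //.
  exact: measurable_funM.
apply: (le_trans (ler_distD (\int[P]_x gstep e s (w + c * y x)) _ _)).
rewrite -natr1 mulrDl mul1r; apply: lerD; last exact: swap_one.
rewrite -RintegralB//.
apply: le_trans (le_normr_Rintegral measurableT (integrableR_sub Ig Is)) _.
rewrite -[leRHS](Rintegral_prob_cst P).
apply: le_Rintegral_prob; last by move=> x; exact: IH.
  exact: integrable_norm (integrableR_sub Ig Is).
exact: integrableR_cst.
Qed.

Lemma lindeberg_clt m a z : (0 < m)%N -> c = (Num.sqrt m%:R)^-1 -> K <= l ^+ 2 * m%:R ->
  0 < a ->
  `|pr (iid_law P m) [set t | c * tsum y t <= z] - Phi z| <=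
    2 * a + 2 * (e / a) + 2 * l * e ^- 3.
Proof.
move=> m0 cE Km a0.
have m0' : 0 < m%:R :> R by rewrite ltr0n.
have c2 : c ^+ 2 = m%:R^-1 by rewrite cE exprVn sqr_sqrtr ?ler0n.
have mX : measurable_fun [set: m.-tuple T] (fun t => c * tsum y t).
  by apply: measurable_funM => //; exact: measurable_tsum.
have bound w : `|\int[iid_law P m]_t step e (c * tsum y t - w) -
    \int[gauss]_x step e (x - w)| <= 2 * l * e ^- 3.
  have := lindeberg m (- w).
  rewrite cE mulVf ?gt_eqF ?sqrtr_gt0// -cE /gstep.
  under eq_Rintegral do rewrite addrC.
  under [X in _ - X]eq_Rintegral do rewrite mul1r addrC.
  move=> /le_trans; apply.
  rewrite /err [c ^+ 4](_ : _ = c ^+ 2 * c ^+ 2); last by rewrite -exprD.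
  rewrite c2 [leLHS](_ : _ = e ^- 3 / 2 * (2 * l + l^-1 * (K / m%:R))); last first.
    by field; rewrite !gt_eqF.
  have : l^-1 * (K / m%:R) <= l.
    by rewrite ler_pdivrMl// ler_pdivrMr// -expr2.
  move=> h; rewrite [leRHS](_ : _ = e ^- 3 / 2 * (4 * l)); last by field; rewrite gt_eqF.
  rewrite ler_wpM2l ?divr_ge0//.
  by have := l0; lra.
have mid := @measurable_id _ R [set: R].
have PhiX b : pr gauss [set x : R | x <= b] = Phi b by rewrite PhiE.
rewrite ler_norml; apply/andP; split.
  have := @cdf_le_of_step R _ _ _ _ gauss (iid_law P m) id _ e a (z - 2 * a)
    (2 * l * e ^- 3) mid mX e0 a0.
  rewrite subrK PhiX => H.
  have h1 : Phi z - Phi (z - 2 * a) <= 2 * a.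
    by apply: le_trans (Phi_lipschitz _) _; lra.
  have : \int[gauss]_x step e (x - (z - 2 * a + a)) <=
      \int[iid_law P m]_t step e (c * tsum y t - (z - 2 * a + a)) + 2 * l * e ^- 3.
    by have := bound (z - 2 * a + a); rewrite ler_norml => /andP[+ _]; lra.
  by move=> /H; lra.
have := @cdf_le_of_step R _ _ _ _ (iid_law P m) gauss _ id e a z
    (2 * l * e ^- 3) mX mid e0 a0.
rewrite PhiX => H; rewrite lerBlDr.
have h1 : Phi (z + 2 * a) - Phi z <= 2 * a.
  by apply: le_trans (Phi_lipschitz _) _; lra.
have : \int[iid_law P m]_t step e (c * tsum y t - (z + a)) <=
    \int[gauss]_x step e (x - (z + a)) + 2 * l * e ^- 3.
  by have := bound (z + a); rewrite ler_norml => /andP[_]; lra.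
by move=> /H; lra.
Qed.

End lindeberg.

Lemma gauss_moment4_ge0 (R : realType) : 0 <= gauss_moment4 R.
Proof. by apply: Rintegral_ge0 => z _; rewrite exprn_even_ge0. Qed.

Lemma sqr_moment2_le d (T : measurableType d) (R : realType) (P : probability T R)
    (f : T -> R) : measurable_fun [set: T] f -> integrableR P (fun x => f x ^+ 4) ->
  (\int[P]_x (f x ^+ 2)) ^+ 2 <= \int[P]_x (f x ^+ 4).
Proof.
move=> mf I4.
have I2 : integrableR P (fun x => (f x ^+ 2) ^+ 2) by under eq_fun do rewrite -exprM.
have := @Cauchy_Schwarz _ _ _ P (fun x => f x ^+ 2) (fun=> 1)
  (measurable_funX _ mf) (measurable_cst _) I2.
under [\int[P]_x (f x ^+ 2 * 1)]eq_Rintegral do rewrite mulr1.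
under [\int[P]_x ((f x ^+ 2) ^+ 2)]eq_Rintegral do rewrite -exprM.
rewrite expr1n Rintegral_prob_cst mulr1; apply.
exact: integrableR_cst.
Qed.

(** The smoothing parameters are fixed in terms of [eps] first, and then the ratio
    of the fourth moment to the squared variance is taken small; the summands enter
    through this ratio alone, which gives the uniformity over distributions. *)
Lemma clt (R : realType) (eps : R) : 0 < eps -> exists2 eta : R, 0 < eta &
  forall d (T : measurableType d) (P : probability T R) (f : T -> R) m,
  (0 < m)%N -> measurable_fun [set: T] f -> integrableR P (fun x => f x ^+ 4) ->
  \int[P]_x f x = 0 -> 0 < \int[P]_x (f x ^+ 2) ->
  \int[P]_x (f x ^+ 4) <= eta * m%:R * (\int[P]_x (f x ^+ 2)) ^+ 2 ->
  forall z, `|pr (iid_law P m) [set t | tsum f t <=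
    z * Num.sqrt (m%:R * \int[P]_x (f x ^+ 2))] - Phi z| <= eps.
Proof.
move=> eps0.
(* the three error terms [2 * a], [2 * (e / a)] and [2 * l * e ^- 3] of
   [lindeberg_clt] become [eps / 4], [eps / 4] and [eps / 2] *)
pose a := eps / 8; pose e := a * eps / 8; pose l := eps / 4 * e ^+ 3.
have a0 : 0 < a by rewrite divr_gt0.
have e0 : 0 < e by rewrite divr_gt0 ?mulr_gt0.
have l0 : 0 < l by rewrite mulr_gt0 ?divr_gt0 ?exprn_gt0.
have g0 := gauss_moment4_ge0 R.
exists (l ^+ 2 / (1 + gauss_moment4 R)).
  by rewrite divr_gt0 ?exprn_gt0// ltr_pwDl.
move=> d T P f m m0 mf I4 f0 s0 H4 z.
set V := \int[P]_x (f x ^+ 2) in s0 H4 *.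
pose s := Num.sqrt V.
have sgt0 : 0 < s by rewrite sqrtr_gt0.
have s2 : s ^+ 2 = V by rewrite sqr_sqrtr// ltW.
pose y x := s^-1 * f x.
have my : measurable_fun [set: T] y by exact: measurable_funM.
have I2 : integrableR P (fun x => f x ^+ 2).
  apply: integrableR_of_sqr; first exact: measurable_funX.
  by under eq_fun do rewrite -exprM.
have If := integrableR_of_sqr mf I2.
have Iy : integrableR P (fun x => y x ^+ 4).
  by under eq_fun do rewrite /y exprMn; exact: integrableR_scale.
have y0 : \int[P]_x y x = 0 by rewrite /y RintegralZl// f0 mulr0.
have y2 : \int[P]_x (y x ^+ 2) = 1.
  under eq_Rintegral do rewrite /y exprMn.
  by rewrite RintegralZl// exprVn s2 mulVf// gt_eqF.
have y4 : \int[P]_x (y x ^+ 4) = (\int[P]_x (f x ^+ 4)) / V ^+ 2.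
  under eq_Rintegral do rewrite /y exprMn.
  by rewrite RintegralZl// exprVn -s2 -exprM mulrC.
have m0' : 0 < m%:R :> R by rewrite ltr0n.
pose c : R := (Num.sqrt m%:R)^-1.
have c0 : 0 < c by rewrite invr_gt0 sqrtr_gt0.
have y41 : 1 <= \int[P]_x (y x ^+ 4).
  rewrite y4 ler_pdivlMr ?exprn_gt0// mul1r; exact: sqr_moment2_le.
have Km : \int[P]_x (y x ^+ 4) + gauss_moment4 R <= l ^+ 2 * m%:R.
  have h : \int[P]_x (y x ^+ 4) <= l ^+ 2 / (1 + gauss_moment4 R) * m%:R.
    by rewrite y4 ler_pdivrMr ?exprn_gt0.
  apply: (@le_trans _ _ ((1 + gauss_moment4 R) * \int[P]_x (y x ^+ 4))).
    by rewrite mulrDl mul1r lerD2l ler_peMr.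
  rewrite mulrC -ler_pdivlMr ?ltr_pwDl//; apply: le_trans h _.
  by rewrite mulrAC.
have := @lindeberg_clt d T R P y my Iy y0 y2 e c l e0 c0 l0 m a z m0 erefl Km a0.
have -> : [set t : m.-tuple T | c * tsum y t <= z] =
    [set t | tsum f t <= z * Num.sqrt (m%:R * V)].
  have E (t : m.-tuple T) : c * tsum y t = tsum f t / Num.sqrt (m%:R * V).
    rewrite sqrtrM ?ler0n// -/s /c invfM [RHS]mulrC -mulrA; congr (_ * _).
    by rewrite /tsum mulr_sumr.
  by apply/seteqP; split => t /=; rewrite E ler_pdivrMr// sqrtr_gt0 mulr_gt0.
move=> /le_trans; apply.
rewrite (_ : 2 * l * e ^- 3 = eps / 2).
  rewrite (_ : 2 * (e / a) = eps / 4).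
    by rewrite /a; lra.
  by rewrite /e; field; rewrite gt_eqF.
by rewrite /l; field; rewrite gt_eqF.
Qed.

(** * Self-normalised sums *)

Lemma measurable_invr (R : realType) : measurable_fun [set: R] (@GRing.inv R).
Proof.
have -> : [set: R] = [set~ 0] `|` [set 0] by rewrite setvU.
apply/measurable_funU; [exact: measurableC|exact: measurable_set1|split].
  apply: subspace_continuous_measurable_fun; first exact: measurableC.
  apply: continuous_in_subspaceT => x; rewrite inE/= => /eqP x0.
  exact: inv_continuous.
exact: measurable_fun_set1.
Qed.

Lemma measurable_sqrtr (R : realType) : measurable_fun [set: R] (@Num.sqrt R).
Proof. by apply: continuous_measurable_fun; exact: sqrt_continuous. Qed.

Section studentized.
Context (T : Type) (R : realType).
Implicit Types f : T -> R.

Definition tstat f m (t : m.-tuple T) : R :=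
  Num.sqrt m%:R * (m%:R^-1 * \sum_(i < m) f (tnth t i)) /
  Num.sqrt (m%:R^-1 * \sum_(i < m)
    (f (tnth t i) - m%:R^-1 * \sum_(j < m) f (tnth t j)) ^+ 2).

End studentized.

Section studentized_algebra.
Context d (T : measurableType d) (R : realType).
Implicit Types f : T -> R.

Lemma sample_variance f m (t : m.-tuple T) : (0 < m)%N ->
  m%:R^-1 * \sum_(i < m) (f (tnth t i) - m%:R^-1 * \sum_(j < m) f (tnth t j)) ^+ 2 =
  m%:R^-1 * tsum (fun x => f x ^+ 2) t - (m%:R^-1 * tsum f t) ^+ 2.
Proof.
move=> m0; rewrite /tsum; set S := \sum_(j < m) f (tnth t j).
have m0' : m%:R != 0 :> R by rewrite pnatr_eq0 -lt0n.
set c := m%:R^-1 * S.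
rewrite (eq_bigr (fun i => f (tnth t i) ^+ 2 - 2 * c * f (tnth t i) + c ^+ 2)).
  rewrite big_split sumrB/= sumr_const card_ord -mulr_sumr -/S -[c ^+ 2 *+ m]mulr_natl.
  by rewrite /c; field.
by move=> i _; ring.
Qed.

Lemma measurable_tstat f m : measurable_fun [set: T] f ->
  measurable_fun [set: m.-tuple T] (fun t => tstat f t).
Proof.
move=> mf; have mS := @measurable_tsum _ T R f m mf.
pose D (t : m.-tuple T) := m%:R^-1 * \sum_(i < m)
    (f (tnth t i) - m%:R^-1 * \sum_(j < m) f (tnth t j)) ^+ 2.
suff mD : measurable_fun [set: m.-tuple T] D.
  rewrite [X in measurable_fun _ X](_ : _ = fun t =>
    Num.sqrt m%:R * (m%:R^-1 * tsum f t) * (GRing.inv \o (Num.sqrt \o D)) t)//.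
  apply: measurable_funM.
    by apply: measurable_funM => //; exact: measurable_funM.
  apply: measurableT_comp; first exact: measurable_invr.
  by apply: measurableT_comp; first exact: measurable_sqrtr.
apply: measurable_funM => //.
apply: measurable_sum => i; apply: measurable_funX; apply: measurable_funB.
  by apply: (measurableT_comp mf); exact: measurable_tnth.
by apply: measurable_funM.
Qed.

(** The event [tstat f t <= z] says that the sum is at most [z] times the square
    root of the sample variance, and the relative error of a square root is at most
    that of its argument. *)
Lemma tstat_sandwich f m (t : m.-tuple T) (V e z : R) : (0 < m)%N -> 0 < V ->
  0 < e -> e <= 8^-1 ->
  let q := (m%:R^-1 * tsum (fun x => f x ^+ 2) t - (m%:R^-1 * tsum f t) ^+ 2) / V in
  1 - 2 * e <= q <= 1 + 2 * e ->
  (tstat f t <= z -> tsum f t <= (z + 2 * e * `|z|) * Num.sqrt (m%:R * V)) /\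
  (tsum f t <= (z - 2 * e * `|z|) * Num.sqrt (m%:R * V) -> tstat f t <= z).
Proof.
move=> m0 V0 e0 e8 q /andP[q1 q2].
have m0' : 0 < m%:R :> R by rewrite ltr0n.
have q0 : 0 < q by lra.
pose r := Num.sqrt q; have r0 : 0 < r by rewrite sqrtr_gt0.
have r2 : r ^+ 2 = q by rewrite sqr_sqrtr// ltW.
have r1 : 1 - 2 * e <= r by rewrite -ler_sqr ?nnegrE ?r2//; [nra|lra|exact: ltW].
have r1' : r <= 1 + 2 * e by rewrite -ler_sqr ?nnegrE ?r2//; [nra|exact: ltW|lra].
pose s := Num.sqrt (m%:R * V); have s0 : 0 < s by rewrite sqrtr_gt0 mulr_gt0.
have TE : tstat f t = tsum f t / (s * r).
  rewrite /tstat sample_variance// -/(tsum f t).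
  rewrite (_ : _ - _ = V * q); last by rewrite /q; field; rewrite !gt_eqF.
  rewrite (sqrtrM q (ltW V0)) -/r /s (sqrtrM V (ltW m0')).
  have sm : 0 < Num.sqrt m%:R :> R by rewrite sqrtr_gt0.
  have sV : 0 < Num.sqrt V by rewrite sqrtr_gt0.
  have mE : m%:R = Num.sqrt m%:R * Num.sqrt m%:R :> R.
    by rewrite -expr2 sqr_sqrtr// ltW.
  by rewrite [X in X^-1]mE; field; rewrite !gt_eqF.
rewrite TE ler_pdivrMr ?mulr_gt0// -/s (_ : z * (s * r) = s * (z * r)); last by ring.
have zr : `|z * r - z| <= 2 * e * `|z|.
  rewrite -{2}(mulr1 z) -mulrBr normrM mulrC ler_wpM2r// ler_norml.
  by apply/andP; split; lra.
move: zr; rewrite ler_norml => /andP[z1 z2].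
split=> h; apply: le_trans h _; first by rewrite [leRHS]mulrC ler_pM2l//; lra.
by rewrite [leLHS]mulrC ler_pM2l//; lra.
Qed.

End studentized_algebra.

(** The stretched argument stays at distance at least [`|z| / 2] from the origin. *)
Lemma Phi_stretch (R : realType) (z e : R) : 0 <= e -> e <= 4^-1 ->
  Phi (z + 2 * e * `|z|) <= Phi z + 3 * e /\ Phi z - 3 * e <= Phi (z - 2 * e * `|z|).
Proof.
move=> e0 e4.
have u0 := normr_ge0 z.
have eu : 2 * e * `|z| <= `|z| / 2.
  by rewrite mulrC ler_wpM2l//; lra.
have eu0 : 0 <= 2 * e * `|z| by rewrite !mulr_ge0.
split.
  have : Phi (z + 2 * e * `|z|) - Phi z <= 3 * e; last by lra.
  apply: (@Phi_rescale _ z) => //; [lra|lra|move=> x /andP[x1 x2]].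
  by move: eu x2; have [z0|z0] := ger0P z; have [x0|x0] := ger0P x; lra.
have : Phi z - Phi (z - 2 * e * `|z|) <= 3 * e; last by lra.
apply: (@Phi_rescale _ z) => //; [lra|lra|move=> x /andP[x1 x2]].
by move: eu x1; have [z0|z0] := ger0P z; have [x0|x0] := ger0P x; lra.
Qed.

Section sample_variance_law.
Context d (T : measurableType d) (R : realType) (P : probability T R) (f : T -> R).
Hypotheses (mf : measurable_fun [set: T] f)
  (I4 : integrableR P (fun x => f x ^+ 4)) (f0 : \int[P]_x f x = 0).
Let V := \int[P]_x (f x ^+ 2).
Let M := \int[P]_x (f x ^+ 4).
Context (m : nat) (eta e : R).
Hypotheses (m0 : (0 < m)%N) (V0 : 0 < V) (e0 : 0 < e) (e1 : e <= 1)
  (HM : M <= eta * m%:R * V ^+ 2).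

Let Q (t : m.-tuple T) : R :=
  (m%:R^-1 * tsum (fun x => f x ^+ 2) t - (m%:R^-1 * tsum f t) ^+ 2) / V.

Lemma measurable_sample_variance : measurable_fun [set: m.-tuple T] Q.
Proof.
have mf2 : measurable_fun [set: T] (fun x => f x ^+ 2) by exact: measurable_funX.
apply: measurable_funM => //; apply: measurable_funB.
  by apply: measurable_funM => //; exact: measurable_tsum.
by apply: measurable_funX; apply: measurable_funM => //; exact: measurable_tsum.
Qed.

(** The mean of squares is a sum of independent variables whose variance is at most
    the fourth moment; the squared mean has expectation of order [V / m], and [m] is
    large because the fourth moment is at least the squared variance. *)
Lemma sample_variance_concentration :
  pr (iid_law P m) [set t | ~~ (1 - 2 * e <= Q t <= 1 + 2 * e)] <= 2 * (eta / e ^+ 2).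
Proof.
have m0' : 0 < m%:R :> R by rewrite ltr0n.
have mf2 : measurable_fun [set: T] (fun x => f x ^+ 2) by exact: measurable_funX.
have I22 : integrableR P (fun x => (f x ^+ 2) ^+ 2) by under eq_fun do rewrite -exprM.
have I2 := integrableR_of_sqr mf2 I22.
pose g x := f x ^+ 2 - V.
have mg : measurable_fun [set: T] g by exact: measurable_funB.
have gE : (fun x => g x ^+ 2) = (fun x => \sum_(i <- [:: (1, fun x => f x ^+ 4);
  (- (2 * V), fun x => f x ^+ 2); (V ^+ 2, fun=> 1)]) i.1 * i.2 x).
  by apply/funext => x; rewrite !big_cons big_nil /g/=; ring.
have [|Ig Eg] := @integrableR_lin _ _ _ P [:: (1, fun x => f x ^+ 4);
  (- (2 * V), fun x => f x ^+ 2); (V ^+ 2, fun=> 1)].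
  by move=> u; rewrite /= !inE => /or3P[]/eqP->//; exact: integrableR_cst.
rewrite -gE in Ig Eg; move: Eg; rewrite !big_cons big_nil/= -/M -/V Rintegral_prob_cst => Eg.
have g0 : \int[P]_x g x = 0.
  rewrite /g RintegralB//; last exact: integrableR_cst.
  by rewrite Rintegral_prob_cst subrr.
have [IA EA] := tsum_cov m mf mf I2 I2 f0 f0.
have [IG EG] := tsum_cov m mg mg Ig Ig g0 g0.
have mA := @measurable_tsum _ T R f m mf.
have mG := @measurable_tsum _ T R g m mg.
have H1 : pr (iid_law P m) [set t | e * m%:R * V <= `|tsum g t|] <= eta / e ^+ 2.
  apply: le_trans (@markov_pr _ _ _ _ _ (fun t => tsum g t * tsum g t)
    ((e * m%:R * V) ^+ 2) _ _ IG _ _) _.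
  - rewrite -[X in measurable X]setTI.
    by apply: measurable_fun_le => //; exact: measurableT_comp.
  - by rewrite exprn_gt0// !mulr_gt0.
  - by move=> t; rewrite -expr2 sqr_ge0.
  - move=> t /= h; rewrite -expr2 -[leRHS](real_normK (num_real _)).
    by rewrite lerXn2r// nnegrE ?mulr_ge0 ?ltW.
  rewrite EG; under eq_Rintegral do rewrite -expr2.
  rewrite Eg ler_pdivrMr ?exprn_gt0 ?mulr_gt0//.
  rewrite [leRHS](_ : _ = m%:R * (eta * m%:R * V ^+ 2)); last by field; rewrite gt_eqF.
  rewrite ler_pM2l//; have := HM; have := sqr_ge0 V; lra.
have V2M : V ^+ 2 <= M by exact: sqr_moment2_le.
have eta1 : 1 <= eta * m%:R.
  have := le_trans V2M HM.
  by rewrite -{1}[V ^+ 2]mul1r ler_pM2r// exprn_gt0.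
have H2 : pr (iid_law P m) [set t | e * m%:R ^+ 2 * V <= tsum f t ^+ 2] <= eta / e ^+ 2.
  apply: le_trans (@markov_pr _ _ _ _ _ (fun t => tsum f t * tsum f t)
    (e * m%:R ^+ 2 * V) _ _ IA _ _) _.
  - rewrite -[X in measurable X]setTI.
    by apply: measurable_fun_le => //; exact: measurable_funX.
  - by rewrite !mulr_gt0// exprn_gt0.
  - by move=> t; rewrite -expr2 sqr_ge0.
  - by move=> t /=; rewrite expr2.
  rewrite EA; under eq_Rintegral do rewrite -expr2.
  rewrite -/V ler_pdivrMr ?mulr_gt0 ?exprn_gt0//.
  rewrite [leRHS](_ : _ = (m%:R * V) * (eta * m%:R / e)); last by field; rewrite gt_eqF.
  apply: ler_peMr; first by rewrite mulr_ge0// ltW.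
  by rewrite ler_pdivlMr// mul1r (le_trans e1).
have mQ := measurable_sample_variance.
have mE1 : measurable [set t : m.-tuple T | e * m%:R * V <= `|tsum g t|].
  rewrite -[X in measurable X]setTI.
  by apply: measurable_fun_le => //; exact: measurableT_comp.
have mE2 : measurable [set t : m.-tuple T | e * m%:R ^+ 2 * V <= tsum f t ^+ 2].
  rewrite -[X in measurable X]setTI.
  by apply: measurable_fun_le => //; exact: measurable_funX.
have mE : measurable [set t | ~~ (1 - 2 * e <= Q t <= 1 + 2 * e)].
  rewrite [X in measurable X](_ : _ = ~` ([set t | 1 - 2 * e <= Q t] `&`
    [set t | Q t <= 1 + 2 * e])).
    apply: measurableC; apply: measurableI; last exact: measurable_RV_le.
    by rewrite -[X in measurable X]setTI; exact: measurable_fun_le.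
  apply/seteqP; split => t /=; first by move=> /negP h [h1 h2]; apply: h; rewrite h1.
  by move=> h; apply/negP => /andP.
rewrite [leRHS](_ : _ = eta / e ^+ 2 + eta / e ^+ 2); last by ring.
apply: (le_trans _ (lerD H1 H2)).
apply: (le_trans _ (pr_setU _ mE1 mE2)); apply: le_pr => //; first exact: measurableU.
move=> t /=; apply: contraPP => /not_orP[/negP + /negP].
rewrite -!ltNge => h1 h2; apply/negP/negPn.
have gS : tsum g t = tsum (fun x => f x ^+ 2) t - m%:R * V.
  by rewrite /tsum /g sumrB sumr_const card_ord mulr_natl.
have QE : Q t = 1 + tsum g t / (m%:R * V) - tsum f t ^+ 2 / (m%:R ^+ 2 * V).
  by rewrite /Q gS; field; rewrite !gt_eqF.
have b1 : `|tsum g t / (m%:R * V)| <= e.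
  have mV : 0 < m%:R * V by exact: mulr_gt0.
  by rewrite normrM normfV (gtr0_norm mV) ler_pdivrMr// mulrA ltW.
have b2 : tsum f t ^+ 2 / (m%:R ^+ 2 * V) <= e.
  by rewrite ler_pdivrMr ?mulr_gt0 ?exprn_gt0// mulrA ltW.
have b3 : 0 <= tsum f t ^+ 2 / (m%:R ^+ 2 * V).
  by rewrite divr_ge0 ?sqr_ge0// mulr_ge0 ?sqr_ge0// ltW.
by rewrite QE; move: b1; rewrite ler_norml => /andP[? ?]; apply/andP; split; lra.
Qed.

End sample_variance_law.

(** Self-normalisation: the sample variance concentrates because its relative
    variance is of the order of the ratio that controls the central limit theorem. *)
Lemma studentized_clt (R : realType) (eps : R) : 0 < eps -> exists2 eta : R, 0 < eta &
  forall d (T : measurableType d) (P : probability T R) (f : T -> R) m,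
  (0 < m)%N -> measurable_fun [set: T] f -> integrableR P (fun x => f x ^+ 4) ->
  \int[P]_x f x = 0 -> 0 < \int[P]_x (f x ^+ 2) ->
  \int[P]_x (f x ^+ 4) <= eta * m%:R * (\int[P]_x (f x ^+ 2)) ^+ 2 ->
  forall z, `|pr (iid_law P m) [set t | tstat f t <= z] - Phi z| <= eps.
Proof.
move=> eps0.
have eps4 : 0 < eps / 4 by rewrite divr_gt0.
have [eta1 eta10 CLT] := clt eps4.
pose e := Num.min 8^-1 (eps / 12).
have e0 : 0 < e by rewrite lt_min invr_gt0 ltr0n divr_gt0.
have e8 : e <= 8^-1 by rewrite ge_min lexx.
have eeps : e <= eps / 12 by rewrite ge_min lexx orbT.
exists (Num.min eta1 (e ^+ 2 * eps / 8)).
  by rewrite lt_min eta10 divr_gt0// mulr_gt0// exprn_gt0.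
move=> d T P f m m0 mf I4 f0 V0 HM z.
set V := \int[P]_x (f x ^+ 2) in V0 HM *.
have m0' : 0 < m%:R :> R by rewrite ltr0n.
have weak eta' : Num.min eta1 (e ^+ 2 * eps / 8) <= eta' ->
    \int[P]_x (f x ^+ 4) <= eta' * m%:R * V ^+ 2.
  move=> h; apply: le_trans HM _.
  apply: ler_wpM2r; first exact: sqr_ge0.
  by apply: ler_wpM2r; first exact: ler0n.
have w1 : Num.min eta1 (e ^+ 2 * eps / 8) <= eta1 by rewrite ge_min lexx.
have w2 : Num.min eta1 (e ^+ 2 * eps / 8) <= e ^+ 2 * eps / 8.
  by rewrite ge_min lexx orbT.
have e1 : e <= 1 by lra.
have {}CLT := CLT d T P f m m0 mf I4 f0 V0 (weak _ w1).
have := @sample_variance_concentration d T R P f mf I4 f0 m (e ^+ 2 * eps / 8) e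
  m0 V0 e0 e1 (weak _ w2).
have mf2 : measurable_fun [set: T] (fun x => f x ^+ 2) by exact: measurable_funX.
pose Q (t : m.-tuple T) : R :=
  (m%:R^-1 * tsum (fun x => f x ^+ 2) t - (m%:R^-1 * tsum f t) ^+ 2) / V.
rewrite [X in pr _ X](_ : _ = [set t | ~~ (1 - 2 * e <= Q t <= 1 + 2 * e)])//.
rewrite (_ : 2 * (e ^+ 2 * eps / 8 / e ^+ 2) = eps / 4); last by field; rewrite gt_eqF.
have mQ : measurable_fun [set: m.-tuple T] Q by exact: measurable_sample_variance.
set B := [set t | ~~ _] => HB.
have mB : measurable B.
  rewrite [X in measurable X](_ : _ = ~` ([set t | 1 - 2 * e <= Q t] `&`
    [set t | Q t <= 1 + 2 * e])).
    apply: measurableC; apply: measurableI; last exact: measurable_RV_le.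
    by rewrite -[X in measurable X]setTI; exact: measurable_fun_le.
  apply/seteqP; split => t /=; first by move=> /negP h [h1 h2]; apply: h; rewrite h1.
  by move=> h; apply/negP => /andP.
have mT := measurable_RV_le (@measurable_tstat _ T R f m mf) z.
have mS b := measurable_RV_le (@measurable_tsum _ T R f m mf) b.
have e4 : e <= 4^-1 by lra.
have [P1 P2] := @Phi_stretch R z e (ltW e0) e4.
have sw (t : m.-tuple T) := @tstat_sandwich d T R f m t V e z m0 V0 e0 e8.
rewrite ler_norml; apply/andP; split.
  have h := CLT (z - 2 * e * `|z|); move: h; rewrite ler_norml => /andP[h _].
  have : pr (iid_law P m) [set t | tsum f t <=
      (z - 2 * e * `|z|) * Num.sqrt (m%:R * V)] <=
      pr (iid_law P m) [set t | tstat f t <= z] + pr (iid_law P m) B.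
    apply: (le_trans _ (pr_setU _ mT mB)); apply: le_pr => //; first exact: measurableU.
    move=> t /= ht; have [tB|/negPn tB] := boolP (~~ (1 - 2 * e <= Q t <= 1 + 2 * e)).
      by right.
    by left; have [_] := sw t tB; exact.
  by lra.
have h := CLT (z + 2 * e * `|z|); move: h; rewrite ler_norml => /andP[_ h].
have : pr (iid_law P m) [set t | tstat f t <= z] <=
    pr (iid_law P m) [set t | tsum f t <= (z + 2 * e * `|z|) * Num.sqrt (m%:R * V)] +
    pr (iid_law P m) B.
  apply: (le_trans _ (pr_setU _ (mS _) mB)); apply: le_pr => //; first exact: measurableU.
  move=> t /= ht; have [tB|/negPn tB] := boolP (~~ (1 - 2 * e <= Q t <= 1 + 2 * e)).
    by right.
  by left; have [+ _] := sw t tB; exact.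
by lra.
Qed.

(** * Fubini's theorem for real integrals *)

Section real_Fubini.
Context d1 d2 (T1 : measurableType d1) (T2 : measurableType d2) (R : realType).
Context (P : probability T1 R) (Q : probability T2 R) (F : T1 * T2 -> R).
Hypothesis mF : measurable_fun [set: T1 * T2] F.

Let mE : measurable_fun [set: T1 * T2] (EFin \o F).
Proof. exact/measurable_EFinP. Qed.

Lemma measurable_Rintegral : (forall x, integrableR Q (fun y => F (x, y))) ->
  measurable_fun [set: T1] (fun x => \int[Q]_y F (x, y)).
Proof.
have ge0 (G : T1 * T2 -> R) : measurable_fun [set: T1 * T2] G -> (forall z, 0 <= G z) ->
    (forall x, integrableR Q (fun y => G (x, y))) ->
    measurable_fun [set: T1] (fun x => \int[Q]_y G (x, y)).
  move=> mG G0 IG; apply/measurable_EFinP.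
  rewrite (_ : _ \o _ = fun x => (\int[Q]_y (G (x, y))%:E)%E); last first.
    by apply/funext => x; rewrite /= (EFin_Rintegral (IG x)).
  apply: (@measurable_fun_fubini_tonelli_F _ _ _ _ R Q (EFin \o G)).
    exact/measurable_EFinP.
  by move=> z; rewrite lee_fin.
move=> I.
have In x := integrable_norm (I x).
have Ip x := integrableR_add (I x) (In x).
rewrite [X in measurable_fun _ X](_ : _ = fun x =>
  (\int[Q]_y (F (x, y) + `|F (x, y)|)) - (\int[Q]_y `|F (x, y)|)); last first.
  by apply/funext => x; rewrite RintegralD//; [exact/esym/addrK|exact: In].
apply: measurable_funB.
  apply: (ge0 (fun z => F z + `|F z|)) => //.
    by apply: measurable_funD => //; exact: measurableT_comp.
  by move=> z; have := ler_norm (- F z); rewrite normrN; lra.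
apply: (ge0 (fun z => `|F z|)) => //; exact: measurableT_comp.
Qed.

(** The functions integrated here have all their sections integrable, so the
    iterated integrals can be written with real values and need no exceptional set. *)
Lemma Tonelli_integrableR : (forall z, 0 <= F z) ->
  (forall x, integrableR Q (fun y => F (x, y))) ->
  integrableR P (fun x => \int[Q]_y F (x, y)) ->
  integrableR (P \x Q)%E F /\ \int[(P \x Q)%E]_z F z = \int[P]_x \int[Q]_y F (x, y).
Proof.
move=> F0 I1 I2.
have E : (\int[P \x Q]_z (F z)%:E)%E = (\int[P]_x \int[Q]_y F (x, y))%:E.
  rewrite (@fubini_tonelli1 _ _ _ _ R P Q (EFin \o F) mE F0) /fubini_F.
  rewrite -(EFin_Rintegral I2); apply: eq_integral => x _.
  by rewrite -(EFin_Rintegral (I1 x)).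
split; last by rewrite /Rintegral E.
by apply: ge0_integrableR => //; rewrite E ltry.
Qed.

Lemma Fubini1 : integrableR (P \x Q)%E F ->
  (forall x, integrableR Q (fun y => F (x, y))) ->
  integrableR P (fun x => \int[Q]_y F (x, y)) /\
  \int[P]_x \int[Q]_y F (x, y) = \int[(P \x Q)%E]_z F z.
Proof.
move=> I I1.
have E : EFin \o (fun x => \int[Q]_y F (x, y)) = fubini_F Q (EFin \o F).
  by apply/funext => x; rewrite /fubini_F/= -(EFin_Rintegral (I1 x)).
have I2 : integrableR P (fun x => \int[Q]_y F (x, y)).
  by rewrite E; exact: integrable_fubini_F.
split => //; apply: EFin_inj; rewrite -(EFin_Rintegral I2) -(EFin_Rintegral I).
rewrite -integral12_prod_meas1//; apply: eq_integral => x _.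
by rewrite -E.
Qed.

Lemma Fubini2 : integrableR (P \x Q)%E F ->
  (forall y, integrableR P (fun x => F (x, y))) ->
  integrableR Q (fun y => \int[P]_x F (x, y)) /\
  \int[Q]_y \int[P]_x F (x, y) = \int[(P \x Q)%E]_z F z.
Proof.
move=> I I1.
have E : EFin \o (fun y => \int[P]_x F (x, y)) = fubini_G P (EFin \o F).
  by apply/funext => x; rewrite /fubini_G/= -(EFin_Rintegral (I1 x)).
have I2 : integrableR Q (fun y => \int[P]_x F (x, y)).
  have mG : measurable_fun [set: T2] (EFin \o (fun y => \int[P]_x F (x, y))).
    by rewrite E; apply: (@measurable_fubini_G _ _ _ _ R P Q).
  have mnE : measurable_fun [set: T1 * T2] (abse \o (EFin \o F)).
    by apply: measurableT_comp => //; exact: measurable_abse.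
  apply/integrableP; split => //.
  have /integrableP[_] := I.
  rewrite (@fubini_tonelli2 _ _ _ _ R P Q _ mnE (fun z => abse_ge0 _)).
  apply: le_lt_trans; apply: ge0_le_integral => //.
  - exact: measurableT_comp.
  - apply: (@measurable_fun_fubini_tonelli_G _ _ _ _ R P (abse \o (EFin \o F))).
      exact: mnE.
    by move=> z; exact: abse_ge0.
  - move=> y _.
    have Ey : (\int[P]_x F (x, y))%:E = (\int[P]_x (F (x, y))%:E)%E.
      by rewrite -(EFin_Rintegral (I1 y)).
    apply: (@le_trans _ _ `|\int[P]_x (F (x, y))%:E|%E).
      by rewrite -Ey.
    by apply: le_abse_integral => //; exact: measurable_int (I1 y).
split => //; apply: EFin_inj; rewrite -(EFin_Rintegral I2) -(EFin_Rintegral I).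
rewrite -integral21_prod_meas1//; apply: eq_integral => x _.
by rewrite -E.
Qed.

End real_Fubini.

(** * The conditional variance of the kernel sum *)

Lemma integrableR_pow4_add d (T : measurableType d) (R : realType) (P : probability T R)
    (f g : T -> R) : measurable_fun [set: T] f -> measurable_fun [set: T] g ->
  integrableR P (fun x => f x ^+ 4) -> integrableR P (fun x => g x ^+ 4) ->
  integrableR P (fun x => (f x + g x) ^+ 4).
Proof.
move=> mf mg If Ig; apply: (@integrableR_dom _ _ _ _ _ (fun x => 8 * (f x ^+ 4 + g x ^+ 4))).
- by apply: measurable_funX; exact: measurable_funD.
- move=> x; rewrite ger0_norm ?exprn_even_ge0//.
  move: (f x) (g x) => u v.
  have h1 : (u + v) ^+ 2 <= 2 * (u ^+ 2 + v ^+ 2) by have := sqr_ge0 (u - v); lra.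
  have h2 : (u + v) ^+ 4 = ((u + v) ^+ 2) ^+ 2 by rewrite -exprM.
  have h3 : ((u + v) ^+ 2) ^+ 2 <= (2 * (u ^+ 2 + v ^+ 2)) ^+ 2.
    by rewrite lerXn2r// nnegrE ?sqr_ge0// mulr_ge0// addr_ge0 ?sqr_ge0.
  by rewrite h2 (le_trans h3)//; have := sqr_ge0 (u ^+ 2 - v ^+ 2); lra.
- by apply: integrableR_scale; exact: integrableR_add.
Qed.

Section conditional_variance.
Context d (T : measurableType d) (R : realType) (P : probability T R).
Context (h : T -> T -> R).
Hypotheses (mh : measurable_fun [set: T * T] (fun w => h w.1 w.2))
  (hC : forall x y, h x y = h y x)
  (h4 : forall x, integrableR P (fun z => h x z ^+ 4))
  (h0 : forall x, \int[P]_z h x z = 0).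

Definition sqnorm x : R := \int[P]_z (h x z ^+ 2).
Definition pow4norm x : R := \int[P]_z (h x z ^+ 4).
(** The kernel of the square of the integral operator of [h]. *)
Definition gram x y : R := \int[P]_z (h x z * h y z).

Hypothesis I4 : integrableR P pow4norm.

Let m2 := \int[P]_x sqnorm x.
Let m22 := \int[P]_x (sqnorm x ^+ 2).

Lemma measurable_section x : measurable_fun [set: T] (h x).
Proof.
rewrite [X in measurable_fun _ X](_ : _ = (fun w => h w.1 w.2) \o pair x)//.
by apply: measurableT_comp => //; exact: measurable_pair1.
Qed.
Local Notation mhx := measurable_section.

Lemma integrable_section_sqr x : integrableR P (fun z => h x z ^+ 2).
Proof.
apply: integrableR_of_sqr; first by apply: measurable_funX; exact: mhx.
by under eq_fun do rewrite -exprM.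
Qed.
Local Notation h2 := integrable_section_sqr.

Lemma integrable_section x : integrableR P (h x).
Proof. by apply: integrableR_of_sqr; [exact: mhx|exact: h2]. Qed.

Lemma measurable_sqnorm : measurable_fun [set: T] sqnorm.
Proof.
apply: (@measurable_Rintegral _ _ T T R P (fun w => h w.1 w.2 ^+ 2)).
  exact: measurable_funX.
exact: h2.
Qed.

Lemma sqnorm_ge0 x : 0 <= sqnorm x.
Proof. by apply: Rintegral_ge0 => z _; exact: sqr_ge0. Qed.

Lemma integrable_sqnorm_sqr : integrableR P (fun x => sqnorm x ^+ 2).
Proof.
apply: (integrableR_dom _ _ I4); first by apply: measurable_funX; exact: measurable_sqnorm.
move=> x; rewrite ger0_norm ?sqr_ge0//.
by apply: sqr_moment2_le => //; exact: mhx.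
Qed.

Lemma integrable_sqnorm : integrableR P sqnorm.
Proof. exact: integrableR_of_sqr measurable_sqnorm integrable_sqnorm_sqr. Qed.

Lemma integrable_gram x y : integrableR P (fun z => h x z * h y z).
Proof. by apply: integrableR_mul; [exact: mhx|exact: mhx|exact: h2|exact: h2]. Qed.

Lemma measurable_gram : measurable_fun [set: T * T] (fun w => gram w.1 w.2).
Proof.
apply: (@measurable_Rintegral _ _ (T * T)%type T R P
  (fun w => h w.1.1 w.2 * h w.1.2 w.2)); last by move=> w; exact: integrable_gram.
apply: measurable_funM.
  rewrite [X in measurable_fun _ X](_ : _ = (fun w => h w.1 w.2) \o
    (fun w : T * T * T => (w.1.1, w.2)))//.
  apply: measurableT_comp => //; apply: measurable_fun_pair => //.
  exact: measurableT_comp.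
rewrite [X in measurable_fun _ X](_ : _ = (fun w => h w.1 w.2) \o
  (fun w : T * T * T => (w.1.2, w.2)))//.
apply: measurableT_comp => //; apply: measurable_fun_pair => //.
exact: measurableT_comp.
Qed.

Lemma gram_sqr_le x y : gram x y ^+ 2 <= sqnorm x * sqnorm y.
Proof. by apply: Cauchy_Schwarz; [exact: mhx|exact: mhx|exact: h2|exact: h2]. Qed.

Lemma integrable_gram_sqr : integrableR (P \x P)%E (fun w => gram w.1 w.2 ^+ 2).
Proof.
apply: (@integrableR_dom _ _ _ _ _ (fun w => sqnorm w.1 * sqnorm w.2)).
- by apply: measurable_funX; exact: measurable_gram.
- by move=> w; rewrite ger0_norm ?sqr_ge0// gram_sqr_le.
- by apply: integrableR_tensor; exact: integrable_sqnorm.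
Qed.

Let gamma := \int[(P \x P)%E]_w (gram w.1 w.2 ^+ 2).

Lemma integrable_gram_section x : integrableR P (fun y => gram x y ^+ 2).
Proof.
apply: (@integrableR_dom _ _ _ _ _ (fun y => sqnorm x * sqnorm y)).
- apply: measurable_funX.
  rewrite [X in measurable_fun _ X](_ : _ = (fun w => gram w.1 w.2) \o pair x)//.
  by apply: measurableT_comp; [exact: measurable_gram|exact: measurable_pair1].
- by move=> w; rewrite ger0_norm ?sqr_ge0// gram_sqr_le.
- by apply: integrableR_scale; exact: integrable_sqnorm.
Qed.

Lemma gamma_iterated :
  integrableR P (fun x => \int[P]_y (gram x y ^+ 2)) /\
  \int[P]_x \int[P]_y (gram x y ^+ 2) = gamma.
Proof.
apply: (@Fubini1 _ _ T T R P P (fun w => gram w.1 w.2 ^+ 2)).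
- exact: integrable_gram_sqr.
- exact: integrable_gram_section.
Qed.

Lemma integrable_h_sqr : integrableR (P \x P)%E (fun w => h w.1 w.2 ^+ 2).
Proof.
have mh2 : measurable_fun [set: T * T] (fun w => h w.1 w.2 ^+ 2).
  exact: measurable_funX.
have [] // := Tonelli_integrableR (P := P) (Q := P) mh2.
- by move=> w; exact: sqr_ge0.
- exact: h2.
- exact: integrable_sqnorm.
Qed.

(** [gram x] has mean zero, because it averages the sections of [h], which do. *)
Lemma gram_mean0 x : \int[P]_y gram x y = 0.
Proof.
pose F (w : T * T) := h x w.2 * h w.1 w.2.
have mF : measurable_fun [set: T * T] F.
  by apply: measurable_funM => //; apply: measurableT_comp => //; exact: mhx.
have IF : integrableR (P \x P)%E F.
  apply: integrableR_mul => //.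
  - by apply: measurableT_comp => //; exact: mhx.
  - have := @integrableR_tensor _ _ T T R P P (fun=> 1) (fun z => h x z ^+ 2)
      (integrableR_cst _ _) (h2 x).
    by under eq_fun do rewrite mul1r.
  - exact: integrable_h_sqr.
have IF1 y : integrableR P (fun z => F (y, z)) by exact: integrable_gram.
have IF2 z : integrableR P (fun y => F (y, z)).
  rewrite /F/=; apply: integrableR_scale; under eq_fun do rewrite hC.
  exact: integrable_section.
have [_ E1] := Fubini1 IF IF1; have [_ E2] := Fubini2 mF IF IF2.
rewrite [LHS]E1 -E2.
under eq_Rintegral => z _.
  rewrite /F/= RintegralZl//; last by under eq_fun do rewrite hC; exact: integrable_section.
  under eq_Rintegral do rewrite hC.
  rewrite h0 mulr0; over.
exact: Rintegral_prob_cst.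
Qed.

Lemma gram_pow4 x : integrableR P (fun y => gram x y ^+ 4) /\
  \int[P]_y (gram x y ^+ 4) <= sqnorm x ^+ 2 * m22.
Proof.
have mg : measurable_fun [set: T] (gram x).
  rewrite [X in measurable_fun _ X](_ : _ = (fun w => gram w.1 w.2) \o pair x)//.
  by apply: measurableT_comp; [exact: measurable_gram|exact: measurable_pair1].
have I : integrableR P (fun y => sqnorm x ^+ 2 * sqnorm y ^+ 2).
  by apply: integrableR_scale; exact: integrable_sqnorm_sqr.
have le4 y : gram x y ^+ 4 <= sqnorm x ^+ 2 * sqnorm y ^+ 2.
  rewrite -exprMn (_ : 4 = 2 * 2)%N// exprM.
  by rewrite lerXn2r ?nnegrE ?sqr_ge0 ?mulr_ge0 ?sqnorm_ge0 ?gram_sqr_le.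
have Ig : integrableR P (fun y => gram x y ^+ 4).
  apply: (integrableR_dom _ _ I); first exact: measurable_funX.
  by move=> y; rewrite ger0_norm ?exprn_even_ge0.
split => //; rewrite /m22 -RintegralZl//; last exact: integrable_sqnorm_sqr.
exact: le_Rintegral_prob.
Qed.

Lemma sqr_tensor_moment :
  integrableR (P \x P)%E (fun w => \int[P]_z ((h w.1 z * h w.2 z) ^+ 2)) /\
  \int[(P \x P)%E]_w \int[P]_z ((h w.1 z * h w.2 z) ^+ 2) = m22.
Proof.
pose F (w : T * (T * T)) := (h w.2.1 w.1 * h w.2.2 w.1) ^+ 2.
have hz2 z : integrableR P (fun x => h x z ^+ 2).
  by under eq_fun do rewrite hC; exact: h2.
have Iz2 z : \int[P]_x (h x z ^+ 2) = sqnorm z.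
  by apply: eq_Rintegral => x _; rewrite hC.
have mF : measurable_fun [set: T * (T * T)] F.
  apply: measurable_funX; apply: measurable_funM.
    rewrite [X in measurable_fun _ X](_ : _ = (fun w => h w.1 w.2) \o
      (fun w : T * (T * T) => (w.2.1, w.1)))//.
    apply: measurableT_comp => //; apply: measurable_fun_pair => //.
    exact: measurableT_comp.
  rewrite [X in measurable_fun _ X](_ : _ = (fun w => h w.1 w.2) \o
    (fun w : T * (T * T) => (w.2.2, w.1)))//.
  apply: measurableT_comp => //; apply: measurable_fun_pair => //.
  exact: measurableT_comp.
have FE z : (fun w => F (z, w)) = fun w => h w.1 z ^+ 2 * h w.2 z ^+ 2.
  by apply/funext => w; rewrite /F/= exprMn.
have IF1 z : integrableR (P \x P)%E (fun w => F (z, w)).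
  by rewrite FE; exact: (integrableR_tensor (hz2 z) (hz2 z)).
have EF1 z : \int[(P \x P)%E]_w F (z, w) = sqnorm z ^+ 2.
  by rewrite FE (Rintegral_tensor (hz2 z) (hz2 z)) !Iz2 expr2.
pose PP : probability (T * T)%type R := (P \x P)%E.
have [IF EF] : integrableR (P \x PP)%E F /\
    \int[(P \x PP)%E]_z F z = \int[P]_z \int[PP]_w F (z, w).
  apply: Tonelli_integrableR => //; first by move=> w; exact: sqr_ge0.
  by under eq_fun do rewrite EF1; exact: integrable_sqnorm_sqr.
have IF2 w : integrableR P (fun z => F (z, w)).
  rewrite /F/=; under eq_fun do rewrite exprMn.
  apply: integrableR_mul; try (by apply: measurable_funX; exact: mhx);
  by under eq_fun do rewrite -exprM; exact: h4.
have [? E] := Fubini2 mF IF IF2; split => //.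
rewrite [LHS]E EF; under eq_Rintegral do rewrite EF1.
by [].
Qed.

(** The average of the kernel at [x] over a second half-sample [t]; conditionally on
    [t], it is the function of one observation that the statistic studentizes. *)
Definition cmean n x (t : n.-tuple T) : R := n%:R^-1 * tsum (h x) t.
Arguments cmean {n} x t.
Definition cvar n (t : n.-tuple T) : R := \int[P]_x (cmean x t ^+ 2).

Lemma measurable_cmean2 n :
  measurable_fun [set: T * n.-tuple T] (fun w => cmean w.1 w.2).
Proof.
apply: measurable_funM => //; apply: measurable_sum => i.
rewrite [X in measurable_fun _ X](_ : _ = (fun w => h w.1 w.2) \o
  (fun w : T * n.-tuple T => (w.1, tnth w.2 i)))//.
apply: measurableT_comp => //; apply: measurable_fun_pair => //.
rewrite [X in measurable_fun _ X](_ : _ = (@tnth _ T ^~ i) \o snd)//.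
by apply: measurableT_comp => //; exact: measurable_tnth.
Qed.

Lemma measurable_cmean n (t : n.-tuple T) : measurable_fun [set: T] (cmean ^~ t).
Proof.
rewrite [X in measurable_fun _ X](_ : _ = (fun w => cmean w.1 w.2) \o (pair^~ t))//.
by apply: measurableT_comp; [exact: measurable_cmean2|exact: measurable_pair2].
Qed.

Lemma integrable_cmean_pow4 n (t : n.-tuple T) :
  integrableR P (fun x => cmean x t ^+ 4).
Proof.
have mhz z : measurable_fun [set: T] (h ^~ z) by under eq_fun do rewrite hC; exact: mhx.
have hz4 z : integrableR P (fun x => h x z ^+ 4).
  by under eq_fun do rewrite hC; exact: h4.
suff H (s : seq T) : measurable_fun [set: T] (fun x => \sum_(z <- s) h x z) /\
    integrableR P (fun x => (\sum_(z <- s) h x z) ^+ 4).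
  under eq_fun do rewrite /cmean /tsum -(big_tuple _ _ t xpredT (h _)) exprMn.
  by apply: integrableR_scale; have [] := H t.
elim: s => [|z s [ms Is]].
  by under eq_fun do rewrite big_nil; under [in X in _ /\ X]eq_fun do rewrite big_nil;
    split => //; exact: integrableR_cst.
under eq_fun do rewrite big_cons; under [in X in _ /\ X]eq_fun do rewrite big_cons.
by split; [exact: measurable_funD|exact: integrableR_pow4_add].
Qed.

Lemma integrable_cmean_sqr n (t : n.-tuple T) : integrableR P (fun x => cmean x t ^+ 2).
Proof.
apply: integrableR_of_sqr; first by apply: measurable_funX; exact: measurable_cmean.
by under eq_fun do rewrite -exprM; exact: integrable_cmean_pow4.
Qed.

Lemma cmean_sqr_moment n x : (0 < n)%N ->
  integrableR (iid_law P n) (fun t => cmean x t ^+ 2) /\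
  \int[iid_law P n]_t (cmean x t ^+ 2) = n%:R^-1 * sqnorm x.
Proof.
move=> n0; have [I E] := @tsum_cov _ T R P (h x) (h x) n (mhx x) (mhx x) (h2 x) (h2 x)
  (h0 x) (h0 x).
have cE (t : n.-tuple T) : cmean x t ^+ 2 = n%:R ^- 2 * (tsum (h x) t * tsum (h x) t).
  by rewrite /cmean exprMn exprVn -expr2.
under eq_fun do rewrite cE.
split; first exact: integrableR_scale.
rewrite RintegralZl// E (_ : \int[P]_z (h x z * h x z) = sqnorm x).
  by field; rewrite pnatr_eq0 -lt0n.
by apply: eq_Rintegral => z _; rewrite expr2.
Qed.

Lemma cvar_mean n : (0 < n)%N -> integrableR (iid_law P n) (@cvar n) /\
  \int[iid_law P n]_t cvar t = m2 / n%:R.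
Proof.
move=> n0.
have m : measurable_fun [set: T * n.-tuple T] (fun w => cmean w.1 w.2 ^+ 2).
  by apply: measurable_funX; exact: measurable_cmean2.
have I1 x := (cmean_sqr_moment x n0).1; have E1 x := (cmean_sqr_moment x n0).2.
have I2 : integrableR P (fun x => \int[iid_law P n]_t (cmean x t ^+ 2)).
  under eq_fun do rewrite E1.
  by apply: integrableR_scale; exact: integrable_sqnorm.
have [I E] := Tonelli_integrableR m (fun w => sqr_ge0 _) I1 I2.
have [? E'] := Fubini2 m I (fun t => integrable_cmean_sqr t); split => //.
rewrite [LHS]E' E /=; under eq_Rintegral do rewrite E1.
by rewrite RintegralZl ?integrable_sqnorm// mulrC.
Qed.

(** The square of [cvar] is the integral over two independent points [x] and [y] of
    a product of squares; exchanging it with the integral over [t] reduces the second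
    moment to the one of a pair of sums. *)
Lemma cvar_sqr_mean n : (0 < n)%N ->
  integrableR (iid_law P n) (fun t => @cvar n t ^+ 2) /\
  \int[iid_law P n]_t (cvar t ^+ 2) =
    n%:R ^- 4 * (n%:R * m22 + n%:R * (n%:R - 1) * (m2 ^+ 2 + 2 * gamma)).
Proof.
move=> n0.
pose F (w : (T * T) * n.-tuple T) := (cmean w.1.1 w.2 * cmean w.1.2 w.2) ^+ 2.
pose PP : probability (T * T)%type R := (P \x P)%E.
have mF : measurable_fun [set: (T * T) * n.-tuple T] F.
  apply: measurable_funX; apply: measurable_funM.
    rewrite [X in measurable_fun _ X](_ : _ = (fun w => cmean w.1 w.2) \o
      (fun w : (T * T) * n.-tuple T => (w.1.1, w.2)))//.
    apply: measurableT_comp; first exact: measurable_cmean2.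
    by apply: measurable_fun_pair => //; exact: measurableT_comp.
  rewrite [X in measurable_fun _ X](_ : _ = (fun w => cmean w.1 w.2) \o
    (fun w : (T * T) * n.-tuple T => (w.1.2, w.2)))//.
  apply: measurableT_comp; first exact: measurable_cmean2.
  by apply: measurable_fun_pair => //; exact: measurableT_comp.
pose W (w : T * T) := \int[P]_z ((h w.1 z * h w.2 z) ^+ 2).
have [IW EW] := sqr_tensor_moment.
have FE w : (fun t => F (w, t)) = fun t => n%:R ^- 4 * (tsum (h w.1) t * tsum (h w.2) t) ^+ 2.
  by apply/funext => t; rewrite /F /cmean/= -exprVn (_ : 4 = 2 * 2)%N// exprM; ring.
have C w := @tsum_cov_sqr _ T R P (h w.1) (h w.2) n (mhx w.1) (mhx w.2) (h4 w.1) (h4 w.2)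
  (h0 w.1) (h0 w.2).
have I1 (w : T * T) : integrableR (iid_law P n) (fun t => F (w, t)).
  by rewrite FE; apply: integrableR_scale; have [] := C w.
have E1 (w : T * T) : \int[iid_law P n]_t F (w, t) =
    n%:R ^- 4 * (n%:R * W w + n%:R * (n%:R - 1) *
      (sqnorm w.1 * sqnorm w.2 + 2 * gram w.1 w.2 ^+ 2)).
  rewrite FE RintegralZl//; last by have [] := C w.
  by have [_ ->] := C w.
pose l := [:: (n%:R ^- 4 * n%:R : R, W);
  (n%:R ^- 4 * (n%:R * (n%:R - 1)), fun w => sqnorm w.1 * sqnorm w.2);
  (n%:R ^- 4 * (n%:R * (n%:R - 1)) * 2, fun w : T * T => gram w.1 w.2 ^+ 2)].
have [|Il El] := @integrableR_lin _ _ _ PP l.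
  move=> u; rewrite /= !inE => /or3P[]/eqP->.
  - exact: IW.
  - by apply: integrableR_tensor; exact: integrable_sqnorm.
  - exact: integrable_gram_sqr.
have lE : (fun w => \int[iid_law P n]_t F (w, t)) = fun w => \sum_(i <- l) i.1 * i.2 w.
  by apply/funext => w; rewrite E1 !big_cons big_nil/=; ring.
have I2 : integrableR PP (fun w => \int[iid_law P n]_t F (w, t)) by rewrite lE.
have [I E] := Tonelli_integrableR mF (fun w => sqr_ge0 _) I1 I2.
have FE' (t : n.-tuple T) : (fun w => F (w, t)) =
    fun w => cmean w.1 t ^+ 2 * cmean w.2 t ^+ 2.
  by apply/funext => w; rewrite /F/= exprMn.
have I3 (t : n.-tuple T) : integrableR PP (fun w => F (w, t)).
  by rewrite FE'; exact: (integrableR_tensor (integrable_cmean_sqr t) (integrable_cmean_sqr t)).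
have E3 (t : n.-tuple T) : \int[PP]_w F (w, t) = cvar t ^+ 2.
  rewrite FE' (Rintegral_tensor (integrable_cmean_sqr t) (integrable_cmean_sqr t)).
  by rewrite expr2.
have [] := Fubini2 mF I I3.
under eq_fun do rewrite E3.
move=> I4' E4; split => //; rewrite E4 E lE El !big_cons big_nil/=.
have := Rintegral_tensor integrable_sqnorm integrable_sqnorm; rewrite -/m2 => Et.
by rewrite [\int[PP]_x W x]EW [\int[PP]_x (sqnorm x.1 * sqnorm x.2)]Et -/gamma; ring.
Qed.

Lemma cmean_pow4_mean n : (0 < n)%N ->
  integrableR (iid_law P n) (fun t => \int[P]_x (cmean x t ^+ 4)) /\
  \int[iid_law P n]_t \int[P]_x (cmean x t ^+ 4) <=
    n%:R ^- 2 * ((\int[P]_x pow4norm x) / n%:R + 3 * m22).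
Proof.
move=> n0.
have n0' : 0 < n%:R :> R by rewrite ltr0n.
have m : measurable_fun [set: T * n.-tuple T] (fun w => cmean w.1 w.2 ^+ 4).
  by apply: measurable_funX; exact: measurable_cmean2.
have C x := @tsum_cov_sqr _ T R P (h x) (h x) n (mhx x) (mhx x) (h4 x) (h4 x) (h0 x) (h0 x).
have cE x (t : n.-tuple T) : cmean x t ^+ 4 = n%:R ^- 4 * (tsum (h x) t * tsum (h x) t) ^+ 2.
  by rewrite /cmean exprMn exprVn -expr2 -exprM.
have I1 x : integrableR (iid_law P n) (fun t => cmean x t ^+ 4).
  by under eq_fun do rewrite cE; apply: integrableR_scale; have [] := C x.
have E1 x : \int[iid_law P n]_t (cmean x t ^+ 4) =
    n%:R ^- 4 * (n%:R * pow4norm x + 3 * (n%:R * (n%:R - 1)) * sqnorm x ^+ 2).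
  under eq_Rintegral do rewrite cE.
  rewrite RintegralZl//; last by have [] := C x.
  have [_ ->] := C x.
  have -> : \int[P]_z ((h x z * h x z) ^+ 2) = pow4norm x.
    by apply: eq_Rintegral => z _; rewrite -expr2 -exprM.
  have -> : \int[P]_z (h x z * h x z) = sqnorm x.
    by apply: eq_Rintegral => z _; rewrite -expr2.
  by rewrite -/(sqnorm x); ring.
pose l := [:: (n%:R ^- 4 * n%:R : R, pow4norm);
  (n%:R ^- 4 * (3 * (n%:R * (n%:R - 1))), fun x => sqnorm x ^+ 2)].
have [|Il El] := @integrableR_lin _ _ _ P l.
  move=> u; rewrite /= !inE => /orP[]/eqP->//.
  exact: integrable_sqnorm_sqr.
have lE : (fun x => \int[iid_law P n]_t (cmean x t ^+ 4)) =
    fun w => \sum_(i <- l) i.1 * i.2 w.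
  by apply/funext => w; rewrite E1 !big_cons big_nil/=; ring.
have I2 : integrableR P (fun x => \int[iid_law P n]_t (cmean x t ^+ 4)) by rewrite lE.
have F0 (w : T * n.-tuple T) : 0 <= cmean w.1 w.2 ^+ 4 by rewrite exprn_even_ge0.
have [I E] := Tonelli_integrableR m F0 I1 I2.
have [? E'] := Fubini2 m I (fun t => integrable_cmean_pow4 t); split => //.
rewrite E' E /= lE El !big_cons big_nil/= -/m22 addr0.
have m22_ge0 : 0 <= m22 by apply: Rintegral_ge0 => x _; exact: sqr_ge0.
set m4 := \int[P]_x pow4norm x.
rewrite (_ : _ + _ = n%:R ^- 2 * (m4 / n%:R + 3 * ((n%:R - 1) / n%:R) * m22)); last first.
  by field; rewrite gt_eqF.
rewrite ler_pM2l ?invr_gt0 ?exprn_gt0// lerD2l ler_wpM2r//.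
rewrite ler_piMr// ler_pdivrMr// mul1r.
by lra.
Qed.

End conditional_variance.

(** * Anti-concentration of the conditional variance *)

(** The hypotheses on the kernel that hold after it has been modified on a null
    set: they are required of every section and not only of almost every one. *)
Record regular_kernel d (T : measurableType d) (R : realType) (P : probability T R)
    (h : T -> T -> R) : Prop := RegularKernel {
  kernel_meas : measurable_fun [set: T * T] (fun w => h w.1 w.2) ;
  kernel_sym : forall x y, h x y = h y x ;
  kernel_pow4 : forall x, integrableR P (fun z => h x z ^+ 4) ;
  kernel_mean0 : forall x, \int[P]_z h x z = 0 ;
  kernel_pow4norm : integrableR P (pow4norm P h) }.

Section lower_tail.
Context d (T : measurableType d) (R : realType) (P : probability T R).
Context (h : T -> T -> R) (K : regular_kernel P h) (n : nat).
Hypothesis n0 : (0 < n)%N.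

Let mh := kernel_meas K.
Let hC := kernel_sym K.
Let h4 := kernel_pow4 K.
Let h0 := kernel_mean0 K.
Let I4 := kernel_pow4norm K.

Let m2 := \int[P]_x sqnorm P h x.
Let m22 := \int[P]_x (sqnorm P h x ^+ 2).
Let gamma := \int[(P \x P)%E]_w (gram P h w.1 w.2 ^+ 2).
Hypothesis m2_gt0 : 0 < m2.

Let n0' : 0 < n%:R :> R. Proof. by rewrite ltr0n. Qed.

Let mcvar : measurable_fun [set: n.-tuple T] (@cvar _ T R P h n).
Proof. exact: integrableR_meas (cvar_mean mh hC h4 h0 I4 n0).1. Qed.

(** The leading term of the second moment of [cvar] is its squared mean; what is
    left of it gives the two terms on the right. *)
Lemma cvar_chebyshev :
  pr (iid_law P n) [set t | cvar P h t <= 2^-1 * (m2 / n%:R)] <=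
    4 * (m22 / (n%:R * m2 ^+ 2)) + 8 * (gamma / m2 ^+ 2).
Proof.
have [I1 E1] := cvar_mean mh hC h4 h0 I4 n0.
have [I2 E2] := cvar_sqr_mean mh hC h4 h0 I4 n0.
pose v := m2 / n%:R; have v0 : 0 < v by rewrite divr_gt0.
pose l := [:: (1, fun t => @cvar _ T R P h n t ^+ 2); (- (2 * v), @cvar _ T R P h n);
  (v ^+ 2, fun=> 1)].
have [|Il El] := @integrableR_lin _ _ _ (iid_law P n) l.
  by move=> u; rewrite /= !inE => /or3P[]/eqP->//; exact: integrableR_cst.
have lE : (fun t => (@cvar _ T R P h n t - v) ^+ 2) = fun t => \sum_(i <- l) i.1 * i.2 t.
  by apply/funext => t; rewrite !big_cons big_nil/=; ring.
rewrite -lE in Il El.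
apply: le_trans (@markov_pr _ _ _ _ _ (fun t => (cvar P h t - v) ^+ 2) ((v / 2) ^+ 2)
  (measurable_RV_le mcvar _) _ Il _ _) _.
- by rewrite exprn_gt0// divr_gt0.
- by move=> t; exact: sqr_ge0.
- move=> t /=; rewrite -/v => h'.
  by rewrite -(sqrrN (_ - _)) lerXn2r ?nnegrE//; lra.
rewrite El !big_cons big_nil/= E1 E2 Rintegral_prob_cst -/m2 -/m22 -/gamma.
have m22_ge0 : 0 <= m22 by apply: Rintegral_ge0 => x _; exact: sqr_ge0.
have g0 : 0 <= gamma by apply: Rintegral_ge0 => x _; exact: sqr_ge0.
rewrite -subr_ge0.
rewrite [X in 0 <= X](_ : _ = n%:R^-1 * (4 + 8 * (gamma / m2 ^+ 2))); last first.
  by rewrite /v; field; rewrite !gt_eqF.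
have : 0 <= gamma / m2 ^+ 2 by rewrite divr_ge0 ?sqr_ge0.
by move=> ?; apply: mulr_ge0; [rewrite invr_ge0 ltW|lra].
Qed.

(** If the squared Hilbert-Schmidt norm [gamma] of the integral operator of [gram] is a
    fixed fraction of the squared trace [m2 ^+ 2], averaging the Rayleigh quotients
    of the sections of [h] shows that one of them is a direction that carries this
    fraction of the trace. *)
Lemma exists_direction (delta : R) : delta * m2 ^+ 2 < gamma ->
  exists x, delta * m2 * sqnorm P h x < \int[P]_y (gram P h x y ^+ 2).
Proof.
move=> dg; apply: contrapT => /forallNP H.
have [I E] := gamma_iterated mh h4 I4.
have Is := integrable_sqnorm mh h4 I4.
suff : gamma <= delta * m2 ^+ 2 by rewrite leNgt dg.
rewrite /gamma -[leLHS]E expr2 mulrA -RintegralZl//.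
apply: le_Rintegral_prob => //; first exact: integrableR_scale.
by move=> x; rewrite leNgt; apply/negP; exact: H.
Qed.

(** Projecting [cmean h ^~ t] onto the direction [h x] can only lose variance. *)
Lemma cvar_direction x (t : n.-tuple T) :
  (n%:R^-1 * tsum (gram P h x) t) ^+ 2 <= cvar P h t * sqnorm P h x.
Proof.
have mx := measurable_section mh x.
have mc := measurable_cmean mh t.
have := Cauchy_Schwarz mc mx (integrable_cmean_sqr mh hC h4 t) (integrable_section_sqr mh h4 x).
congr (_ ^+ 2 <= _).
rewrite /tsum (eq_bigr (fun i => \int[P]_z (h x z * h (tnth t i) z)))//.
have Ii (i : 'I_n) := integrable_gram mh h4 x (tnth t i).
pose l := [seq (n%:R^-1 : R, fun z => h x z * h (tnth t i) z) | i <- index_enum 'I_n].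
have [|_ El] := @integrableR_lin _ _ _ P l.
  by move=> u; rewrite -map_comp => /mapP[i _ ->] /=; exact: Ii.
rewrite mulr_sumr.
transitivity (\sum_(i <- l) i.1 * \int[P]_z i.2 z); last by rewrite big_map.
rewrite -El; apply: eq_Rintegral => z _.
rewrite big_map /cmean /tsum -mulrA mulr_suml mulr_sumr; apply: eq_bigr => i _ /=.
by rewrite (hC z) (mulrC (h x z)).
Qed.

End lower_tail.

(** The conditional variance given the second half of the sample is unlikely to
    be much smaller than its mean, whatever the spectrum of the kernel.  Either the
    spectrum is spread out, and the conditional variance concentrates; or some
    direction carries a fixed fraction of it, and the projection onto that direction
    is asymptotically Gaussian, hence rarely small. *)
Lemma cvar_anticoncentration (R : realType) (eps : R) : 0 < eps ->
  exists2 e : R, 0 < e & exists2 eta : R, 0 < eta &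
  forall d (T : measurableType d) (P : probability T R) (h : T -> T -> R) n,
  regular_kernel P h -> (0 < n)%N -> 0 < \int[P]_x sqnorm P h x ->
  \int[P]_x (sqnorm P h x ^+ 2) <= eta * n%:R * (\int[P]_x sqnorm P h x) ^+ 2 ->
  pr (iid_law P n) [set t | cvar P h t <= e * ((\int[P]_x sqnorm P h x) / n%:R)] <= eps.
Proof.
move=> eps0.
(* [delta] separates the two cases; [r] is the size, in standard deviations, below
   which the Gaussian projection counts as small *)
pose delta := eps / 16; pose r := eps / 12.
have d0 : 0 < delta by rewrite divr_gt0.
have r0 : 0 < r by rewrite divr_gt0.
have [eta1 eta10 CLT] := @clt R (eps / 4) ltac:(by rewrite divr_gt0).
exists (Num.min 2^-1 (delta * r ^+ 2)).
  by rewrite lt_min invr_gt0 ltr0n mulr_gt0// exprn_gt0.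
exists (Num.min (eps / 8) (eta1 * delta ^+ 2)).
  by rewrite lt_min divr_gt0// mulr_gt0// exprn_gt0.
move=> d T P h n K n0 m20 H.
have [mh hC h4 h0 I4] := K.
set m2 := \int[P]_x sqnorm P h x in m20 H *.
set m22 := \int[P]_x (sqnorm P h x ^+ 2) in H *.
set e := Num.min 2^-1 _.
have n0' : 0 < n%:R :> R by rewrite ltr0n.
have v0 : 0 < m2 / n%:R by rewrite divr_gt0.
have mcvar : measurable_fun [set: n.-tuple T] (@cvar _ T R P h n).
  exact: integrableR_meas (cvar_mean mh hC h4 h0 I4 n0).1.
have weak eta' : Num.min (eps / 8) (eta1 * delta ^+ 2) <= eta' ->
    m22 <= eta' * n%:R * m2 ^+ 2.
  move=> h'; apply: le_trans H _.
  apply: ler_wpM2r; first exact: sqr_ge0.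
  by apply: ler_wpM2r; first exact: ler0n.
have w1 : m22 <= eps / 8 * n%:R * m2 ^+ 2 by apply: weak; rewrite ge_min lexx.
have w2 : m22 <= eta1 * delta ^+ 2 * n%:R * m2 ^+ 2.
  by apply: weak; rewrite ge_min lexx orbT.
have nm0 : 0 < n%:R * m2 ^+ 2 by rewrite mulr_gt0// exprn_gt0.
set gamma := \int[(P \x P)%E]_w (gram P h w.1 w.2 ^+ 2).
have [gd|gd] := leP gamma (delta * m2 ^+ 2).
  have := cvar_chebyshev K n0 m20; rewrite -/m2 -/m22 -/gamma => C.
  have b1 : m22 / (n%:R * m2 ^+ 2) <= eps / 8 by rewrite ler_pdivrMr// mulrA.
  have b2 : gamma / m2 ^+ 2 <= eps / 16 by rewrite ler_pdivrMr// exprn_gt0.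
  have : pr (iid_law P n) [set t | cvar P h t <= e * (m2 / n%:R)] <=
      pr (iid_law P n) [set t | cvar P h t <= 2^-1 * (m2 / n%:R)].
    apply: le_pr; try exact: measurable_RV_le.
    move=> t /= /le_trans; apply; rewrite ler_pM2r// ge_min lexx//.
  by lra.
have [x hx] := exists_direction K gd.
set Vc := \int[P]_y (gram P h x y ^+ 2) in hx.
have a0 : 0 <= sqnorm P h x := sqnorm_ge0 _ _ _.
have [Ic4 c4] := gram_pow4 mh h4 I4 x.
have mg : measurable_fun [set: T] (gram P h x).
  rewrite [X in measurable_fun _ X](_ : _ = (fun w => gram P h w.1 w.2) \o pair x)//.
  apply: measurableT_comp; last exact: measurable_pair1.
  exact: measurable_gram.
have Vc0 : 0 < Vc by apply: le_lt_trans hx; rewrite !mulr_ge0// ltW.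
have Vc2 : \int[P]_y (gram P h x y ^+ 4) <= eta1 * n%:R * Vc ^+ 2.
  apply: (le_trans c4); rewrite -/m22.
  apply: (@le_trans _ _ (eta1 * n%:R * (delta * m2 * sqnorm P h x) ^+ 2)); last first.
    apply: ler_wpM2l; first by rewrite mulr_ge0// ltW.
    by rewrite lerXn2r ?nnegrE ?(ltW hx)// ?(ltW Vc0)// !mulr_ge0// ltW.
  rewrite [leRHS](_ : _ = sqnorm P h x ^+ 2 * (eta1 * delta ^+ 2 * n%:R * m2 ^+ 2)).
    by rewrite ler_wpM2l// sqr_ge0.
  by ring.
have {}CLT := CLT d T P (gram P h x) n n0 mg Ic4 (gram_mean0 mh hC h4 h0 I4 x) Vc0 Vc2.
rewrite -/Vc in CLT.
set s := Num.sqrt (n%:R * Vc) in CLT.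
have s0 : 0 < s by rewrite sqrtr_gt0 mulr_gt0.
have s2 : s ^+ 2 = n%:R * Vc := sqr_sqrtr (ltW (mulr_gt0 n0' Vc0)).
have mts := measurable_tsum (n := n) mg.
have mS b := measurable_RV_le mts b.
(* on the event, the projection [tsum] is at most [r] standard deviations *)
have small (t : n.-tuple T) : cvar P h t <= e * (m2 / n%:R) ->
    `|tsum (gram P h x) t| <= r * s.
  move=> ht; have rs0 : 0 <= r * s := ltW (mulr_gt0 r0 s0).
  rewrite -ler_sqr ?nnegrE//.
  rewrite real_normK ?num_real// exprMn s2.
  have h1 := cvar_direction K x t.
  have h2 : cvar P h t * sqnorm P h x <= r ^+ 2 * Vc / n%:R.
    apply: (@le_trans _ _ (delta * r ^+ 2 * (m2 / n%:R) * sqnorm P h x)).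
      apply: ler_wpM2r => //; apply: (le_trans ht).
      by apply: ler_wpM2r; [exact: ltW|rewrite ge_min lexx orbT].
    rewrite [leLHS](_ : _ = r ^+ 2 * (delta * m2 * sqnorm P h x) / n%:R); last by ring.
    apply: ler_wpM2r; first by rewrite invr_ge0; exact: ltW.
    by apply: ler_wpM2l; [exact: sqr_ge0|exact: ltW].
  have := le_trans h1 h2; rewrite exprMn exprVn -ler_pdivlMl ?invr_gt0 ?exprn_gt0//.
  rewrite invrK => /le_trans; apply.
  by rewrite le_eqVlt; apply/orP; left; apply/eqP; field; rewrite gt_eqF.
have mE := measurable_RV_le mcvar (e * (m2 / n%:R)).
have split3 : pr (iid_law P n) [set t | cvar P h t <= e * (m2 / n%:R)] +
    pr (iid_law P n) [set t | tsum (gram P h x) t <= (- (2 * r)) * s] <=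
    pr (iid_law P n) [set t | tsum (gram P h x) t <= r * s].
  rewrite -lee_fin EFinD !EFin_pr// -measureU//; last first.
    apply/eqP/negPn/negP => /set0P[u [/= /small t1 t2]].
    move: t1; rewrite ler_norml => /andP[t1 _].
    by have rs : 0 < r * s := mulr_gt0 r0 s0; lra.
  apply: le_measure; rewrite ?inE//; first exact: measurableU.
  by move=> t /= [/small|t2]; [rewrite ler_norml => /andP[]|
    have rs : 0 < r * s := mulr_gt0 r0 s0; lra].
have c1 := CLT r; have c2 := CLT (- (2 * r)).
move: c1 c2; rewrite !ler_norml => /andP[_ c1] /andP[c2 _].
have := @Phi_lipschitz R (- (2 * r)) r ltac:(lra).
have -> : r - (- (2 * r)) = eps / 4 by rewrite /r; field.
by lra.
Qed.

(** * The split statistic for a regular kernel *)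

Section fibers.
Context d (T : measurableType d) (R : realType) (P : probability T R).
Context (m k : nat) (A : set ((m + k).-tuple T)).
Hypothesis mA : measurable A.

Let fiber (t : k.-tuple T) : set (m.-tuple T) := [set s | A (cat_tuple s t)].

Let mind : measurable_fun [set: m.-tuple T * k.-tuple T]
  (fun w => \1_A (cat_tuple w.1 w.2) : R).
Proof.
apply: (@measurableT_comp _ _ _ _ _ _ (\1_A : (m + k).-tuple T -> R) _
  (fun w => cat_tuple w.1 w.2)); first exact: measurable_indic.
exact: measurable_cat_tuple.
Qed.

Lemma measurable_fiber t : measurable (fiber t).
Proof.
have -> : fiber t = (fun s => cat_tuple s t) @^-1` A by [].
rewrite -[X in measurable X]setTI.
suff : measurable_fun [set: m.-tuple T] (fun s => cat_tuple s t) by apply.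
rewrite [X in measurable_fun _ X](_ : _ =
  (fun w => cat_tuple w.1 w.2) \o (pair^~ t))//.
by apply: measurableT_comp; [exact: measurable_cat_tuple|exact: measurable_pair2].
Qed.

(** Conditioning on the last [k] coordinates: outside [B] the conditional
    probability is within [e1] of [c], and inside both are at most one. *)
Lemma pr_iid_fiber (B : set (k.-tuple T)) (c e1 e2 : R) : measurable B ->
  (forall t, ~ B t -> `|pr (iid_law P m) (fiber t) - c| <= e1) ->
  0 <= c <= 1 -> 0 <= e1 -> pr (iid_law P k) B <= e2 ->
  `|pr (iid_law P (m + k)) A - c| <= e1 + e2.
Proof.
move=> mB H c01 e10 HB.
pose p t := pr (iid_law P m) (fiber t).
have pE t : (p t)%:E = (\int[iid_law P m]_s (\1_A (cat_tuple s t))%:E)%E.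
  rewrite EFin_pr; last exact: measurable_fiber.
  by rewrite -[in LHS](setIT (fiber t)) -integral_indic//; exact: measurable_fiber.
have mp : measurable_fun [set: k.-tuple T] p.
  apply/measurable_EFinP; rewrite (_ : _ \o _ =
    fun t => (\int[iid_law P m]_s (\1_A (cat_tuple s t))%:E)%E); last first.
    by apply/funext => t; rewrite /= pE.
  apply: (@measurable_fun_fubini_tonelli_G _ _ _ _ R (iid_law P m)
    (fun w => (\1_A (cat_tuple w.1 w.2))%:E)); first exact/measurable_EFinP.
  by move=> w; rewrite lee_fin.
have p01 t : 0 <= p t <= 1.
  by rewrite pr_ge0 pr_le1//; exact: measurable_fiber.
have Ip : integrableR (iid_law P k) p.
  apply: (@integrableR_bounded _ _ _ _ _ 1) => // t.
  by have /andP[? ?] := p01 t; rewrite ger0_norm.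
have Ec := Rintegral_prob_cst (iid_law P k).
have -> : pr (iid_law P (m + k)) A = \int[iid_law P k]_t p t.
  apply: EFin_inj; rewrite EFin_pr// -(EFin_Rintegral Ip).
  rewrite -[in LHS](setIT A) -integral_indic// ge0_integral_iidD.
  - by apply: eq_integral => t _; rewrite pE.
  - exact/measurable_EFinP/measurable_indic.
  - by move=> t; rewrite lee_fin.
rewrite -(Ec c) -RintegralB//; last exact: integrableR_cst.
have Id := integrableR_sub Ip (integrableR_cst _ c).
apply: le_trans (le_normr_Rintegral measurableT Id) _.
apply: (@le_trans _ _ (\int[iid_law P k]_t (e1 + \1_B t))).
  apply: le_Rintegral_prob; first exact: integrable_norm Id.
    by apply: integrableR_add; [exact: integrableR_cst|exact: integrableR_indic].
  move=> t; rewrite indicE; have [_|tB] := boolP (_ \in _).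
    have /andP[? ?] := p01 t; have /andP[? ?] := c01.
    by rewrite ler_norml; apply/andP; split; rewrite /=; lra.
  by rewrite addr0; apply: H; move: tB; rewrite notin_setE.
rewrite RintegralD//; [|exact: integrableR_cst|exact: integrableR_indic].
by rewrite Ec Rintegral_indic// lerD2l.
Qed.

End fibers.

Section split_statistic.
Context d (T : measurableType d) (R : realType) (h : T -> T -> R).

(** The benefit of splitting the sample: with the second half fixed, the kernel
    averages become one function evaluated at independent points. *)
Lemma T_stat_cat m k (s : m.-tuple T) (t : k.-tuple T) : (m + k)./2 = m ->
  T_stat h (cat_tuple s t) = tstat (fun x => cmean h x t) s.
Proof.
move=> mk.
have fE x : f_stat h (cat_tuple s t) x = cmean h x t.
  rewrite /f_stat mk addKn /cmean /tsum; congr (_ * _).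
  rewrite big_split_ord/= big_pred0 ?add0r; last first.
    by move=> i; rewrite leqNgt ltn_ord.
  apply: eq_big => [i|i _]; first by rewrite leq_addr.
  by rewrite tnth_rshift.
have sumE (F : T -> R) : \sum_(i < m + k | (i < m)%N) F (tnth (cat_tuple s t) i) =
    \sum_(i < m) F (tnth s i).
  rewrite big_split_ord/= [X in _ + X]big_pred0 ?addr0; last first.
    by move=> i; rewrite ltnNge leq_addr.
  apply: eq_big => [i|i _]; first by rewrite ltn_ord.
  by rewrite tnth_lshift.
have bE : fbar_stat h (cat_tuple s t) = m%:R^-1 * \sum_(i < m) cmean h (tnth s i) t.
  rewrite /fbar_stat mk; congr (_ * _).
  rewrite (sumE (f_stat h (cat_tuple s t))).
  by apply: eq_bigr => i _; rewrite fE.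
rewrite /T_stat mk /tstat bE; congr (_ / Num.sqrt (_ * _)).
rewrite (sumE (fun x => (f_stat h (cat_tuple s t) x -
  m%:R^-1 * \sum_(i < m) cmean h (tnth s i) t) ^+ 2)).
by apply: eq_bigr => i _; rewrite fE.
Qed.

Hypothesis mh : measurable_fun [set: T * T] (fun w => h w.1 w.2).

Lemma measurable_T_stat n : measurable_fun [set: n.-tuple T] (fun X => T_stat h X).
Proof.
have mij (i j : 'I_n) : measurable_fun [set: n.-tuple T]
    (fun X => h (tnth X i) (tnth X j)).
  rewrite [X in measurable_fun _ X](_ : _ = (fun w => h w.1 w.2) \o
    (fun X : n.-tuple T => (tnth X i, tnth X j)))//.
  by apply: measurableT_comp => //; apply: measurable_fun_pair; exact: measurable_tnth.
have msum (Q : pred 'I_n) (F : 'I_n -> n.-tuple T -> R) :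
    (forall i, measurable_fun [set: n.-tuple T] (F i)) ->
    measurable_fun [set: n.-tuple T] (fun X => \sum_(i < n | Q i) F i X).
  move=> mF; under eq_fun do rewrite big_mkcond.
  by apply: measurable_sum => i; case: (Q i) => //; exact: measurable_cst.
have mf (i : 'I_n) : measurable_fun [set: n.-tuple T] (fun X => f_stat h X (tnth X i)).
  by apply: measurable_funM => //; apply: msum => j; exact: mij.
have mb : measurable_fun [set: n.-tuple T] (fun X => fbar_stat h X).
  by apply: measurable_funM => //; apply: msum.
pose D (X : n.-tuple T) := n./2%:R^-1 *
  \sum_(i < n | (i < n./2)%N) (f_stat h X (tnth X i) - fbar_stat h X) ^+ 2.
have mD : measurable_fun [set: n.-tuple T] D.
  apply: measurable_funM => //; apply: msum => i.
  by apply: measurable_funX; exact: measurable_funB.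
rewrite [X in measurable_fun _ X](_ : _ = fun X =>
  Num.sqrt n./2%:R * fbar_stat h X * (GRing.inv \o (Num.sqrt \o D)) X)//.
apply: measurable_funM; first exact: measurable_funM.
apply: measurableT_comp; first exact: measurable_invr.
by apply: measurableT_comp; first exact: measurable_sqrtr.
Qed.

End split_statistic.

Lemma cmean_mean0 d (T : measurableType d) (R : realType) (P : probability T R)
    (h : T -> T -> R) k (t : k.-tuple T) :
  (forall x y, h x y = h y x) -> (forall x, integrableR P (h x)) ->
  (forall x, \int[P]_z h x z = 0) -> \int[P]_x cmean h x t = 0.
Proof.
move=> hC h1 h0.
pose l := [seq (k%:R^-1 : R, fun x => h x (tnth t i)) | i <- index_enum 'I_k].
have hE i : (fun x => h x (tnth t i)) = h (tnth t i) by apply/funext => x.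
have [|_ El] := @integrableR_lin _ _ _ P l.
  by move=> u; rewrite -map_comp => /mapP[i _ ->] /=; rewrite hE.
rewrite (_ : (fun x => cmean h x t) = fun x => \sum_(i <- l) i.1 * i.2 x); last first.
  by apply/funext => x; rewrite big_map /cmean /tsum mulr_sumr.
rewrite El big_map big1// => i _ /=; rewrite hE h0 mulr0//.
Qed.

(** Conditionally on the second half of the sample, the statistic is studentized;
    outside an event of small probability, the fourth moment of the summands is
    small compared to the squared conditional variance. *)
Lemma regular_T_stat_clt (R : realType) (eps : R) : 0 < eps -> exists2 eta : R, 0 < eta &
  forall d (T : measurableType d) (P : probability T R) (h : T -> T -> R) m k,
  regular_kernel P h -> (0 < m)%N -> (0 < k <= 2 * m)%N -> (m + k)./2 = m ->
  0 < \int[P]_x sqnorm P h x ->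
  (\int[P]_x pow4norm P h x) / k%:R + \int[P]_x (sqnorm P h x ^+ 2) <=
    eta * k%:R * (\int[P]_x sqnorm P h x) ^+ 2 ->
  forall z, `|pr (iid_law P (m + k)) [set X | T_stat h X <= z] - Phi z| <= eps.
Proof.
move=> eps0; have eps3 : 0 < eps / 3 by rewrite divr_gt0.
have [eta1 eta10 SCLT] := studentized_clt eps3.
have [e e0 [eta2 eta20 ANTI]] := cvar_anticoncentration eps3.
(* Markov's inequality at the threshold [thr] below costs a factor [6]: three for the
   fourth moment and two for [k <= 2 * m] *)
pose eta3 := eta1 * e ^+ 2 * (eps / 3) / 6.
have eta30 : 0 < eta3 by rewrite divr_gt0// !mulr_gt0// exprn_gt0.
exists (Num.min eta2 eta3); first by rewrite lt_min eta20.
move=> d T P h m k K m0 /andP[k0 k2m] mk m20 H z.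
have [mh hC h4 h0 I4] := K.
set m2 := \int[P]_x sqnorm P h x in m20 H.
set m22 := \int[P]_x (sqnorm P h x ^+ 2) in H.
set m4 := \int[P]_x pow4norm P h x in H.
have m0' : 0 < m%:R :> R by rewrite ltr0n.
have k0' : 0 < k%:R :> R by rewrite ltr0n.
have m4_ge0 : 0 <= m4.
  by apply: Rintegral_ge0 => x _; apply: Rintegral_ge0 => y _; rewrite exprn_even_ge0.
have m22_ge0 : 0 <= m22 by apply: Rintegral_ge0 => x _; exact: sqr_ge0.
have m4k : 0 <= m4 / k%:R by rewrite divr_ge0// ltW.
have weak eta' : Num.min eta2 eta3 <= eta' -> m4 / k%:R + m22 <= eta' * k%:R * m2 ^+ 2.
  move=> h'; apply: le_trans H _.
  apply: ler_wpM2r; first exact: sqr_ge0.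
  by apply: ler_wpM2r; first exact: ler0n.
have w2 : m22 <= eta2 * k%:R * m2 ^+ 2.
  by have := weak eta2; rewrite ge_min lexx => /(_ isT); lra.
have w3 : m4 / k%:R + 3 * m22 <= 3 * (eta3 * k%:R * m2 ^+ 2).
  by have := weak eta3; rewrite ge_min lexx orbT => /(_ isT); lra.
have {}ANTI := ANTI d T P h k K k0 m20 w2; rewrite -/m2 in ANTI.
have [IM EM] := cmean_pow4_mean mh hC h4 h0 I4 k0.
pose M (t : k.-tuple T) := \int[P]_x (cmean h x t ^+ 4).
pose thr := eta1 * m%:R * (e * (m2 / k%:R)) ^+ 2.
have thr0 : 0 < thr.
  apply: mulr_gt0; first exact: mulr_gt0.
  exact: exprn_gt0 (mulr_gt0 e0 (divr_gt0 m20 k0')).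
have mM : measurable_fun [set: k.-tuple T] M by exact: integrableR_meas IM.
pose B1 : set (k.-tuple T) := [set t | cvar P h t <= e * (m2 / k%:R)].
pose B2 : set (k.-tuple T) := [set t | thr <= M t].
have mB1 : measurable B1.
  by apply: measurable_RV_le; exact: integrableR_meas (cvar_mean mh hC h4 h0 I4 k0).1.
have mB2 : measurable B2.
  by rewrite -[X in measurable X]setTI; exact: measurable_fun_le.
have HB2 : pr (iid_law P k) B2 <= eps / 3.
  have M0 t : 0 <= M t by apply: Rintegral_ge0 => x _; rewrite exprn_even_ge0.
  apply: le_trans (markov_pr mB2 thr0 IM M0 (fun t => id)) _.
  rewrite ler_pdivrMr//; apply: (le_trans EM); rewrite -/m4 -/m22.
  apply: (@le_trans _ _ (k%:R ^- 2 * (3 * (eta3 * k%:R * m2 ^+ 2)))).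
    by rewrite ler_pM2l// invr_gt0 exprn_gt0.
  rewrite [leLHS](_ : _ = (eps / 3 * eta1 * e ^+ 2 * (m2 / k%:R) ^+ 2) * (k%:R / 2)); last first.
    by rewrite /eta3; field; rewrite gt_eqF.
  rewrite [leRHS](_ : _ = (eps / 3 * eta1 * e ^+ 2 * (m2 / k%:R) ^+ 2) * m%:R); last first.
    by rewrite /thr; ring.
  apply: ler_wpM2l.
    apply: mulr_ge0; last exact: sqr_ge0.
    apply: mulr_ge0; last exact: sqr_ge0.
    exact: mulr_ge0 (ltW eps3) (ltW eta10).
  by rewrite ler_pdivrMr// -natrM ler_nat mulnC.
have HB : pr (iid_law P k) (B1 `|` B2) <= eps / 3 + eps / 3.
  by apply: le_trans (pr_setU _ mB1 mB2) _; exact: lerD.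
rewrite (_ : eps = eps / 3 + (eps / 3 + eps / 3)); last by field.
apply: (@pr_iid_fiber _ _ _ _ _ _ _ _ (B1 `|` B2)) => //; first 1 last.
- exact: measurableU.
- move=> t /not_orP[/negP + /negP].
  rewrite -!ltNge => t1 t2.
  have V0 : 0 < cvar P h t := lt_trans (mulr_gt0 e0 (divr_gt0 m20 k0')) t1.
  have -> : [set s : m.-tuple T | [set X | T_stat h X <= z] (cat_tuple s t)] =
      [set s | tstat (fun x => cmean h x t) s <= z].
    by apply/seteqP; split => s /=; rewrite T_stat_cat.
  apply: SCLT => //.
  + exact: measurable_cmean.
  + exact: integrable_cmean_pow4.
  + by apply: cmean_mean0 => // x; exact: integrable_section mh h4 x.
  + apply: (@le_trans _ _ thr); first exact: ltW.
    apply: ler_wpM2l; first by rewrite mulr_ge0// ltW.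
    have v0 : 0 <= e * (m2 / k%:R) := ltW (mulr_gt0 e0 (divr_gt0 m20 k0')).
    by rewrite lerXn2r ?nnegrE ?v0 ?(ltW V0) ?(ltW t1).
- by rewrite Phi_ge0 Phi_le1.
- exact: ltW.
- by apply: measurable_RV_le; exact: measurable_T_stat.
Qed.

(** * Reduction to regular kernels *)

Section regularisation.
Context d (T : measurableType d) (R : realType) (P : probability T R).
Context (h : T -> T -> R).
Hypotheses (mh : measurable_fun [set: T * T] (fun w => h w.1 w.2))
  (hC : forall x y, h x y = h y x).

(** Erasing in both variables keeps the kernel symmetric. *)
Definition erase (B : set T) x y : R := h x y * (\1_(~` B) x * \1_(~` B) y).

Lemma eraseE (B : set T) x y : ~ B x -> ~ B y -> erase B x y = h x y.
Proof.
by move=> Bx By; rewrite /erase !indicE !mem_set// !mulr1.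
Qed.

Lemma erase0 (B : set T) x y : B x -> erase B x y = 0.
Proof. by move=> Bx; rewrite /erase !indicE memNset ?mul0r ?mulr0//=; apply. Qed.

Lemma eraseC B x y : erase B x y = erase B y x.
Proof. by rewrite /erase hC (mulrC (\1_ _ _)). Qed.

Lemma erase_le B x y k : ~~ odd k -> erase B x y ^+ k <= h x y ^+ k.
Proof.
move=> k2; have [Bx|Bx] := pselect (B x); last first.
  have [By|By] := pselect (B y); last by rewrite eraseE.
  rewrite eraseC erase0//; case: k k2 => [|k] k2; first by rewrite !expr0.
  by rewrite expr0n/= exprn_even_ge0.
rewrite erase0//; case: k k2 => [|k] k2; first by rewrite !expr0.
by rewrite expr0n/= exprn_even_ge0.
Qed.

Lemma measurable_erase B : measurable B ->
  measurable_fun [set: T * T] (fun w => erase B w.1 w.2).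
Proof.
move=> mB; have mI : measurable_fun [set: T] (\1_(~` B) : T -> R).
  exact/measurable_indic/measurableC.
by apply: measurable_funM => //; apply: measurable_funM; apply: measurableT_comp.
Qed.

Lemma ae_prod_erase B : measurable B -> P B = 0%E ->
  {ae (P \x P)%E, forall w, erase B w.1 w.2 = h w.1 w.2}.
Proof.
move=> mB PB; exists ((B `*` setT) `|` (setT `*` B)); split.
- by apply: measurableU; exact: measurableX.
- have z1 : (P \x P)%E (B `*` setT) = 0%E.
    by apply: etrans (product_measure1E _ _ mB measurableT) _; rewrite [X in (X * _)%E]PB mul0e.
  have z2 : (P \x P)%E (setT `*` B) = 0%E.
    by apply: etrans (product_measure1E _ _ measurableT mB) _; rewrite [X in (_ * X)%E]PB mule0.
  apply/eqP; rewrite eq_le measure_ge0 andbT.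
  rewrite (le_trans (measureU2 _ (measurableX mB measurableT) (measurableX measurableT mB)))//.
  by rewrite [X in (X + _)%E]z1 [X in (_ + X)%E]z2 adde0.
- move=> w /= H; apply: contrapT => /not_orP[w1 w2]; apply: H.
  by apply: eraseE => ?; [apply: w1|apply: w2].
Qed.

Hypotheses (h0 : {ae P, forall y, ('E_P[fun x => h x y] = 0)%E})
  (h4 : (moment4 P h < +oo)%E).

Lemma bad_sections : exists B : set T, [/\ measurable B, P B = 0%E &
  forall y, ~ B y -> integrableR P (fun x => h y x ^+ 4) /\ \int[P]_x h y x = 0].
Proof.
have mh4 : measurable_fun [set: T * T] (fun w => (h w.1 w.2 ^+ 4)%:E).
  by apply/measurable_EFinP; exact: measurable_funX.
have ge4 (w : T * T) : (0 <= (h w.1 w.2 ^+ 4)%:E)%E by rewrite lee_fin exprn_even_ge0.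
have If : P.-integrable [set: T] (fun y => \int[P]_x (h y x ^+ 4)%:E)%E.
  apply/integrableP; split.
    by apply: (@measurable_fun_fubini_tonelli_F _ _ _ _ R P (fun w => (h w.1 w.2 ^+ 4)%:E)).
  under eq_integral => y _.
    rewrite gee0_abs; last by apply: integral_ge0 => x _; exact: (ge4 (y, x)).
    over.
  by have := h4; rewrite /moment4 (fubini_tonelli1 _ mh4 ge4).
have [B1 [mB1 PB1 H1]] := integrable_ae measurableT If.
have [B2 [mB2 PB2 H2]] := h0.
exists (B1 `|` B2); split; first exact: measurableU.
  apply/eqP; rewrite eq_le measure_ge0 andbT.
  rewrite (le_trans (measureU2 _ mB1 mB2))//.
  by rewrite [X in (X + _)%E]PB1 [X in (_ + X)%E]PB2 adde0.
move=> y /not_orP[y1 y2].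
have {}y1 : (\int[P]_x (h y x ^+ 4)%:E \is a fin_num)%E.
  by apply: contrapT => H; apply: y1; apply: H1 => /=; apply: contra_not H; apply.
have {}y2 : ('E_P[fun x => h x y] = 0)%E.
  by apply: contrapT => H; apply: y2; apply: H2.
have mhy : measurable_fun [set: T] (h y).
  rewrite [X in measurable_fun _ X](_ : _ = (fun w => h w.1 w.2) \o pair y)//.
  by apply: measurableT_comp => //; exact: measurable_pair1.
split.
  apply: ge0_integrableR; first exact: measurable_funX.
    by move=> x; rewrite exprn_even_ge0.
  by rewrite -ge0_fin_numE//; apply: integral_ge0 => x _; exact: (ge4 (y, x)).
have -> : h y = h ^~ y by apply/funext => x.
by move: y2; rewrite unlock /Rintegral => ->.
Qed.

(** The bad sections form a null set, so erasing them preserves the second moment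
    and can only decrease the others. *)
Lemma regularise : exists B : set T, [/\ measurable B, P B = 0%E,
  regular_kernel P (erase B) & [/\ moment2 P h = (\int[P]_x sqnorm P (erase B) x)%:E,
  ((\int[P]_x pow4norm P (erase B) x)%:E <= moment4 P h)%E &
  ((\int[P]_x (sqnorm P (erase B) x ^+ 2))%:E <= moment22 P h)%E]].
Proof.
have [B [mB PB HB]] := bad_sections.
have me := measurable_erase mB.
have mex x : measurable_fun [set: T] (erase B x).
  rewrite [X in measurable_fun _ X](_ : _ = (fun w => erase B w.1 w.2) \o pair x)//.
  by apply: measurableT_comp => //; exact: measurable_pair1.
have e4 x : integrableR P (fun z => erase B x z ^+ 4).
  have [Bx|Bx] := pselect (B x).
    rewrite (_ : (fun z => _) = fun=> 0); first exact: integrableR_cst.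
    by apply/funext => z; rewrite erase0// expr0n.
  apply: (integrableR_dom _ _ (HB x Bx).1); first exact: measurable_funX.
  by move=> z; rewrite ger0_norm ?exprn_even_ge0//; exact: erase_le.
have e0 x : \int[P]_z erase B x z = 0.
  have [Bx|Bx] := pselect (B x).
    by under eq_Rintegral do rewrite erase0//; rewrite Rintegral_prob_cst.
  rewrite -(HB x Bx).2; congr fine; apply: ae_eq_integral => //.
  - exact/measurable_EFinP.
  - apply/measurable_EFinP.
    rewrite [X in measurable_fun _ X](_ : _ = (fun w => h w.1 w.2) \o pair x)//.
    by apply: measurableT_comp => //; exact: measurable_pair1.
  - exists B; split => // z /= H; apply: contrapT => Bz; apply: H => _.
    by rewrite eraseE.
have ge4 (w : T * T) : (0 <= (erase B w.1 w.2 ^+ 4)%:E)%E.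
  by rewrite lee_fin exprn_even_ge0.
have mh4 : measurable_fun [set: T * T] (fun w => (h w.1 w.2 ^+ 4)%:E).
  by apply/measurable_EFinP; exact: measurable_funX.
have me4 : measurable_fun [set: T * T] (fun w => (erase B w.1 w.2 ^+ 4)%:E).
  by apply/measurable_EFinP; exact: measurable_funX.
have p4E : (\int[P]_x (pow4norm P (erase B) x)%:E =
    \int[P \x P]_w (erase B w.1 w.2 ^+ 4)%:E)%E.
  rewrite (fubini_tonelli1 _ me4 ge4); apply: eq_integral => x _.
  by rewrite /fubini_F/= (EFin_Rintegral (e4 x)).
have p4le : (\int[P]_x (pow4norm P (erase B) x)%:E <= moment4 P h)%E.
  rewrite p4E; apply: ge0_le_integral => //.
  by move=> w _; rewrite lee_fin; exact: erase_le.
have I4 : integrableR P (pow4norm P (erase B)).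
  apply: ge0_integrableR; last exact: le_lt_trans h4.
    apply: (@measurable_Rintegral _ _ T T R P (fun w => erase B w.1 w.2 ^+ 4)) => //.
    exact: measurable_funX.
  by move=> x; apply: Rintegral_ge0 => z _; rewrite exprn_even_ge0.
have K : regular_kernel P (erase B).
  by split => //; exact: eraseC.
exists B; split => //; split.
- have me2 : measurable_fun [set: T * T] (fun w => (erase B w.1 w.2 ^+ 2)%:E).
    by apply/measurable_EFinP; exact: measurable_funX.
  have ge2 (w : T * T) : (0 <= (erase B w.1 w.2 ^+ 2)%:E)%E by rewrite lee_fin sqr_ge0.
  rewrite -(EFin_Rintegral (integrable_sqnorm me e4 I4)).
  transitivity (\int[P \x P]_w (erase B w.1 w.2 ^+ 2)%:E)%E.
    apply: ae_eq_integral => //.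
      by apply/measurable_EFinP; exact: measurable_funX.
    have [N [mN PN HN]] := ae_prod_erase mB PB.
    exists N; split => // w /= H; apply: HN => /= E; apply: H => _.
    by rewrite E.
  rewrite (fubini_tonelli1 _ me2 ge2); apply: eq_integral => x _.
  by rewrite /fubini_F/= (EFin_Rintegral (integrable_section_sqr me e4 x)).
- by rewrite -(EFin_Rintegral I4).
- pose PP : probability (T * T)%type R := (P \x P)%E.
  pose F (g : T -> T -> R) (w : T * T * T) := g w.1.1 w.2 ^+ 2 * g w.1.2 w.2 ^+ 2.
  have mF (g : T -> T -> R) : measurable_fun [set: T * T] (fun w => g w.1 w.2) ->
      measurable_fun [set: T * T * T] (F g).
    move=> mg; apply: measurable_funM; apply: measurable_funX.
      rewrite [X in measurable_fun _ X](_ : _ = (fun w => g w.1 w.2) \o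
        (fun w : T * T * T => (w.1.1, w.2)))//.
      apply: measurableT_comp => //; apply: measurable_fun_pair => //.
      exact: measurableT_comp.
    rewrite [X in measurable_fun _ X](_ : _ = (fun w => g w.1 w.2) \o
      (fun w : T * T * T => (w.1.2, w.2)))//.
    apply: measurableT_comp => //; apply: measurable_fun_pair => //.
    exact: measurableT_comp.
  have F0 (g : T -> T -> R) w : 0 <= F g w by rewrite mulr_ge0 ?sqr_ge0.
  have [IW EW] := sqr_tensor_moment me (eraseC B) e4 I4.
  have FE (w : T * T) : (fun z => F (erase B) (w, z)) =
      fun z => (erase B w.1 z * erase B w.2 z) ^+ 2.
    by apply/funext => z; rewrite exprMn.
  have I1 (w : T * T) : integrableR P (fun z => F (erase B) (w, z)).
    apply: integrableR_mul; try (by apply: measurable_funX; exact: mex);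
    by under eq_fun do rewrite -exprM; exact: e4.
  have I2 : integrableR PP (fun w => \int[P]_z F (erase B) (w, z)).
    by under eq_fun do rewrite FE.
  have [I E] := Tonelli_integrableR (mF _ me) (F0 _) I1 I2.
  have -> : \int[P]_x (sqnorm P (erase B) x ^+ 2) = \int[(PP \x P)%E]_z F (erase B) z.
    by rewrite E -EW; apply: eq_Rintegral => w _; rewrite FE.
  rewrite -(EFin_Rintegral I); apply: ge0_le_integral => //.
  + by move=> w _; rewrite lee_fin; exact: F0.
  + by apply/measurable_EFinP; exact: mF.
  + by apply/measurable_EFinP; exact: (mF h).
  + move=> w _; rewrite lee_fin; apply: ler_pM; rewrite ?sqr_ge0//; exact: erase_le.
Qed.

(** The statistic only evaluates the kernel at pairs of sample points. *)
Lemma T_stat_erase (B : set T) n (X : n.-tuple T) : (forall i, ~ B (tnth X i)) ->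
  T_stat (erase B) X = T_stat h X.
Proof.
move=> XB.
have fE i : f_stat (erase B) X (tnth X i) = f_stat h X (tnth X i).
  by congr (_ * _); apply: eq_bigr => j _; rewrite eraseE.
have bE : fbar_stat (erase B) X = fbar_stat h X.
  by congr (_ * _); apply: eq_bigr => j _; rewrite fE.
rewrite /T_stat bE; congr (_ / Num.sqrt (_ * _)).
by apply: eq_bigr => j _; rewrite fE.
Qed.

Lemma pr_T_stat_erase (B : set T) n z : measurable B -> P B = 0%E ->
  pr (iid_law P n) [set X | T_stat (erase B) X <= z] =
  pr (iid_law P n) [set X | T_stat h X <= z].
Proof.
move=> mB PB.
have mN := @measurable_exists_tnth _ T n B mB.
have N0 := iid_null n mB PB.
have mS (g : T -> T -> R) : measurable_fun [set: T * T] (fun w => g w.1 w.2) ->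
    measurable [set X : n.-tuple T | T_stat g X <= z].
  by move=> mg; apply: measurable_RV_le; exact: measurable_T_stat.
have m1 := mS _ mh; have m2 := mS _ (measurable_erase mB).
have N0' : pr (iid_law P n) [set t | exists i, B (tnth t i)] = 0 by rewrite /pr N0.
apply/eqP; rewrite eq_le; apply/andP; split.
  rewrite -[leRHS]addr0 -N0'; apply: (le_trans _ (pr_setU _ m1 mN)).
  apply: le_pr => //; first exact: measurableU.
  move=> X /= HX; have [|/forallNP XB] := pselect (exists i, B (tnth X i)); first by right.
  by left; rewrite -(T_stat_erase XB).
rewrite -[leRHS]addr0 -N0'; apply: (le_trans _ (pr_setU _ m2 mN)).
apply: le_pr => //; first exact: measurableU.
move=> X /= HX; have [|/forallNP XB] := pselect (exists i, B (tnth X i)); first by right.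
by left; rewrite (T_stat_erase XB).
Qed.

End regularisation.

(** * Uniformity and p-values *)

Section Phi_quantile.
Context {R : realType}.

Lemma Phi_dist (x y : R) : `|Phi x - Phi y| <= `|x - y|.
Proof.
wlog xy : x y / x <= y => [H|].
  by have [/H//|/ltW /H] := leP x y; rewrite distrC [leRHS]distrC.
rewrite distrC [leRHS]distrC (ger0_norm (_ : 0 <= y - x)) ?subr_ge0//.
by rewrite ger0_norm ?Phi_lipschitz// subr_ge0; exact: Phi_nondecreasing.
Qed.

Lemma continuous_Phi : continuous (@Phi R).
Proof.
move=> x; apply/cvgrPdist_lt => e e0; near=> y.
apply: le_lt_trans (Phi_dist x y) _.
by near: y; exact: cvgr_dist_lt.
Unshelve. all: by end_near. Qed.

Lemma Phi_tails (K : R) : 0 < K -> Phi (- K) <= K ^- 2 /\ 1 - K ^- 2 <= Phi K.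
Proof.
move=> K0; have I2 := @integrable_gauss_pow R 2; have [_ E2] := @gauss_moments R.
have sq0 (x : R) : 0 <= x ^+ 2 by exact: sqr_ge0.
have K2 : 0 < K ^+ 2 by rewrite exprn_gt0.
split.
  have := @markov_pr _ _ R gauss [set x : R | x <= - K] _ _ (measurable_le _) K2 I2 sq0.
  rewrite -PhiE E2 div1r; apply => x /= xK.
  by rewrite -(sqrrN x) lerXn2r ?nnegrE ?(ltW K0)//; lra.
have mC : measurable (~` [set x : R | x <= K]) by apply: measurableC; exact: measurable_le.
have : pr gauss (~` [set x : R | x <= K]) <= K ^- 2.
  have := @markov_pr _ _ R gauss _ _ _ mC K2 I2 sq0; rewrite E2 div1r; apply.
  move=> x /= /negP; rewrite -ltNge => xK.
  by rewrite lerXn2r ?nnegrE ?(ltW K0)// ltW// (lt_trans K0).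
by rewrite pr_setC -?PhiE; [lra|exact: measurable_le].
Qed.

Lemma Phi_quantile (y : R) : 0 < y < 1 -> exists z : R, Phi z = y.
Proof.
move=> /andP[y0 y1]; pose w := Num.min y (1 - y).
have w0 : 0 < w by rewrite lt_min y0 subr_gt0.
pose K : R := 1 + w^-1.
have K1 : 1 <= K by rewrite lerDl invr_ge0 ltW.
have K0 : 0 < K by exact: lt_le_trans K1.
have Kw : K ^- 2 <= w.
  rewrite -[leRHS]invrK lef_pV2 ?posrE ?exprn_gt0 ?invr_gt0//.
  apply: (@le_trans _ _ K); first by rewrite lerDr.
  by rewrite expr2 ler_peMr// ltW.
have [t1 t2] := Phi_tails K0.
have wy : w <= y by rewrite ge_min lexx.
have wy' : w <= 1 - y by rewrite ge_min lexx orbT.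
have [|||c _ Ec] := @IVT R (@Phi R) (- K) K y.
- by lra.
- by apply: continuous_subspaceT; exact: continuous_Phi.
- by rewrite ge_min le_max; apply/andP; split; apply/orP; [left|right]; lra.
- by exists c.
Qed.

End Phi_quantile.

Lemma half_split n : (2 <= n)%N -> [/\ n = (n./2 + (n - n./2))%N, (0 < n./2)%N,
  (0 < n - n./2)%N, (n - n./2 <= 2 * n./2)%N & (n <= 2 * (n - n./2))%N].
Proof. by move=> n2; have := odd_double_half n; case: (odd n) => /= ?; split; lia. Qed.

(** The second half is at least half of the sample; replacing [n] by its size in the
    moment ratio costs the factor [4]. *)
Lemma T_stat_clt (R : realType) (eps : R) : 0 < eps -> exists2 eta : R, 0 < eta &
  forall d (T : measurableType d) (P : probability T R) (h : T -> T -> R) n,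
  measurable_fun [set: T * T] (fun w => h w.1 w.2) ->
  (forall x y, h x y = h y x) -> (2 <= n)%N ->
  (0 < moment2 P h < +oo)%E ->
  {ae P, forall y, ('E_P[fun x => h x y] = 0)%E} ->
  (moment_ratio P h n <= eta%:E)%E ->
  forall z, `|pr (iid_law P n) [set X | T_stat h X <= z] - Phi z| <= eps.
Proof.
move=> eps0; have [eta eta0 CLT] := regular_T_stat_clt eps0.
exists (eta / 4); first by rewrite divr_gt0.
move=> d T P h n mh hC n2 /andP[m2_gt0 m2_lty] h0 ratio z.
have n0 : 0 < n%:R :> R by rewrite ltr0n (leq_trans _ n2).
have [m2 m2E] : exists r, moment2 P h = r%:E.
  by exists (fine (moment2 P h)); rewrite fineK// ge0_fin_numE// ltW.
have m20 : 0 < m2 by rewrite -lte_fin -m2E.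
have m4_ge0 : (0 <= moment4 P h)%E.
  by apply: integral_ge0 => w _; rewrite lee_fin exprn_even_ge0.
have m22_ge0 : (0 <= moment22 P h)%E.
  by apply: integral_ge0 => w _; rewrite lee_fin mulr_ge0// sqr_ge0.
have nm0 : 0 < n%:R * m2 ^+ 2 by rewrite mulr_gt0// exprn_gt0.
have {ratio} : (moment4 P h * (n%:R^-1)%:E + moment22 P h <=
    (eta / 4 * (n%:R * m2 ^+ 2))%:E)%E.
  move: ratio; rewrite /moment_ratio m2E -EFin_expe -EFinM !inver !gt_eqF//.
  by rewrite lee_pdivrMr// -EFinM.
have [m22 m22E] : exists r, moment22 P h = r%:E \/ moment22 P h = +oo%E.
  by case: (moment22 P h) m22_ge0 => [r _||//]; [exists r; left|exists 0; right].
have [m4 m4E] : exists r, moment4 P h = r%:E \/ moment4 P h = +oo%E.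
  by case: (moment4 P h) m4_ge0 => [r _||//]; [exists r; left|exists 0; right].
case: m4E => [m4E|->]; last first.
  by rewrite gt0_mulye ?lte_fin ?invr_gt0// addye ?leye_eq// gt_eqF// (lt_le_trans _ m22_ge0).
case: m22E => [m22E|->]; last by rewrite m4E -EFinM addey.
rewrite m4E m22E -EFinM -EFinD lee_fin => ratio.
rewrite m4E lee_fin in m4_ge0.
have h4 : (moment4 P h < +oo)%E by rewrite m4E ltry.
have [B [mB PB K [e2 e4 e22]]] := regularise mh hC h0 h4.
rewrite -(pr_T_stat_erase mh n z mB PB).
pose m := n./2; pose k := (n - m)%N.
have [mn m_gt0 k_gt0 k2m nk] : [/\ n = (m + k)%N, (0 < m)%N, (0 < k)%N,
  (k <= 2 * m)%N & (n <= 2 * k)%N] by exact: half_split.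
have mk : (m + k)./2 = m by rewrite -mn.
have nkR : n%:R <= 2 * k%:R :> R by rewrite -natrM ler_nat.
have k0 : 0 < k%:R :> R by rewrite ltr0n.
rewrite mn; apply: (CLT d T P (erase h B) m k K) => //.
- by rewrite k_gt0.
- by rewrite -lte_fin -e2 m2E.
move: e2 e4 e22; rewrite m2E m4E m22E !lee_fin => -[<-] e4 e22.
rewrite m22E lee_fin in m22_ge0.
have m4kn : m4 / k%:R <= 2 * (m4 / n%:R).
  rewrite mulrCA ler_wpM2l// -[2]invrK -invfM lef_pV2 ?posrE ?divr_gt0//.
    by rewrite mulrC ler_pdivrMr// mulrC.
  by rewrite mulr_gt0 ?invr_gt0.
have h1 : (\int[P]_x pow4norm P (erase h B) x) / k%:R <= m4 / k%:R.
  by rewrite ler_wpM2r// invr_ge0 ltW.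
have h2 : n%:R * m2 ^+ 2 <= 2 * k%:R * m2 ^+ 2 by rewrite ler_wpM2r ?sqr_ge0.
have h3 : eta * (n%:R * m2 ^+ 2) <= eta * (2 * k%:R * m2 ^+ 2) by rewrite ler_pM2l.
by lra.
Qed.

Lemma limn_esup_le_near (R : realType) (u : (\bar R)^nat) (l : \bar R) :
  (\forall n \near \oo, (u n <= l)%E) -> (limn_esup u <= l)%E.
Proof.
move=> [N _ H]; rewrite limn_esup_lim; apply: lime_le; first exact: is_cvg_esups.
exists N => // n /= Nn; apply: ub_ereal_sup => _ [k /= nk <-].
by apply: H; exact: leq_trans nk.
Qed.

(** A quantity that vanishes along every sequence of members vanishes uniformly:
    otherwise, a sequence of violators could be chosen. *)
Lemma uniform_of_sequences (R : realType) (d : nat -> measure_display)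
    (S : forall n : nat, measurableType (d n))
    (calP : forall n : nat, set (probability (S n) R))
    (F : forall n, probability (S n) R -> \bar R) :
  (forall n, calP n !=set0) ->
  (forall Pn : (forall n, probability (S n) R), (forall n, calP n (Pn n)) ->
    (F n (Pn n)) @[n --> \oo] --> 0%E) ->
  forall eta : R, 0 < eta ->
  \forall n \near \oo, forall P, calP n P -> (F n P <= eta%:E)%E.
Proof.
move=> calP_neq0 H eta eta0.
have ex n : exists P, calP n P /\
    ((exists2 P', calP n P' & ~ (F n P' <= eta%:E)%E) -> ~ (F n P <= eta%:E)%E).
  have [[P' P'n HP']|nP] := pselect (exists2 P', calP n P' & ~ (F n P' <= eta%:E)%E).
    by exists P'.
  by have [P Pn] := calP_neq0 n; exists P; split => // /nP.
pose Pn n := projT1 (cid (ex n)).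
have PnP n := projT2 (cid (ex n)).
have /fine_cvgP[fin /cvgr0Pnorm_lt/(_ _ eta0) small] := H Pn (fun n => (PnP n).1).
apply: filterS2 fin small => n fin small P nP; apply: contrapT => viol.
have [_ /(_ (ex_intro2 _ _ P nP viol))] := PnP n; apply.
rewrite -/(Pn n) -(fineK fin) lee_fin; apply: ltW.
exact: le_lt_trans (ler_norm _) small.
Qed.

(** If [z] is the normal quantile of level [1 - alpha - eps / 2], the event excludes
    [X <= z] because [Phi] is monotone. *)
Lemma p_value_le (R : realType) d (T : measurableType d) (Q : probability T R)
    (X : T -> R) (alpha eps : R) : measurable_fun [set: T] X -> 0 <= alpha -> 0 < eps ->
  (forall z, `|pr Q [set x | X x <= z] - Phi z| <= eps / 2) ->
  (Q [set x | (1 - Phi (X x) <= alpha)%R] <= (alpha + eps)%:E)%E.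
Proof.
move=> mX a0 e0 H.
have mE : measurable [set x | 1 - Phi (X x) <= alpha].
  apply: measurable_RV_le; apply: measurable_funB => //.
  by apply: measurableT_comp => //; apply: continuous_measurable_fun; exact: continuous_Phi.
rewrite -EFin_pr// lee_fin.
have [ae|ae] := leP 1 (alpha + eps / 2).
  by apply: le_trans (pr_le1 _ mE) _; lra.
have [|z Ez] := @Phi_quantile R (1 - alpha - eps / 2); first by apply/andP; split; lra.
have mz := measurable_RV_le mX z.
apply: (@le_trans _ _ (pr Q (~` [set x | X x <= z]))).
  apply: le_pr => //; first exact: measurableC.
  move=> x /= h1 h2; have := Phi_nondecreasing h2; rewrite Ez; lra.
rewrite pr_setC//; have := H z; rewrite Ez ler_norml => /andP[? _]; lra.
Qed.

Unset Implicit Arguments.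

Theorem theorem4p2 (R : realType) (d : nat -> measure_display)
  (S : forall n : nat, measurableType (d n))
  (h : forall n : nat, S n -> S n -> R)
  (calP : forall n : nat, set (probability (S n) R))
  (h_meas : forall n : nat,
    measurable_fun [set: S n * S n] (fun w => h n w.1 w.2))
  (h_sym : forall (n : nat) (x y : S n), h n x y = h n y x)
  (calP_neq0 : forall n : nat, calP n !=set0)
  (h_moment2 : forall (n : nat) (P : probability (S n) R), calP n P ->
    (0 < moment2 P (h n) < +oo)%E)
  (hyp : forall Pn : (forall n : nat, probability (S n) R),
    (forall n : nat, calP n (Pn n)) ->
    (forall n : nat,
      {ae Pn n, forall y : S n, ('E_(Pn n)[fun x => h n x y] = 0)%E}) /\
    ((fun n : nat => moment_ratio (Pn n) (h n) n) @ \oo --> 0%E)) :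
  ((fun n : nat =>
      ereal_sup [set ereal_sup [set
        (`| iid_law P n [set X | (T_stat (h n) X <= z)%R] - (Phi z)%:E |)%E
        | z in [set: R]] | P in calP n])
    @ \oo --> 0%E) /\
  (forall alpha : R, 0 <= alpha <= 1 ->
    (limn_esup (fun n : nat =>
      ereal_sup [set
        iid_law P n [set X | (1 - Phi (T_stat (h n) X) <= alpha)%R]
        | P in calP n]) <= alpha%:E)%E).
Proof.
have mT n := measurable_T_stat (h_meas n) (n := n).
have mean0 n P : calP n P -> {ae P, forall y, ('E_P[fun x => h n x y] = 0)%E}.
  move=> nP.
  pose Pn k := projT1 (cid (calP_neq0 k)).
  have PnP k : calP k (Pn k) := projT2 (cid (calP_neq0 k)).
  (* the sequence that passes through [P] at time [n] *)
  pose Qn k : probability (S k) R :=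
    match pselect (n = k) with
    | left e => ecast i (probability (S i) R) e P
    | right _ => Pn k
    end.
  have QnP k : calP k (Qn k).
    by rewrite /Qn; case: pselect => // e; case: _ / e.
  have [+ _] := hyp Qn QnP; move=> /(_ n).
  rewrite /Qn; case: pselect => // e.
  by rewrite (Prop_irrelevance e erefl).
have unif (eps : R) : 0 < eps -> \forall n \near \oo, forall P, calP n P ->
    forall z, `|pr (iid_law P n) [set X | T_stat (h n) X <= z] - Phi z| <= eps.
  move=> eps0; have [eta eta0 CLT] := T_stat_clt eps0.
  have := @uniform_of_sequences R d S calP
    (fun n P => moment_ratio P (h n) n) calP_neq0 (fun Pn PnP => (hyp Pn PnP).2) eta eta0.
  apply: filterS2 (nbhs_infty_ge 2) => n n2 H P nP z.
  by apply: CLT => //; [exact: h_moment2|exact: mean0|exact: H].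
have mle n z : measurable [set X : n.-tuple (S n) | T_stat (h n) X <= z].
  by apply: measurable_RV_le; exact: mT.
split.
  apply: limn_esup_le_cvg; last first.
    move=> n; have [P nP] := calP_neq0 n.
    apply: ereal_sup_ge; exists (ereal_sup [set (`| iid_law P n [set X |
      (T_stat (h n) X <= z)%R] - (Phi z)%:E |)%E | z in [set: R]]); first by exists P.
    apply: ereal_sup_ge.
    by exists (`| iid_law P n [set X | (T_stat (h n) X <= 0)%R] - (Phi 0)%:E |)%E => //;
      exists 0.
  apply/lee_addgt0Pr => eps eps0; rewrite add0e; apply: limn_esup_le_near.
  apply: filterS (unif _ eps0) => n H.
  apply: ub_ereal_sup => _ [P nP <-]; apply: ub_ereal_sup => _ [z _ <-].
  by rewrite -EFin_pr// -EFinB lee_fin; exact: H.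
move=> alpha /andP[a0 _].
apply/lee_addgt0Pr => eps eps0; apply: limn_esup_le_near.
have eps2 : 0 < eps / 2 by rewrite divr_gt0.
apply: filterS (unif _ eps2) => n H; apply: ub_ereal_sup => _ [P nP <-].
by apply: p_value_le => // z; exact: H.
Qed.
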